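(* Fix $\beta>0$ and $h\in\mathbb{R}$, and suppose there is a number $q<1$ and a constant $C_0$ depending only on $\beta,h$ such that for every $N$, $$\mathbb{E}\langle (R_{12}-q)^4\rangle \le \frac{C_0}{N^2}.$$ For $1\le i\le N$ let $$r_i := \frac{1}{\sqrt{N}}\sum_{j\ne i} g_{ij}\langle\sigma_j\rangle - \beta(1-q)\langle\sigma_i\rangle,\qquad p_i := \frac{e^{\beta r_i+h}}{e^{\beta r_i+h}+e^{-\beta r_i-h}},$$ and let $\nu_i$ be the random probability measure on $\mathbb{R}$ with density $$p_i\,\phi_{r_i+\beta(1-q),\,1-q} + (1-p_i)\,\phi_{r_i-\beta(1-q),\,1-q}.$$ Let $\ell_i := \frac{1}{\sqrt N}\sum_{j\ne i} g_{ij}\sigma_j$ be the local field at site $i$. Then there is a constant $C(\beta,h)$ depending only on $\beta$ and $h$ (and the constants in the hypothesis) such that for every $N$, every bounded measurable $u:\mathbb{R}\to\mathbb{R}$ and every $1\le i\le N$, $$\mathbb{E}\Bigl(\langle u(\ell_i)\rangle - \int_{\mathbb{R}} u(x)\,\nu_i(dx)\Bigr)^2 \le \frac{C(\beta,h)\,\|u\|_\infty^2}{\sqrt N}.$$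
   Context: Sherrington–Kirkpatrick model: for a positive integer $N$, let $\Sigma_N=\{-1,1\}^N$ and let $g=(g_{ij})_{1\le i<j\le N}$ be i.i.d. standard Gaussian random variables (the disorder); set $g_{ji}:=g_{ij}$. Given $g$, the Gibbs measure on $\Sigma_N$ is $G_N(\sigma)=Z_N^{-1}\exp\bigl(\frac{\beta}{\sqrt N}\sum_{1\le i<j\le N} g_{ij}\sigma_i\sigma_j + h\sum_{i=1}^N\sigma_i\bigr)$, with $Z_N$ the normalizing constant. Replicas $\sigma^1,\sigma^2,\dots$ are independent samples from $G_N$ given $g$, and for a function $f$ of the disorder and of replicas, $\langle f(\sigma^1,\dots,\sigma^k)\rangle := \sum_{\sigma^1,\dots,\sigma^k} f(\sigma^1,\dots,\sigma^k)G_N(\sigma^1)\cdots G_N(\sigma^k)$ (quenched average, $g$ fixed). $\mathbb{E}$ denotes expectation over the disorder. The overlap is $R_{12}=\frac1N\sum_{i=1}^N\sigma^1_i\sigma^2_i$. For $\mu\in\mathbb{R}$, $s>0$, $\phi_{\mu,s^2}(x)=\frac{1}{\sqrt{2\pi}s}e^{-(x-\mu)^2/(2s^2)}$ is the Gaussian density with mean $\mu$ and variance $s^2$. *)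

(* Defs.v *)
From HB Require Import structures.
From mathcomp Require Import all_boot all_order all_algebra.
From mathcomp Require Import all_classical all_reals all_analysis.
Set Implicit Arguments. Unset Strict Implicit. Unset Printing Implicit Defensive.
Import Order.TTheory GRing.Theory Num.Theory.
Import numFieldNormedType.Exports.
Local Open Scope classical_set_scope.
Local Open Scope ring_scope.

Section SK.
Context {R : realType} {d : measure_display} {T : measurableType d} (N : nat).

Definition config := {ffun 'I_N -> bool}.
Definition spin (b : bool) : R := if b then 1 else -1.

(* disorder: only the entries g i j with i < j are used; g_ji := g_ij *)
Definition gsym (g : 'I_N -> 'I_N -> T -> R) (i j : 'I_N) (w : T) : R :=
  if (i < j)%N then g i j w else g j i w.

Definition SK_disorder (P : probability T R) (g : 'I_N -> 'I_N -> T -> R) : Prop :=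
  (forall i j : 'I_N, (i < j)%N -> measurable_fun setT (g i j)) /\
  (forall i j : 'I_N, (i < j)%N -> forall B : set R, measurable B ->
      P (g i j @^-1` B) = normal_prob 0 1 B) /\
  (forall (S : {set 'I_N * 'I_N}) (B : 'I_N * 'I_N -> set R),
      (forall k, k \in S -> (k.1 < k.2)%N) ->
      (forall k, measurable (B k)) ->
      P (\bigcap_(k in [set k | k \in S]) (g k.1 k.2 @^-1` B k)) =
      (\prod_(k in S) P (g k.1 k.2 @^-1` B k))%E).

Variables (beta h : R) (g : 'I_N -> 'I_N -> T -> R).

Definition hamil (w : T) (s : config) : R :=
  beta / Num.sqrt (N%:R) *
    (\sum_(i < N) \sum_(j < N | (i < j)%N) g i j w * spin (s i) * spin (s j))
  + h * \sum_(i < N) spin (s i).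

Definition Zpart (w : T) : R := \sum_(s : config) expR (hamil w s).
Definition Gibbs (w : T) (s : config) : R := expR (hamil w s) / Zpart w.

Definition gavg1 (f : config -> R) (w : T) : R := \sum_(s : config) f s * Gibbs w s.
Definition gavg2 (f : config -> config -> R) (w : T) : R :=
  \sum_(s1 : config) \sum_(s2 : config) f s1 s2 * Gibbs w s1 * Gibbs w s2.

Definition overlap (s1 s2 : config) : R :=
  N%:R^-1 * \sum_(i < N) spin (s1 i) * spin (s2 i).

Definition local_field (i : 'I_N) (w : T) (s : config) : R :=
  (Num.sqrt (N%:R))^-1 * \sum_(j < N | j != i) gsym g i j w * spin (s j).

Definition mag (j : 'I_N) (w : T) : R := gavg1 (fun s => spin (s j)) w.

Variable q : R.

Definition r_field (i : 'I_N) (w : T) : R :=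
  (Num.sqrt (N%:R))^-1 * (\sum_(j < N | j != i) gsym g i j w * mag j w)
  - beta * (1 - q) * mag i w.

Definition p_weight (i : 'I_N) (w : T) : R :=
  expR (beta * r_field i w + h) /
  (expR (beta * r_field i w + h) + expR (- (beta * r_field i w) - h)).

(* density of nu_i; normal_pdf m s is the Gaussian density with mean m and
   standard deviation s, so variance 1-q corresponds to s = sqrt(1-q) *)
Definition nu_density (i : 'I_N) (w : T) (x : R) : R :=
  p_weight i w * normal_pdf (r_field i w + beta * (1 - q)) (Num.sqrt (1 - q)) x
  + (1 - p_weight i w) *
    normal_pdf (r_field i w - beta * (1 - q)) (Num.sqrt (1 - q)) x.

Definition nu_integral (u : R -> R) (i : 'I_N) (w : T) : R :=
  fine (\int[lebesgue_measure]_(x in setT) (u x * nu_density i w x)%:E)%E.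

End SK.

Definition supnorm {R : realType} (u : R -> R) : R := sup (range (fun x => `|u x|)).

(* Main.v *)
(** Cavity method. Let [pi] be the Gibbs measure with the couplings of site [i]
removed (and spin [i] uniform); it is independent of the row [g i _], and
<F(l_i)> is the ratio of the [pi]-averages of [F(l) cosh(beta l + h)] and of
[cosh(beta l + h)]. For a fixed [pi], the local fields of two replicas form a
centred Gaussian pair whose covariance matrix is close to (1, q; q, 1) when the
overlap is close to [q]; expanding the square and comparing bivariate Gaussian
laws shows that the [pi]-average of [f(l)] is, in mean square over the row, within
[O(1/N + Delta)] of [E f(r + sqrt(1-q) z)], where [r] is the [pi]-average of
[l] and [Delta] the [pi]-mean of |overlap - q|. With [f = u cosh(beta . + h)],
tilting the Gaussian [z] turns the ratio of the two limits into the integral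
of [u] against the mixture centred at [r]. The same second-moment computation
applied to [(l - r -+ beta(1-q)) exp(+- beta l)] shows that [r] is close to [r_i],
and the mixture is Lipschitz in its centre. Finally [Delta] has mean
[O(N^(-1/2))]: the weights [pi] are Gibbs weights multiplied by [B exp(-+ (beta l + h))],
whose moments are bounded, so Young's inequality reduces to the fourth
moment of the overlap. If [q < 0] the hypothesis bounds [N], because the mean
overlap is nonnegative, so the trivial bound on the
difference suffices. *)

Require Import Defs.
From HB Require Import structures.
From mathcomp Require Import all_boot all_order all_algebra.
From mathcomp Require Import all_classical all_reals all_analysis.
From mathcomp Require Import measurable_realfun ring lra.
Import Order.TTheory GRing.Theory Num.Theory.
Import numFieldNormedType.Exports.
Local Open Scope classical_set_scope.
Local Open Scope ring_scope.

(** * Integration and Gaussian measures *)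

(** Two constraints shape the proof. Observables are merely bounded and measurable, so regularity
    always comes from the Gaussian: a perturbation is charged to a Gaussian density, through its
    logarithm or a Cameron-Martin tilt, never to [u]. And the final constant must serve all [N] and
    all probability spaces, so the comparison constant is fixed, as the property [compare_cst],
    before either appears. Almost all integrals are of nonnegative functions, with values in
    [0, +oo], so that Tonelli needs no integrability: signed quantities are split into parts or
    polarised, and a cross term is first added to the other side of an identity, then subtracted
    once everything is known to be finite. Quotients are avoided in the same spirit: the
    normalisation [cavB] is at least 1, so errors are estimated after multiplication by it and no
    inverse moment occurs. The rate N^(-1/2) is that of [cavDelta], an average of absolute overlap
    deviations, in which the bounds on the expected squared errors are affine. *)

Lemma measurable_integral1 {d1 d2} {T1 : measurableType d1} {T2 : measurableType d2}
    {R : realType} (m : {sigma_finite_measure set T1 -> \bar R}) {F : T1 * T2 -> \bar R} :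
  measurable_fun setT F -> (forall z, 0 <= F z)%E ->
  measurable_fun setT (fun y => \int[m]_x F (x, y))%E.
Proof. by move=> mF F0; exact: measurable_fun_fubini_tonelli_G. Qed.

Lemma measurable_integral2 {d1 d2} {T1 : measurableType d1} {T2 : measurableType d2}
    {R : realType} (m : {sigma_finite_measure set T2 -> \bar R}) {F : T1 * T2 -> \bar R} :
  measurable_fun setT F -> (forall z, 0 <= F z)%E ->
  measurable_fun setT (fun x => \int[m]_y F (x, y))%E.
Proof. by move=> mF F0; exact: measurable_fun_fubini_tonelli_F. Qed.

Lemma integral_swap {d1 d2} {T1 : measurableType d1} {T2 : measurableType d2}
    {R : realType} (m1 : {sigma_finite_measure set T1 -> \bar R})
    (m2 : {sigma_finite_measure set T2 -> \bar R}) {F : T1 * T2 -> \bar R} :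
  measurable_fun setT F -> (forall z, 0 <= F z)%E ->
  (\int[m2]_y \int[m1]_x F (x, y) = \int[m1]_x \int[m2]_y F (x, y))%E.
Proof. by move=> mF F0; rewrite (fubini_tonelli F mF F0). Qed.

Lemma integral_prod1 {d1 d2} {T1 : measurableType d1} {T2 : measurableType d2}
    {R : realType} (m1 : {sigma_finite_measure set T1 -> \bar R})
    (m2 : {sigma_finite_measure set T2 -> \bar R}) {F : T1 * T2 -> \bar R} :
  measurable_fun setT F -> (forall z, 0 <= F z)%E ->
  (\int[m1 \x m2]_z F z = \int[m1]_x \int[m2]_y F (x, y))%E.
Proof. by move=> mF F0; exact: (fubini_tonelli1 F mF F0). Qed.

Lemma integral_prod2 {d1 d2} {T1 : measurableType d1} {T2 : measurableType d2}
    {R : realType} (m1 : {sigma_finite_measure set T1 -> \bar R})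
    (m2 : {sigma_finite_measure set T2 -> \bar R}) {F : T1 * T2 -> \bar R} :
  measurable_fun setT F -> (forall z, 0 <= F z)%E ->
  (\int[m1 \x m2]_z F z = \int[m2]_y \int[m1]_x F (x, y))%E.
Proof. by move=> mF F0; exact: (fubini_tonelli2 F mF F0). Qed.

Definition pushmeas {d d'} {T : measurableType d} {U : measurableType d'}
    {R : realFieldType} (m : {measure set T -> \bar R}) {f : T -> U}
    (mf : measurable_fun [set: T] f) : {measure set U -> \bar R} :=
  measure_function_pushforward__canonical__measure_function_Measure m mf.

Section measurability.
Context {d} {T : measurableType d} {R : realType}.

Lemma measurable_pair {d1 d2} {T1 : measurableType d1} {T2 : measurableType d2}
    {f : T -> T1} {g : T -> T2} :
  measurable_fun setT f -> measurable_fun setT g ->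
  measurable_fun setT (fun x => (f x, g x)).
Proof. by move=> mf mg; apply/measurable_fun_pairP; split. Qed.

Lemma measurable_compT {d1 d2} {T1 : measurableType d1} {T2 : measurableType d2}
    {F : T1 -> T2} {f : T -> T1} :
  measurable_fun setT F -> measurable_fun setT f ->
  measurable_fun setT (fun x => F (f x)).
Proof. by move=> mF mf; exact: (measurableT_comp mF mf). Qed.

Lemma measurable_fun_expR {f : T -> R} :
  measurable_fun setT f -> measurable_fun setT (fun x => expR (f x)).
Proof. by move=> mf; exact: (measurable_compT (measurable_expR (R:=R))). Qed.

Lemma measurable_fun_EFin {f : T -> R} :
  measurable_fun setT f -> measurable_fun setT (fun x => (f x)%:E).
Proof. by move=> mf; exact/measurable_EFinP. Qed.

Lemma measurable_sec1 {d1 d2} {T1 : measurableType d1} {T2 : measurableType d2}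
    {F : T * T1 -> T2} y :
  measurable_fun setT F -> measurable_fun setT (fun x => F (x, y)).
Proof.
by move=> mF; exact: (measurable_compT mF (measurable_pair (@measurable_id _ _ _) (measurable_cst y))).
Qed.

Lemma measurable_sec2 {d1 d2} {T1 : measurableType d1} {T2 : measurableType d2}
    {F : T1 * T -> T2} x :
  measurable_fun setT F -> measurable_fun setT (fun y => F (x, y)).
Proof.
by move=> mF; exact: (measurable_compT mF (measurable_pair (measurable_cst x) (@measurable_id _ _ _))).
Qed.

End measurability.

Ltac mfun := repeat first
  [ exact: measurable_cst | exact: measurable_id | exact: measurable_fst
  | exact: measurable_snd | assumption
  | apply: measurable_fun_EFin | apply: measurable_fun_expR
  | apply: measurable_funD | apply: measurable_funB | apply: measurable_funN
  | apply: measurable_funM | apply: measurable_funX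
  | apply: measurable_pair ].

Section ge0_real_integral.
Context {d} {T : measurableType d} {R : realType} (m : {measure set T -> \bar R}).
Implicit Types f g : T -> R.

Lemma integralD_ge0 {f g} : measurable_fun setT f -> (forall x, 0 <= f x) ->
  measurable_fun setT g -> (forall x, 0 <= g x) ->
  (\int[m]_x (f x + g x)%:E = \int[m]_x (f x)%:E + \int[m]_x (g x)%:E)%E.
Proof.
move=> mf f0 mg g0; rewrite -ge0_integralD; first by [].
- exact: measurableT.
- by move=> x _; rewrite lee_fin.
- exact: measurable_fun_EFin.
- by move=> x _; rewrite lee_fin.
- exact: measurable_fun_EFin.
Qed.

Lemma integralZ_ge0 {f} (k : R) : measurable_fun setT f -> (forall x, 0 <= f x) ->
  0 <= k -> (\int[m]_x (k * f x)%:E = k%:E * \int[m]_x (f x)%:E)%E.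
Proof.
move=> mf f0 k0; rewrite -ge0_integralZl; first by [].
- exact: measurableT.
- exact: measurable_fun_EFin.
- by move=> x _; rewrite lee_fin.
- by rewrite lee_fin.
Qed.

Lemma integral_sum_ge0 (I : finType) (f : I -> T -> R) :
  (forall i, measurable_fun setT (f i)) -> (forall i x, 0 <= f i x) ->
  (\int[m]_x (\sum_i f i x)%:E = \sum_i \int[m]_x (f i x)%:E)%E.
Proof.
move=> mf f0; rewrite -ge0_integral_sum.
- by apply: eq_integral => x _; rewrite sumEFin.
- exact: measurableT.
- by move=> i; exact: measurable_fun_EFin.
- by move=> i x _; rewrite lee_fin.
Qed.

Lemma le_integral_ge0 {f g} : measurable_fun setT f -> (forall x, 0 <= f x) ->
  measurable_fun setT g -> (forall x, f x <= g x) ->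
  (\int[m]_x (f x)%:E <= \int[m]_x (g x)%:E)%E.
Proof.
move=> mf f0 mg fg; apply: ge0_le_integral.
- exact: measurableT.
- by move=> x _; rewrite lee_fin.
- exact: measurable_fun_EFin.
- exact: measurable_fun_EFin.
- by move=> x _; rewrite lee_fin.
Qed.

Lemma integral_real_ge0 {f} : (forall x, 0 <= f x) -> (0 <= \int[m]_x (f x)%:E)%E.
Proof. by move=> f0; apply: integral_ge0 => x _; rewrite lee_fin. Qed.

End ge0_real_integral.

Section gaussian.
Context {R : realType}.
Local Notation mu := (@lebesgue_measure R).
Implicit Types (a b m s x y : R) (f : R -> \bar R).

(** The Radon-Nikodym derivative of [normal_prob m s] and the explicit density have the same
    integral over every measurable set, hence agree almost everywhere, which makes the abstract
    change of measure explicit. *)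
Lemma ge0_integral_normal_prob m s {f} : measurable_fun [set: R] f ->
  (forall x, 0 <= f x)%E ->
  (\int[normal_prob m s]_x f x = \int[mu]_x (f x * (normal_pdf m s x)%:E))%E.
Proof.
move=> mf f0.
rewrite -(Radon_Nikodym_SigmaFinite.change_of_variables (normal_prob_dominates m s))//.
apply: ae_eq_integral => //.
- apply: emeasurable_funM => //; apply: (measurable_int mu).
  exact/Radon_Nikodym_SigmaFinite.f_integrable/normal_prob_dominates.
- by apply: emeasurable_funM => //; apply/measurable_EFinP; exact: measurable_normal_pdf.
- apply: ae_eqe_mul2l.
  apply: integral_ae_eq => //.
  + exact/Radon_Nikodym_SigmaFinite.f_integrable/normal_prob_dominates.
  + by apply/measurable_EFinP; exact: measurable_normal_pdf.
  + move=> E _ mE; rewrite -Radon_Nikodym_SigmaFinite.f_integral//.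
    exact: normal_prob_dominates.
Qed.

(** The image of Lebesgue measure under x -> a x + b, scaled by a, gives half-open intervals their
    length, so it is Lebesgue measure by uniqueness. *)
Lemma ge0_integral_affine {a} b {f} : 0 < a -> measurable_fun [set: R] f ->
  (forall x, 0 <= f x)%E ->
  (\int[mu]_x f (a * x + b)%R = (a^-1)%:E * \int[mu]_x f x)%E.
Proof.
move=> a0 mf f0.
have mphi : measurable_fun setT (fun x : measurableTypeR R => a * x + b : measurableTypeR R).
  by apply: measurable_funD => //; exact: measurable_funM.
pose phi (x : measurableTypeR R) : measurableTypeR R := a * x + b.
have a0' : 0 <= a by exact: ltW.
pose nu := mscale (NngNum a0') (pushmeas mu mphi).
have nuE A : measurable A -> mu A = nu A.
  apply: lebesgue_measure_unique => _ [[c d] _ <-].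
  transitivity (a%:E * mu (phi @^-1` `]c, d]))%E; last by [].
  have -> : phi @^-1` `]c, d] = `](c - b) / a, (d - b) / a]%classic.
    apply/seteqP; split => x /=; rewrite !in_itv/= ltr_pdivrMr// ler_pdivlMr//;
      by rewrite ltrBlDr lerBrDr mulrC.
  rewrite -[(`]c, d])%classic]/([set` Interval (BRight c) (BRight d)]).
  rewrite !lebesgue_measure_itv/= !lte_fin ltr_pM2r ?invr_gt0// ltrD2r.
  case: ifPn => cd; last by rewrite mule0.
  rewrite -!EFinB -EFinM; congr EFin.
  by field; rewrite gt_eqF.
have -> : (\int[mu]_x f x = \int[nu]_x f x)%E.
  by apply: eq_measure_integral => A mA _; exact: nuE.
rewrite ge0_integral_mscale// ge0_integral_pushforward//=.
by rewrite muleA -EFinM mulVf ?gt_eqF// mul1e.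
Qed.

Lemma ge0_integral_std_normal m {s f} : 0 < s -> measurable_fun [set: R] f ->
  (forall x, 0 <= f x)%E ->
  (\int[normal_prob 0 1]_x f (m + s * x)%R = \int[normal_prob m s]_x f x)%E.
Proof.
move=> s0 mf f0.
have mg : measurable_fun setT (fun x : R => m + s * x).
  by apply: measurable_funD => //; exact: measurable_funM.
rewrite (ge0_integral_normal_prob m s mf f0).
rewrite (ge0_integral_normal_prob 0 1 (measurableT_comp mf mg) (fun x => f0 _)).
pose F x := (f x * (normal_pdf m s x)%:E)%E.
have F0 x : (0 <= F x)%E by rewrite mule_ge0// lee_fin normal_pdf_ge0.
have mF : measurable_fun setT F.
  by apply: emeasurable_funM => //; apply/measurable_EFinP; exact: measurable_normal_pdf.
have := ge0_integral_affine m s0 mF F0.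
move=> /(congr1 (fun z => s%:E * z)%E).
rewrite muleA -EFinM (mulfV (lt0r_neq0 s0)) mul1e => <-.
have mFc : measurable_fun setT (fun x : measurableTypeR R => F (s * x + m)).
  have mh : measurable_fun setT (fun x : R => s * x + m).
    by apply: measurable_funD => //; exact: measurable_funM.
  exact: (measurableT_comp mF mh).
rewrite -(ge0_integralZl mu measurableT mFc (fun x _ => F0 _)); last by rewrite lee_fin ltW.
apply: eq_integral => x _; rewrite /F addrC muleCA -EFinM; congr (_ * _%:E)%E.
rewrite !normal_pdfE ?oner_neq0 ?lt0r_neq0//.
rewrite /normal_peak /normal_fun.
have -> : (s ^+ 2 * pi *+ 2 : R) = s ^+ 2 * (pi *+ 2) by ring.
rewrite sqrtrM ?sqr_ge0// sqrtr_sqr gtr0_norm// invfM mulrA mulrA divff ?gt_eqF// mul1r.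
rewrite expr1n mul1r subr0; congr (_ * expR _).
by field; rewrite gt_eqF.
Qed.

Lemma integral_normal_cst m s (e : \bar R) : (0 <= e)%E ->
  (\int[normal_prob m s]_x e = e)%E.
Proof.
move=> e0; rewrite integral_cst// -[RHS]mule1.
by apply: f_equal; exact: probability_setT.
Qed.

Local Notation gam := (normal_prob (0 : R) 1).

Lemma ge0_integral_normalN {f} : measurable_fun [set: R] f ->
  (forall x, 0 <= f x)%E -> (\int[gam]_x f (- x)%R = \int[gam]_x f x)%E.
Proof.
move=> mf f0.
have mN : measurable_fun setT (-%R : R -> R) by [].
rewrite (ge0_integral_normal_prob 0 1 mf f0).
rewrite (ge0_integral_normal_prob 0 1 (measurableT_comp mf mN) (fun x => f0 _)).
pose F x := (f x * (normal_pdf 0 1 x)%:E)%E.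
have mF : measurable_fun [set: R] F.
  by apply: emeasurable_funM => //; apply/measurable_EFinP; exact: measurable_normal_pdf.
have mN' : measurable_fun [set: measurableTypeR R] (-%R : measurableTypeR R -> measurableTypeR R) by [].
transitivity (\int[pushmeas mu mN']_x F x)%E; last first.
  by apply: eq_measure_integral => A mA _; exact: lebesgue_measureN.
have F0 x : (0 <= F x)%E by rewrite mule_ge0// lee_fin normal_pdf_ge0.
rewrite (ge0_integral_pushforward mN' mu measurableT mF) => [|x _]; last exact: F0.
apply: eq_integral => x _; rewrite /F /=; congr (_ * _%:E)%E.
by rewrite !normal_pdfE ?oner_neq0// /normal_fun !subr0 sqrrN.
Qed.

End gaussian.

(** * Rotation invariance of the standard Gaussian plane *)

Section rotation.
Context {R : realType}.
Local Notation mu := (@lebesgue_measure R).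
Local Notation gam := (normal_prob (0 : R) 1).
Local Notation phi := (normal_pdf (0 : R) 1).

Lemma normal_pdf_rot (c s x y : R) : c ^+ 2 + s ^+ 2 = 1 ->
  phi (c * x - s * y) * phi (s * x + c * y) = phi x * phi y.
Proof.
move=> cs; rewrite !normal_pdfE ?oner_neq0// /normal_fun !subr0.
rewrite mulrACA [RHS]mulrACA -!expRD; congr (_ * expR _).
rewrite expr1n -!mulrDl; congr (_ / _).
transitivity (- ((c ^+ 2 + s ^+ 2) * (x ^+ 2 + y ^+ 2))); first ring.
by rewrite cs; ring.
Qed.

(** With c > 0 the rotation splits into two one-dimensional affine substitutions of slope c: x at
    fixed y, then, after Tonelli, y at fixed x. Their Jacobians cancel, and [normal_pdf_rot]
    restores the product density. *)
Lemma gauss_rotation_pos {c s : R} {F : R * R -> \bar R} :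
  0 < c -> c ^+ 2 + s ^+ 2 = 1 -> measurable_fun setT F -> (forall z, 0 <= F z)%E ->
  (\int[gam]_y \int[gam]_x F (c * x + s * y, - s * x + c * y)%R =
   \int[gam]_x \int[gam]_y F (x, y))%E.
Proof.
move=> c0 cs mF F0.
have cn0 : c != 0 by rewrite gt_eqF.
have mphi : measurable_fun [set: R] phi by exact: measurable_normal_pdf.
have phi0 x : (0 <= (phi x)%:E)%E by rewrite lee_fin normal_pdf_ge0.
have m2 : measurable_fun [set: R * R] (fun z => F (c * z.1 + s * z.2, - s * z.1 + c * z.2)).
  by apply: (measurable_compT mF); mfun.
(* Here [x] stands for the first rotated coordinate c x + s y. The second one, -s x + c y, becomes
   (y - s x) / c because c^2 + s^2 = 1. *)
pose K y x := (F (x, (y - s * x) / c)%R * (phi ((x - s * y) / c)%R)%:E)%E.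
have K0 y x : (0 <= K y x)%E by rewrite mule_ge0.
have mK : measurable_fun [set: R * R] (fun z => K z.2 z.1).
  apply: emeasurable_funM; first by apply: (measurable_compT mF); mfun.
  by apply: measurable_fun_EFin; apply: (measurable_compT mphi); mfun.
have mKy y : measurable_fun [set: R] (K y).
  exact: (measurable_sec1 y mK).
have mKx x : measurable_fun [set: R] (K ^~ x).
  exact: (measurable_sec2 x mK).
pose H (z : R * R) : \bar R := (K z.2 z.1 * (phi z.2)%:E)%E.
have H0 z : (0 <= H z)%E by rewrite mule_ge0.
have mH : measurable_fun setT H.
  apply: emeasurable_funM => //.
  by apply: measurable_fun_EFin; apply: (measurable_compT mphi); mfun.
transitivity (c^-1%:E * \int[mu]_y \int[mu]_x H (x, y))%E.
  rewrite (ge0_integral_normal_prob 0 1 (measurable_integral1 gam m2 (fun z => F0 _))); last first.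
    by move=> y; apply: integral_ge0 => x _; exact: F0.
  rewrite -ge0_integralZl; [|exact: measurableT| | |]; last first.
  - by rewrite lee_fin invr_ge0 ltW.
  - by move=> y _; apply: integral_ge0 => x _; exact: H0.
  - exact: (measurable_integral1 mu mH H0).
  apply: eq_integral => y _;
  rewrite (ge0_integral_normal_prob 0 1 (measurable_sec1 y m2) (fun x => F0 _)).
  rewrite [in RHS](_ : (fun x => H (x, y)) = fun x => K y x * (phi y)%:E)%E//.
  rewrite (ge0_integralZr mu measurableT (mKy y) (fun x _ => K0 _ _) (phi0 y)).
  rewrite muleA -(ge0_integral_affine (s * y) c0 (mKy y) (K0 y)).
  have E x : K y (c * x + s * y) =
      (F (c * x + s * y, - s * x + c * y)%R * (phi x)%:E)%E.
    rewrite /K; have -> : (c * x + s * y - s * y) / c = x by field.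
    suff -> : (y - s * (c * x + s * y)) / c = - s * x + c * y by [].
    transitivity (((c ^+ 2 + s ^+ 2) * y - s * (c * x + s * y)) / c); first by rewrite cs mul1r.
    by field.
  under [in RHS]eq_integral do rewrite E.
  by [].
have -> : (\int[mu]_y \int[mu]_x H (x, y) = \int[mu]_x \int[mu]_y H (x, y))%E.
  exact: (integral_swap mu mu mH H0).
rewrite -ge0_integralZl; [|exact: measurableT| | |]; last first.
- by rewrite lee_fin invr_ge0 ltW.
- by move=> y _; apply: integral_ge0 => x _; exact: H0.
- exact: (measurable_integral2 mu mH H0).
rewrite (ge0_integral_normal_prob 0 1 (measurable_integral2 gam mF F0)); last first.
  by move=> y; apply: integral_ge0 => x _; exact: F0.
apply: eq_integral => x _;
rewrite -(ge0_integral_affine (s * x) c0 (measurable_sec2 x mH) (fun y => H0 _)).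
have E y : H (x, c * y + s * x) = (F (x, y) * (phi y)%:E * (phi x)%:E)%E.
  rewrite /H /K/=.
  have -> : (x - s * (c * y + s * x)) / c = c * x - s * y.
    transitivity (((c ^+ 2 + s ^+ 2) * x - s * (c * y + s * x)) / c); first by rewrite cs mul1r.
    by field.
  have -> : (c * y + s * x - s * x) / c = y by field.
  by rewrite -!muleA -!EFinM mulrC (addrC (c * y)) mulrC normal_pdf_rot// mulrC.
rewrite (ge0_integral_normal_prob 0 1 (measurable_sec2 x mF) (fun x => F0 _)).
under eq_integral do rewrite E.
rewrite (ge0_integralZr mu measurableT _ _ (phi0 x)) => [//||y _]; last exact: mule_ge0.
apply: emeasurable_funM; first exact: measurable_sec2.
exact: measurable_fun_EFin.
Qed.

(** A Givens rotation: two linear forms in two independent normals are made triangular, the first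
    depending on one variable only. The three equations say that the covariance matrix is kept. The
    case a = 0 is separate because the rotation lemma wants c > 0; there swapping and reflecting the
    variables is enough. *)
Lemma gauss_merge (a b t e : R) : 0 <= a -> exists r t' e',
  [/\ 0 <= r, r ^+ 2 = a ^+ 2 + b ^+ 2, r * t' = a * t + b * e,
      t' ^+ 2 + e' ^+ 2 = t ^+ 2 + e ^+ 2 &
   forall F : R * R -> \bar R, measurable_fun setT F -> (forall z, 0 <= F z)%E ->
   (\int[gam]_z \int[gam]_x F (a * x + b * z, t * x + e * z)%R =
    \int[gam]_x \int[gam]_z F (r * x, t' * x + e' * z)%R)%E].
Proof.
rewrite le_eqVlt => /predU1P[<-|a0]; last first.
  set r := Num.sqrt (a ^+ 2 + b ^+ 2).
  have r2 : r ^+ 2 = a ^+ 2 + b ^+ 2 by rewrite sqr_sqrtr// addr_ge0 ?sqr_ge0.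
  have r0 : 0 < r by rewrite sqrtr_gt0 ltr_pwDl ?exprn_gt0 ?sqr_ge0.
  have rn0 : r != 0 by rewrite gt_eqF.
  exists r, ((a * t + b * e) / r), ((a * e - b * t) / r); split.
  - exact: ltW.
  - by [].
  - by field.
  - transitivity ((a ^+ 2 + b ^+ 2) * (t ^+ 2 + e ^+ 2) / r ^+ 2); first by field.
    by rewrite -r2; field.
  - move=> F mF F0.
    have cs : (a / r) ^+ 2 + (b / r) ^+ 2 = 1.
      by rewrite !expr_div_n -mulrDl -r2 divff// expf_neq0.
    have mG : measurable_fun [set: R * R]
        (fun z => F (r * z.1, (a * t + b * e) / r * z.1 + (a * e - b * t) / r * z.2)).
      by apply: (measurable_compT mF); mfun.
    have c0 : 0 < a / r by exact: divr_gt0.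
    rewrite -(gauss_rotation_pos c0 cs mG (fun z => F0 _)).
    apply: eq_integral => z _; apply: eq_integral => x _ /=.
    have -> : a * x + b * z = r * (a / r * x + b / r * z) by field.
    suff -> : t * x + e * z = (a * t + b * e) / r * (a / r * x + b / r * z) +
       (a * e - b * t) / r * (- (b / r) * x + a / r * z) by [].
    transitivity ((a ^+ 2 + b ^+ 2) * (t * x + e * z) / r ^+ 2); last by field.
    by rewrite -r2; field.
have [b0|b0|->] := ltgtP b 0.
- exists (- b), (- e), t; split.
  + by rewrite oppr_ge0 ltW.
  + by ring.
  + by ring.
  + by ring.
  + move=> F mF F0.
    have mG : measurable_fun [set: R * R] (fun z => F (- b * z.1, - e * z.1 + t * z.2)).
      by apply: (measurable_compT mF); mfun.
    rewrite -(ge0_integral_normalN (measurable_integral2 gam mG (fun z => F0 _))); last first.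
      by move=> x; apply: integral_ge0 => y _; exact: F0.
    apply: eq_integral => z _; apply: eq_integral => x _ /=.
    by rewrite mul0r add0r !mulrNN addrC.
- exists b, e, t; split.
  + exact: ltW.
  + by ring.
  + by ring.
  + by ring.
  + move=> F mF F0.
    apply: eq_integral => z _; apply: eq_integral => x _ /=.
    by rewrite mul0r add0r addrC.
- exists 0, t, e; split.
  + by [].
  + by ring.
  + by ring.
  + by [].
  + move=> F mF F0.
    have mG : measurable_fun [set: R * R] (fun z => F (0 * z.1, t * z.1 + e * z.2)).
      by apply: (measurable_compT mF); mfun.
    rewrite -(integral_swap gam gam mG (fun z => F0 _)).
    by apply: eq_integral => z _; apply: eq_integral => x _ /=; rewrite !mul0r addr0.
Qed.

End rotation.

(** * Gaussian pairs *)

Section bigauss.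
Context {R : realType}.
Local Notation gam := (normal_prob (0 : R) 1).

(* [X] and [Y] are jointly centred Gaussian with variances [v1], [v2] and
   covariance [c]; the law is given through a Cholesky factor so that
   degenerate covariances are allowed. *)
Definition bigauss {d} {T : measurableType d} (m : {measure set T -> \bar R})
    (X Y : T -> R) (v1 c v2 : R) : Prop :=
  [/\ measurable_fun setT X, measurable_fun setT Y &
   exists s t u, [/\ 0 <= s /\ 0 <= u, s ^+ 2 = v1, s * t = c, t ^+ 2 + u ^+ 2 = v2 &
   forall F : R * R -> \bar R, measurable_fun setT F -> (forall z, 0 <= F z)%E ->
   (\int[m]_w F (X w, Y w) = \int[gam]_x \int[gam]_y F (s * x, t * x + u * y)%R)%E]].

(** The pair is linear in three normals x, y, z. Rotating (x, z) removes z from the first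
    coordinate, and rotating (y, z) absorbs what is left of z in the second, which restores the
    Cholesky form. This is both the induction step for linear forms and the way smoothing variables
    are attached later. *)
Lemma bigauss_add {d} {T : measurableType d} (m : {sigma_finite_measure set T -> \bar R})
    (X Y : T -> R) (v1 c v2 a b : R) : bigauss m X Y v1 c v2 ->
  bigauss (m \x gam)%E (fun z => X z.1 + a * z.2) (fun z => Y z.1 + b * z.2)
    (v1 + a ^+ 2) (c + a * b) (v2 + b ^+ 2).
Proof.
move=> [mX mY [s [t [u [[s0 u0] sE tE uE law]]]]].
have mXa : measurable_fun [set: T * R] (fun z => X z.1 + a * z.2).
  by apply: measurable_funD; [exact: (measurable_compT mX)|mfun].
have mYb : measurable_fun [set: T * R] (fun z => Y z.1 + b * z.2).
  by apply: measurable_funD; [exact: (measurable_compT mY)|mfun].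
split => //.
have [r [t' [b' [r0 rE t'E b'E merge1]]]] := gauss_merge s a t b s0.
(* Only the single form u y + b' z matters here, so the second form of the merge is 0. *)
have [u' [x1 [x2 [u'0 u'E _ _ merge2]]]] := gauss_merge u b' 0 0 u0.
exists r, t', u'; split.
- by [].
- by rewrite rE sE.
- by rewrite t'E tE.
- by rewrite u'E addrA addrAC b'E -uE; ring.
move=> F mF F0.
have mG : measurable_fun [set: T * R] (fun z => F (X z.1 + a * z.2, Y z.1 + b * z.2)).
  by apply: (measurable_compT mF); apply: measurable_pair.
rewrite (integral_prod2 m gam mG (fun z => F0 _)) /=.
pose H (p : (R * R) * R) : \bar R :=
  F (s * p.2 + a * p.1.2, t * p.2 + u * p.1.1 + b * p.1.2).
have mH : measurable_fun [set: (R * R) * R] H.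
  apply: (measurable_compT mF); mfun.
  - exact: (measurable_compT measurable_snd measurable_fst).
  - exact: (measurable_compT measurable_fst measurable_fst).
  - exact: (measurable_compT measurable_snd measurable_fst).
have H0 p : (0 <= H p)%E by exact: F0.
have mHz z : measurable_fun [set: R * R] (fun p => H ((p.2, z), p.1)).
  by apply: (measurable_compT mH); mfun.
have mHi := measurable_integral2 gam mH H0.
have Hi0 p : (0 <= \int[gam]_x H (p, x))%E by exact: integral_ge0.
transitivity (\int[gam]_z \int[gam]_x \int[gam]_y H ((y, z), x))%E.
  apply: eq_integral => z _.
  have mFz : measurable_fun [set: R * R] (fun p => F (p.1 + a * z, p.2 + b * z)).
    by apply: (measurable_compT mF); mfun.
  exact: (law _ mFz (fun p => F0 _)).
transitivity (\int[gam]_z \int[gam]_y \int[gam]_x H ((y, z), x))%E.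
  apply: eq_integral => z _.
  by rewrite (integral_swap gam gam (mHz z) (fun p => H0 _)).
rewrite (integral_swap gam gam mHi Hi0).
transitivity (\int[gam]_y \int[gam]_x \int[gam]_z F (r * x, u * y + (t' * x + b' * z))%R)%E.
  apply: eq_integral => y _.
  have mFy : measurable_fun [set: R * R] (fun p => F (p.1, u * y + p.2)).
    by apply: (measurable_compT mF); mfun.
  rewrite -(merge1 _ mFy (fun p => F0 _)).
  apply: eq_integral => z _; apply: eq_integral => x _; rewrite /H/=.
  by congr (F (_, _)); ring.
pose K (p : (R * R) * R) : \bar R :=
  F (r * p.1.1, u * p.1.2 + (t' * p.1.1 + b' * p.2)).
have mK : measurable_fun [set: (R * R) * R] K.
  apply: (measurable_compT mF); mfun.
  - exact: (measurable_compT measurable_fst measurable_fst).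
  - exact: (measurable_compT measurable_snd measurable_fst).
  - exact: (measurable_compT measurable_fst measurable_fst).
have K0 p : (0 <= K p)%E by exact: F0.
rewrite (integral_swap gam gam (measurable_integral2 gam mK K0)); last first.
  by move=> p; exact: integral_ge0.
apply: eq_integral => x _.
have mKx : measurable_fun [set: R * R] (fun p => K ((x, p.1), p.2)).
  by apply: (measurable_compT mK); mfun.
rewrite -(integral_swap gam gam mKx (fun p => K0 _)).
have mFx : measurable_fun [set: R * R] (fun p => F (r * x, t' * x + p.1)).
  by apply: (measurable_compT mF); mfun.
transitivity (\int[gam]_z \int[gam]_y F (r * x, t' * x + (u * y + b' * z))%R)%E.
  apply: eq_integral => z _; apply: eq_integral => y _; rewrite /K/=.
  by congr (F (_, _)); ring.
rewrite (merge2 _ mFx (fun p => F0 _)).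
apply: eq_integral => y _ /=.
exact: integral_normal_cst.
Qed.

End bigauss.

(** * Independence and decoupling *)

Definition pushprob {d d'} {T : measurableType d} {U : measurableType d'}
    {R : realType} (P : probability T R) {f : T -> U}
    (mf : measurable_fun [set: T] f) : probability U R :=
  distribution P (HB.pack_for {mfun T >-> U} f (isMeasurableFun.Build _ _ _ _ _ mf)).

Lemma ge0_integral_pushprob {d d'} {T : measurableType d} {U : measurableType d'}
    {R : realType} (P : probability T R) {f : T -> U}
    (mf : measurable_fun [set: T] f) {F : U -> \bar R} :
  measurable_fun setT F -> (forall z, 0 <= F z)%E ->
  (\int[pushprob P mf]_y F y = \int[P]_x F (f x))%E.
Proof.
move=> mF F0.
rewrite (ge0_integral_pushforward mf P measurableT mF) => [|x _]; last exact: F0.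
by rewrite preimage_setT.
Qed.

Section decouple.
Context {R : realType} {d : measure_display} {T : measurableType d}.
Variables (P : probability T R) (K : finType) (X : K -> T -> R) (U : {set K}).
Hypothesis mX : forall k, k \in U -> measurable_fun setT (X k).
Hypothesis indep : forall (S : {set K}) (B : K -> set R), S \subset U ->
  (forall k, measurable (B k)) ->
  P (\bigcap_(k in [set k | k \in S]) (X k @^-1` B k)) =
  (\prod_(k in S) P (X k @^-1` B k))%E.

Definition rects (S : {set K}) : set (set T) :=
  [set A | exists B : K -> set R, (forall k, measurable (B k)) /\
     A = \bigcap_(k in [set k | k \in S]) (X k @^-1` B k)].

(* [T] equipped with the sigma-algebra generated by the [X k], [k \in S]. *)
Notation Tsub S := (g_sigma_algebraType (rects S)).

Lemma rects_setT S : rects S setT.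
Proof.
exists (fun=> setT); split => //.
by apply/esym/seteqP; split.
Qed.

Lemma rects_setI S : setI_closed (rects S).
Proof.
move=> A B [A' [mA ->]] [B' [mB ->]]; exists (fun k => A' k `&` B' k); split.
  by move=> k; exact: measurableI.
by rewrite -bigcapI; apply: eq_bigcapr => k _; rewrite preimage_setI.
Qed.

Lemma measurable_rects (S : {set K}) A : S \subset U -> rects S A -> measurable A.
Proof.
move=> SU [B [mB ->]]; apply: fin_bigcap_measurable => [|k kS].
  exact: (@sub_finite_set _ _ setT).
by rewrite -[X in measurable X]setTI; apply: mX => //; exact: (fintype.subsetP SU).
Qed.

Lemma measurable_idsub {S : {set K}} : S \subset U ->
  measurable_fun setT (id : T -> Tsub S).
Proof.
move=> SU; apply: (@measurability _ _ T (Tsub S) setT id (rects S)) => [//|_ [A rA <-]].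
by rewrite setTI preimage_id; exact: measurable_rects rA.
Qed.

Lemma measurable_Tsub {S : {set K}} k : k \in S -> measurable_fun setT (X k : Tsub S -> R).
Proof.
move=> kS _ B mB; rewrite setTI; apply: sub_sigma_algebra.
exists (fun k' => if k' == k then B else setT); split.
  by move=> k'; case: ifP.
apply/seteqP; split => [w Xw k' k'S /=|w /(_ k kS)/=]; last by rewrite eqxx.
by case: eqP => [->|].
Qed.

(** The two families of sets are glued into one family over the union of [S1] and [S2], to which the
    product formula applies. *)
Lemma rects_indep {S1 S2 : {set K}} A C : S1 \subset U -> S2 \subset U ->
  (forall k, k \in S1 -> k \notin S2) -> rects S1 A -> rects S2 C -> P (A `&` C) = (P A * P C)%E.
Proof.
move=> S1U S2U dS [B1 [mB1 ->]] [B2 [mB2 ->]].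
pose B k := if k \in S1 then B1 k else B2 k.
have S12 : S1 :|: S2 \subset U by rewrite finset.subUset S1U.
have mB k : measurable (B k) by rewrite /B; case: ifP.
have notS1 k : k \in S2 -> (k \in S1) = false.
  by move=> kS2; apply/negP => /dS; rewrite kS2.
have -> : \bigcap_(k in [set k | k \in S1]) (X k @^-1` B1 k) `&`
    \bigcap_(k in [set k | k \in S2]) (X k @^-1` B2 k) =
    \bigcap_(k in [set k | k \in S1 :|: S2]) (X k @^-1` B k).
  apply/seteqP; split => [w [h1 h2] k /=|w h].
    rewrite finset.in_setU /B; case: ifPn => [kS _|_ /= kS]; [exact: h1|exact: h2].
  split => k /= kS; have := h k; rewrite /= finset.in_setU kS ?orbT /B => /(_ isT).
    by rewrite kS.
  by rewrite notS1.
rewrite !indep// (big_setID S1)/=.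
have -> : ((S1 :|: S2) :&: S1)%SET = S1 by apply/setP => k; rewrite !inE; case: (k \in S1); rewrite ?andbF.
have -> : ((S1 :|: S2) :\: S1)%SET = S2.
  apply/setP => k; rewrite !inE; have := notS1 k.
  by case: (k \in S2) => [->|_]; case: (k \in S1).
congr (_ * _)%E; apply: eq_bigr => k kS; first by rewrite /B kS.
by rewrite /B notS1.
Qed.

(** Cylinders form a pi-system. With one of the two sets fixed, the probability of the intersection
    and the product of probabilities are finite measures in the other that agree on cylinders, hence
    on the generated sigma-algebra; the argument runs once for each factor. *)
Lemma sub_indep {S1 S2 : {set K}} {A B : set T} : S1 \subset U -> S2 \subset U ->
  (forall k, k \in S1 -> k \notin S2) -> measurable (A : set (Tsub S1)) ->
  measurable (B : set (Tsub S2)) -> P (A `&` B) = (P A * P B)%E.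
Proof.
move=> S1U S2U dS mA mB.
have mT (S : {set K}) (SU : S \subset U) (C : set T) : measurable (C : set (Tsub S)) -> measurable (C : set T).
  by move=> mC; have := measurable_idsub SU measurableT _ mC; rewrite setTI preimage_id.
have ext (S : {set K}) (C : set T) (mC : measurable C) : S \subset U ->
    (forall D, rects S D -> P (D `&` C) = (P D * P C)%E) ->
    forall D, measurable (D : set (Tsub S)) -> P (D `&` C) = (P D * P C)%E.
  move=> SU h D mD.
  pose m1 : {measure set (Tsub S) -> \bar R} := pushmeas (mrestr P mC) (measurable_idsub SU).
  have PC : fine (P C) >= 0 by exact: fine_ge0.
  pose m2 : {measure set (Tsub S) -> \bar R} := mscale (NngNum PC) (pushmeas P (measurable_idsub SU)).
  have m2E E : m2 E = (P E * P C)%E.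
    rewrite muleC -[in RHS](@fineK _ (P C)) //.
    exact: fin_num_measure.
  rewrite -m2E; change (m1 D = m2 D).
  apply: (@measure_unique _ R (Tsub S) (rects S) (fun=> setT) _ _ _ _ m1 m2) => //.
  - exact: rects_setI.
  - by move=> _; exact: rects_setT.
  - by rewrite bigcup_const.
  - by move=> E rE; rewrite m2E -h.
  - move=> _; change (P (setT `&` C) < +oo)%E.
    apply: (le_lt_trans (probability_le1 _ _)); last exact: ltry.
    exact: measurableI.
rewrite (ext S1 B (mT _ S2U _ mB))// => D rD.
rewrite (setIC D) [RHS]muleC.
have mD := measurable_rects _ _ S1U rD.
refine (ext S2 D mD S2U _ B mB) => E rE.
by rewrite (setIC E) [RHS]muleC; apply: rects_indep rD rE.
Qed.

(** No product structure on [T] is assumed: the diagonal map w -> (w, w), its two targets carrying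
    different sigma-algebras, pushes [P] forward to a product measure by [sub_indep]. *)
Lemma decouple {S1 S2 : {set K}} (F : Tsub S1 * Tsub S2 -> \bar R) :
  S1 \subset U -> S2 \subset U -> (forall k, k \in S1 -> k \notin S2) ->
  measurable_fun setT F -> (forall z, 0 <= F z)%E ->
  (\int[P]_w F (w, w) = \int[P]_w2 \int[P]_w1 F (w1, w2))%E.
Proof.
move=> S1U S2U dS mF F0.
have m1 := measurable_idsub S1U; have m2 := measurable_idsub S2U.
have mdiag : measurable_fun setT (fun w : T => (w : Tsub S1, w : Tsub S2)).
  exact: (measurable_pair m1 m2).
rewrite -(ge0_integral_pushprob P mdiag mF F0).
transitivity (\int[pushprob P m1 \x pushprob P m2]_z F z)%E.
  apply: eq_measure_integral => A mA _; apply/esym/product_measure_unique => // B C mB mC.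
  change (P ((fun w : T => (w : Tsub S1, w : Tsub S2)) @^-1` (B `*` C)) = (P B * P C)%E).
  by rewrite -sub_indep.
rewrite (integral_prod2 _ _ mF F0).
rewrite (ge0_integral_pushprob P m2 (measurable_integral1 _ mF F0)); last first.
  by move=> y; exact: integral_ge0.
apply: eq_integral => w2 _.
exact: (ge0_integral_pushprob P m1 (measurable_sec1 _ mF) (fun x => F0 _)).
Qed.

End decouple.

(** * Linear forms in independent normal variables *)

Section linear_forms.
Context {R : realType} {d : measure_display} {T : measurableType d}.
Variables (P : probability T R) (K : finType) (X : K -> T -> R) (U : {set K}).
Hypothesis mX : forall k, k \in U -> measurable_fun setT (X k).
Hypothesis indep : forall (S : {set K}) (B : K -> set R), S \subset U ->
  (forall k, measurable (B k)) ->
  P (\bigcap_(k in [set k | k \in S]) (X k @^-1` B k)) =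
  (\prod_(k in S) P (X k @^-1` B k))%E.
Hypothesis gaussX : forall k B, k \in U -> measurable B ->
  P (X k @^-1` B) = normal_prob 0 1 B.
Local Notation gam := (normal_prob (0 : R) 1).

Lemma integral_gaussX k (F : R -> \bar R) : k \in U -> measurable_fun setT F ->
  (forall x, 0 <= F x)%E -> (\int[P]_w F (X k w) = \int[gam]_x F x)%E.
Proof.
move=> kU mF F0.
have mXk : measurable_fun setT (X k : T -> measurableTypeR R) by exact: mX.
rewrite -(ge0_integral_pushprob P mXk mF F0).
by apply: eq_measure_integral => A mA _; exact: gaussX.
Qed.

(** Induction on the list: the head variable is independent of the tail sums, so decoupling lets a
    fresh normal replace it and [bigauss_add] applies. The empty list already has covariance 0,
    which is why degenerate pairs must be allowed. *)
Lemma bigauss_linear (l : seq K) (a b : K -> R) : uniq l -> {subset l <= U} ->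
  bigauss P (fun w => \sum_(k <- l) a k * X k w) (fun w => \sum_(k <- l) b k * X k w)
    (\sum_(k <- l) a k ^+ 2) (\sum_(k <- l) a k * b k) (\sum_(k <- l) b k ^+ 2).
Proof.
have msub (e : K -> R) (l' : seq K) (S : {set K}) : {subset l' <= S} ->
    measurable_fun setT (fun w : g_sigma_algebraType (rects K X S) => \sum_(k <- l') e k * X k w).
  elim: l' => [_|k l' IH sl].
    by under eq_fun do rewrite big_nil; exact: measurable_cst.
  under eq_fun do rewrite big_cons; apply: measurable_funD.
    apply: measurable_funM; first exact: measurable_cst.
    by apply: measurable_Tsub; apply: sl; rewrite mem_head.
  by apply: IH => k' k'l; apply: sl; rewrite inE k'l orbT.
have msubT (e : K -> R) (l' : seq K) : {subset l' <= U} ->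
    measurable_fun setT (fun w : T => \sum_(k <- l') e k * X k w).
  move=> l'U.
  exact: (measurable_compT (msub e l' U l'U) (measurable_idsub K X U mX (subxx _))).
elim: l => [_ _|k0 l IH /= /andP[k0l ul] sl].
  split; [exact: msubT|exact: msubT|exists 0, 0, 0; split].
  - by [].
  - by rewrite big_nil expr2 mul0r.
  - by rewrite big_nil mul0r.
  - by rewrite big_nil expr2 mul0r addr0.
  move=> F mF F0.
  transitivity (F (0, 0)).
    under eq_integral do rewrite !big_nil.
    by rewrite integral_cst// -[RHS]mule1; apply: f_equal; exact: probability_setT.
  rewrite -[LHS](integral_normal_cst 0 1)//; apply: eq_integral => x _.
  rewrite -[LHS](integral_normal_cst 0 1)//; apply: eq_integral => y _.
  by rewrite !mul0r addr0.
have slU : {subset l <= U} by move=> k kl; apply: sl; rewrite inE kl orbT.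
have k0U : k0 \in U by apply: sl; rewrite mem_head.
have := bigauss_add P _ _ _ _ _ (a k0) (b k0) (IH ul slU).
rewrite !big_cons !(addrC (_ k0 ^+ 2)) (addrC (a k0 * b k0)).
move=> [_ _ [s [t [u [h1 h2 h3 h4 law]]]]].
split; [exact: msubT|exact: msubT|exists s, t, u; split => //].
move=> F mF F0; rewrite -law//.
set A := fun w => \sum_(k <- l) a k * X k w; set B := fun w => \sum_(k <- l) b k * X k w.
pose S1 := [set k in l]%SET; pose S2 := [set k0]%SET.
have S1U : S1 \subset U by apply/fintype.subsetP => k; rewrite inE; exact: slU.
have S2U : S2 \subset U by rewrite finset.sub1set.
have dS k : k \in S1 -> k \notin S2.
  by rewrite !inE; apply: contraTN => /eqP ->.
have sS1 : {subset l <= S1} by move=> k kl; rewrite inE.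
pose T1 := g_sigma_algebraType (rects K X S1).
pose T2 := g_sigma_algebraType (rects K X S2).
have mX2 : measurable_fun setT (X k0 : T2 -> R) by apply: measurable_Tsub; rewrite inE.
have mF' : measurable_fun [set: T1 * T2] (fun z => F (A z.1 + a k0 * X k0 z.2, B z.1 + b k0 * X k0 z.2)).
  apply: (measurable_compT mF); apply: measurable_pair; apply: measurable_funD.
  - exact: (measurable_compT (msub a l S1 sS1) measurable_fst).
  - by apply: measurable_funM; [mfun|exact: (measurable_compT mX2 measurable_snd)].
  - exact: (measurable_compT (msub b l S1 sS1) measurable_fst).
  - by apply: measurable_funM; [mfun|exact: (measurable_compT mX2 measurable_snd)].
transitivity (\int[P]_w F (A w + a k0 * X k0 w, B w + b k0 * X k0 w)%R)%E.
  by apply: eq_integral => w _; rewrite !big_cons !(addrC (_ * X k0 w)).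
rewrite (decouple P K X U mX indep _ S1U S2U dS mF' (fun z => F0 _)) /=.
have mG : measurable_fun [set: T * R] (fun z => F (A z.1 + a k0 * z.2, B z.1 + b k0 * z.2)).
  apply: (measurable_compT mF); apply: measurable_pair; apply: measurable_funD; mfun.
  - exact: (measurable_compT (msubT a l slU) measurable_fst).
  - exact: (measurable_compT (msubT b l slU) measurable_fst).
rewrite (integral_prod2 P gam mG (fun z => F0 _)).
rewrite -(integral_gaussX _ _ k0U (measurable_integral1 P mG (fun z => F0 _)))//.
by move=> x; exact: integral_ge0.
Qed.

End linear_forms.

(** * Exponential and quadratic moments of Gaussian pairs *)

Section moments.
Context {R : realType}.
Local Notation mu := (@lebesgue_measure R).
Local Notation gam := (normal_prob (0 : R) 1).

(** Completing the square: exp(a x) times the standard density is exp(a^2 / 2) times the density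
    centred at a. *)
Lemma gauss_tilt (a : R) (F : R -> \bar R) : measurable_fun setT F -> (forall x, 0 <= F x)%E ->
  (\int[gam]_x (F x * (expR (a * x))%:E) = (expR (a ^+ 2 / 2))%:E * \int[gam]_x F (a + x)%R)%E.
Proof.
move=> mF F0.
have mFa : measurable_fun [set: R] (fun x => F (a + x)).
  by apply: (measurable_compT mF); mfun.
have mFe : measurable_fun [set: R] (fun x => F x * (expR (a * x))%:E)%E.
  by apply: emeasurable_funM => //; mfun.
rewrite (ge0_integral_normal_prob 0 1 mFe); last first.
  by move=> x; rewrite mule_ge0// lee_fin expR_ge0.
have -> : (\int[gam]_x F (a + x)%R = \int[gam]_x F (a + 1 * x)%R)%E.
  by apply: eq_integral => x _; rewrite mul1r.
rewrite (ge0_integral_std_normal a ltr01 mF F0) (ge0_integral_normal_prob a 1 mF F0).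
have mFp : measurable_fun [set: R] (fun x => F x * (normal_pdf a 1 x)%:E)%E.
  by apply: emeasurable_funM => //; apply: measurable_fun_EFin; exact: measurable_normal_pdf.
rewrite -(ge0_integralZl mu measurableT mFp); last 2 first.
- by move=> x _; rewrite mule_ge0// lee_fin normal_pdf_ge0.
- by rewrite lee_fin expR_ge0.
apply: eq_integral => x _; rewrite -muleA -EFinM muleCA -EFinM.
suff -> : expR (a * x) * normal_pdf 0 1 x = expR (a ^+ 2 / 2) * normal_pdf a 1 x by [].
rewrite !normal_pdfE ?oner_neq0// /normal_fun mulrCA [RHS]mulrCA -!expRD.
by congr (_ * expR _); field.
Qed.

Lemma gauss_expR (a : R) : (\int[gam]_x (expR (a * x))%:E = (expR (a ^+ 2 / 2))%:E)%E.
Proof.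
transitivity (\int[gam]_x (1 * (expR (a * x))%:E))%E.
  by apply: eq_integral => x _; rewrite mul1e.
rewrite (gauss_tilt a (fun=> 1%E)) => [|//|x]; last exact: lee01.
by rewrite integral_normal_cst ?lee01// mule1.
Qed.

(** The value 1 is never computed: the bounds only ask that this moment be finite. *)
Definition gauss_m2 : R := fine (\int[gam]_x (x ^+ 2)%:E)%E.

Lemma gauss_m2E : (\int[gam]_x (x ^+ 2)%:E = gauss_m2%:E)%E.
Proof.
rewrite /gauss_m2 fineK// ge0_fin_numE; last first.
  exact: (integral_real_ge0 gam (fun x => sqr_ge0 x)).
apply: (@le_lt_trans _ _ (\int[gam]_x (expR (2 * x) + expR (- 2 * x))%:E)%E).
  apply: le_integral_ge0; [mfun|by move=> x; exact: sqr_ge0|mfun|move=> x].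
  have h (y : R) : 0 <= y -> y ^+ 2 <= expR (2 * y).
    move=> y0; rewrite mulrC expRM_natr lerXn2r ?nnegrE ?expR_ge0//.
    by rewrite (le_trans _ (expR_ge1Dx y))// lerDr.
  have [x0|x0] := leP 0 x.
    by rewrite (le_trans (h _ x0))// lerDl expR_ge0.
  have x0' : 0 <= - x by rewrite oppr_ge0 ltW.
  rewrite -sqrrN; apply: (le_trans (h _ x0')).
  by rewrite mulrN mulNr lerDr expR_ge0.
rewrite integralD_ge0; [|mfun|by move=> x; exact: expR_ge0|mfun|by move=> x; exact: expR_ge0].
by rewrite !gauss_expR -EFinD ltry.
Qed.

Lemma gauss_m2_ge0 : 0 <= gauss_m2.
Proof. by rewrite -lee_fin -gauss_m2E; apply: integral_ge0 => x _; rewrite lee_fin sqr_ge0. Qed.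

Lemma gauss_sqr (a b : R) :
  (\int[gam]_x ((a * x + b) ^+ 2)%:E = (a ^+ 2 * gauss_m2 + b ^+ 2)%:E)%E.
Proof.
have ms e : measurable_fun [set: R] (fun x => ((e * x + b) ^+ 2)%:E) by mfun.
have s0 (e x : R) : (0 <= ((e * x + b) ^+ 2)%:E)%E by rewrite lee_fin sqr_ge0.
set I := (X in X = _).
(* Adding the integral to its reflection cancels the cross term 2 a b x pointwise, so no signed
   integral appears. *)
have I2 : (I + I = (a ^+ 2 * gauss_m2 + b ^+ 2)%:E + (a ^+ 2 * gauss_m2 + b ^+ 2)%:E)%E.
  rewrite {2}/I -(ge0_integral_normalN (ms a) (s0 a)).
  have -> : (\int[gam]_x ((a * - x + b) ^+ 2)%:E = \int[gam]_x ((- a * x + b) ^+ 2)%:E)%E.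
    by apply: eq_integral => x _; rewrite mulrN mulNr.
  rewrite -(ge0_integralD gam measurableT (fun x _ => s0 a x) (ms a) (fun x _ => s0 (- a) x) (ms (- a))).
  have -> : (\int[gam]_x (((a * x + b) ^+ 2)%:E + ((- a * x + b) ^+ 2)%:E) =
     \int[gam]_x (2 * a ^+ 2 * x ^+ 2 + 2 * b ^+ 2)%:E)%E.
    by apply: eq_integral => x _; rewrite -!EFinD; congr EFin; ring.
  have p2 (e : R) : 0 <= 2 * e ^+ 2 by rewrite mulr_ge0// sqr_ge0.
  rewrite integralD_ge0; [|mfun|by move=> x; rewrite mulr_ge0// sqr_ge0|mfun|by []].
  rewrite integral_normal_cst ?lee_fin//.
  rewrite integralZ_ge0; [|mfun|by move=> x; exact: sqr_ge0|by []].
  by rewrite gauss_m2E -EFinM -!EFinD; congr EFin; ring.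
have I0 : (0 <= I)%E by apply: integral_ge0.
move: I2; case: I I0 => [r _|//|//]; rewrite -!EFinD => -[] h.
by congr EFin; lra.
Qed.

Context {d : measure_display} {T : measurableType d} (m : {measure set T -> \bar R}).

Lemma bigauss_expRl X Y v1 c v2 (b : R) : bigauss m X Y v1 c v2 ->
  (\int[m]_w (expR (b * X w))%:E = (expR (b ^+ 2 * v1 / 2))%:E)%E.
Proof.
move=> [_ _ [s [t [u [_ <- _ _ law]]]]].
rewrite (law (fun z => (expR (b * z.1))%:E)) => [|| z]; last by rewrite lee_fin expR_ge0.
  transitivity (\int[gam]_x (expR ((b * s) * x))%:E)%E.
    apply: eq_integral => x _ /=; rewrite -mulrA.
    by apply: integral_normal_cst; rewrite lee_fin expR_ge0.
  by rewrite gauss_expR exprMn.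
by mfun.
Qed.

Lemma bigauss_expRr X Y v1 c v2 (b : R) : bigauss m X Y v1 c v2 ->
  (\int[m]_w (expR (b * Y w))%:E = (expR (b ^+ 2 * v2 / 2))%:E)%E.
Proof.
move=> [_ _ [s [t [u [_ _ _ <- law]]]]].
rewrite (law (fun z => (expR (b * z.2))%:E)) => [|| z]; last by rewrite lee_fin expR_ge0.
  transitivity (\int[gam]_x (expR ((b * u) ^+ 2 / 2) * expR ((b * t) * x))%:E)%E.
    apply: eq_integral => x _ /=; rewrite EFinM -(gauss_expR (b * u)) muleC.
    rewrite -integralZ_ge0; [|mfun|by move=> y; exact: expR_ge0|exact: expR_ge0].
    by apply: eq_integral => y _; rewrite -expRD; congr (expR _)%:E; ring.
  rewrite integralZ_ge0; [|mfun|by move=> y; exact: expR_ge0|exact: expR_ge0].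
  by rewrite gauss_expR -EFinM -expRD; congr (expR _)%:E; ring.
by mfun.
Qed.

(** Tilting by exp X multiplies the mass by exp(v1 / 2) and moves the mean of Y from 0 to the
    covariance c, leaving its variance v2 unchanged. *)
Lemma bigauss_quad X Y v1 c v2 (e : R) : bigauss m X Y v1 c v2 ->
  (\int[m]_w ((Y w - e) ^+ 2 * expR (X w))%:E =
   (expR (v1 / 2) * ((c - e) ^+ 2 + gauss_m2 * v2))%:E)%E.
Proof.
move=> [_ _ [s [t [u [_ <- <- <- law]]]]].
rewrite (law (fun z => ((z.2 - e) ^+ 2 * expR z.1)%:E)) => [|| z]; last first.
- by rewrite lee_fin mulr_ge0 ?sqr_ge0 ?expR_ge0.
- by mfun.
pose Q (x : R) : R := u ^+ 2 * gauss_m2 + (t * x - e) ^+ 2.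
have Q0 x : (0 <= (Q x)%:E)%E by rewrite lee_fin addr_ge0 ?sqr_ge0// mulr_ge0 ?sqr_ge0 ?gauss_m2_ge0.
have mQ : measurable_fun [set: R] (EFin \o Q).
  by apply: measurable_fun_EFin; rewrite /Q; mfun.
transitivity (\int[gam]_x ((Q x)%:E * (expR (s * x))%:E))%E.
  apply: eq_integral => x _ /=; rewrite /Q -gauss_sqr muleC.
  rewrite -integralZ_ge0; [|mfun|by move=> y; exact: sqr_ge0|exact: expR_ge0].
  by apply: eq_integral => y _; congr EFin; rewrite mulrC; congr (_ * _ ^+ 2); ring.
rewrite (gauss_tilt s (EFin \o Q) mQ Q0).
have -> : (\int[gam]_x (EFin \o Q) (s + x)%R = \int[gam]_x (u ^+ 2 * gauss_m2 + (t * x + (s * t - e)) ^+ 2)%:E)%E.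
  by apply: eq_integral => x _; rewrite /Q /=; congr EFin; congr (_ + _ ^+ 2); ring.
have u20 : 0 <= u ^+ 2 * gauss_m2 by rewrite mulr_ge0 ?sqr_ge0 ?gauss_m2_ge0.
rewrite integralD_ge0; [|mfun|by []|mfun|by move=> x; exact: sqr_ge0].
rewrite gauss_sqr integral_normal_cst ?lee_fin// -EFinD -EFinM.
by congr (_ * _)%:E; ring.
Qed.

End moments.

(** * Comparison of Gaussian pairs *)

Section real_inequalities.
Context {R : realType}.
Implicit Types (a b k x y : R).

Lemma ln_diff_le k x y : 0 < k -> k <= x -> k <= y -> `|ln x - ln y| <= `|x - y| / k.
Proof.
move=> k0; have h u v : k <= u -> k <= v -> ln u - ln v <= `|u - v| / k.
  move=> ku kv; have u0 := lt_le_trans k0 ku; have v0 := lt_le_trans k0 kv.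
  rewrite -ln_div ?posrE//.
  have -> : u / v = 1 + (u - v) / v by field; rewrite gt_eqF.
  apply: (le_trans (le_ln1Dx _)).
    by rewrite mulrBl divff ?gt_eqF// ltrBrDr addrC subrr divr_gt0.
  apply: (@le_trans _ _ (`|u - v| / v)); first by rewrite ler_pM2r ?invr_gt0// ler_norm.
  by rewrite ler_wpM2l// lef_pV2 ?posrE.
by move=> kx ky; rewrite ler_norml lerNl opprB h//= andbT distrC h.
Qed.

(** From 1 - exp t <= |t|. With A and B minus log-densities, the error is weighted by the first
    density alone, so only moments of the first law are needed. *)
Lemma expR_one_sided (A B : R) : expR (- A) <= expR (- B) + `|A - B| * expR (- A).
Proof.
rewrite -lerBlDl; have -> : expR (- A) - expR (- B) = (1 - expR (A - B)) * expR (- A).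
  by rewrite mulrBl mul1r -expRD; congr (_ - expR _); ring.
rewrite ler_wpM2r ?expR_ge0// -normrN; apply: le_trans (ler_norm _).
by have := expR_ge1Dx (A - B); lra.
Qed.

(** Twice cosh(a x). This is the growth class of the observables: products and polynomial factors
    stay in it at the price of a larger [a]. *)
Definition wexp a x : R := expR (a * x) + expR (- a * x).

Lemma wexp_gt0 a x : 0 < wexp a x.
Proof. by rewrite addr_gt0 ?expR_gt0. Qed.

Lemma wexp_ge0 a x : 0 <= wexp a x. Proof. exact/ltW/wexp_gt0. Qed.

Lemma wexp_sqr a x : wexp a x ^+ 2 = wexp (2 * a) x + 2.
Proof.
rewrite /wexp sqrrD -expRM_natr -expRD.
have -> : a * x + - a * x = 0 by ring.
rewrite expR0 -expRM_natr.
have -> : a * x * 2 = 2 * a * x by ring.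
have -> : - a * x * 2 = - (2 * a) * x by ring.
ring.
Qed.

Lemma wexp_ge2 a x : 2 <= wexp a x.
Proof.
rewrite -(@ler_pXn2r _ 2) ?nnegrE ?wexp_ge0//.
have := sqr_ge0 (expR (a * x) - expR (- a * x)).
rewrite wexp_sqr sqrrB -expRM_natr -expRD.
have -> : a * x + - a * x = 0 by ring.
rewrite expR0 -expRM_natr /wexp.
have -> : a * x * 2 = 2 * a * x by ring.
have -> : - a * x * 2 = - (2 * a) * x by ring.
lra.
Qed.

Lemma wexp_sqr_le a x : wexp a x ^+ 2 <= 2 * wexp (2 * a) x.
Proof. by have := wexp_ge2 (2 * a) x; rewrite wexp_sqr; lra. Qed.

Lemma wexpM_le a x y : wexp a x * wexp a y <= wexp (2 * a) x + wexp (2 * a) y.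
Proof.
have := wexp_sqr_le a x; have := wexp_sqr_le a y.
have := sqr_ge0 (wexp a x - wexp a y); rewrite sqrrB.
rewrite -mulr_natl; lra.
Qed.

Lemma sqr_le_wexp1 x : 1 + x ^+ 2 <= 4 * wexp 1 x.
Proof.
have h y : 0 <= y -> 1 + y ^+ 2 <= 4 * wexp 1 y.
  move=> y0; have h1 : 1 + y / 2 <= expR (y / 2) by exact: expR_ge1Dx.
  have h2 : expR (y / 2) ^+ 2 = expR (1 * y).
    by rewrite -expRM_natr; congr expR; field.
  have h3 := expR_gt0 (- 1 * y).
  have : (1 + y / 2) ^+ 2 <= expR (y / 2) ^+ 2.
    by rewrite lerXn2r ?nnegrE ?expR_ge0//; lra.
  rewrite h2 /wexp => h4.
  have : (1 + y / 2) ^+ 2 = 1 + y + y ^+ 2 / 4 by field.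
  nra.
have [x0|x0] := leP 0 x; first exact: h.
have := h (- x); rewrite sqrrN /wexp !mulrN !mulNr opprK => /(_ _).
by rewrite oppr_ge0 ltW// => /(_ isT); lra.
Qed.

Lemma wexp_mul1_le a x : 0 <= a -> wexp a x * wexp 1 x <= 2 * wexp (a + 1) x.
Proof.
move=> a0; rewrite /wexp mulrDl !mulrDr -!expRD.
have -> : a * x + 1 * x = (a + 1) * x by ring.
have -> : - a * x + -1 * x = - (a + 1) * x by ring.
suff : expR (a * x + -1 * x) + expR (- a * x + 1 * x) <= expR ((a + 1) * x) + expR (- (a + 1) * x) by lra.
have h (u v : R) : 0 <= u -> 0 <= v -> expR (u - v) + expR (v - u) <= expR (u + v) + expR (- (u + v)).
  move=> u0 v0; rewrite -subr_ge0.
  have -> : expR (u + v) + expR (- (u + v)) - (expR (u - v) + expR (v - u)) =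
     (expR u - expR (- u)) * (expR v - expR (- v)).
    have -> : v - u = - u + v by ring.
    have -> : - (u + v) = - u - v by ring.
    by rewrite mulrBl !mulrBr -!expRD; ring.
  by rewrite mulr_ge0// subr_ge0 ler_expR; lra.
have [x0|x0] := leP 0 x.
  have := h (a * x) x (mulr_ge0 a0 x0) x0.
  have -> : a * x + -1 * x = a * x - x by ring.
  have -> : - a * x + 1 * x = x - a * x by ring.
  have -> : (a + 1) * x = a * x + x by ring.
  by have -> : - (a + 1) * x = - (a * x + x) by ring.
have x1 : 0 <= - x by lra.
have := h (a * - x) (- x) (mulr_ge0 a0 x1) x1.
have -> : a * x + -1 * x = - x - a * - x by ring.
have -> : - a * x + 1 * x = a * - x - - x by ring.
have -> : (a + 1) * x = - (a * - x + - x) by ring.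
have -> : - (a + 1) * x = a * - x + - x by ring.
lra.
Qed.

(** Lets the exponential weight of the observables absorb the quadratic growth of a difference of
    log-densities. *)
Lemma wexp_quad_le a x y : 0 <= a ->
  wexp a x * wexp a y * (1 + x ^+ 2 + y ^+ 2) <=
  64 * (wexp (2 * (a + 1)) x + wexp (2 * (a + 1)) y).
Proof.
move=> a0.
have h1 : 1 + x ^+ 2 + y ^+ 2 <= (4 * wexp 1 x) * (4 * wexp 1 y).
  apply: (@le_trans _ _ ((1 + x ^+ 2) * (1 + y ^+ 2))).
    by have := sqr_ge0 x; have := sqr_ge0 y; nra.
  by apply: ler_pM; rewrite ?addr_ge0 ?sqr_ge0 ?sqr_le_wexp1.
apply: (@le_trans _ _ (wexp a x * wexp a y * ((4 * wexp 1 x) * (4 * wexp 1 y)))).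
  by rewrite ler_wpM2l// mulr_ge0 ?wexp_ge0.
have -> : wexp a x * wexp a y * ((4 * wexp 1 x) * (4 * wexp 1 y)) =
  16 * ((wexp a x * wexp 1 x) * (wexp a y * wexp 1 y)) by ring.
apply: (@le_trans _ _ (16 * ((2 * wexp (a + 1) x) * (2 * wexp (a + 1) y)))).
  rewrite ler_wpM2l//; apply: ler_pM; rewrite ?wexp_mul1_le ?mulr_ge0 ?wexp_ge0//.
by have := wexpM_le (a + 1) x y; lra.
Qed.

(* Minus the logarithm, up to an additive constant, of the density of a
   centred Gaussian pair: [v1] is the variance of the first coordinate and,
   given that it equals [x], the second one has mean [t * x], variance [v]. *)
Definition logdens (v1 t v x y : R) : R :=
  x ^+ 2 / (2 * v1) + (y - t * x) ^+ 2 / (2 * v) + (ln v1 + ln v) / 2.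

(** The parameters are changed one at a time: [e1] for the first variance, [e2] for the slope, [e3]
    for the conditional variance, [e4] and [e5] for the normalisations. The coefficients 2, 7 / k
    and 5 / k^2 collect, with room to spare, the errors carrying no, one and two factors 1 / k. *)
Lemma logdens_lip (v1 t v v0 q k D x y : R) : 0 < k -> k <= v -> k <= v0 ->
  0 <= D -> 1 / 2 <= v1 -> `|t| <= 2 -> 0 <= q <= 1 ->
  `|v1 - 1| <= D -> `|t - q| <= 2 * D -> `|v - v0| <= 5 * D ->
  `|logdens v1 t v x y - logdens 1 q v0 x y| <=
  (2 + 7 / k + 5 / k ^+ 2) * D * (1 + x ^+ 2 + y ^+ 2).
Proof.
move=> k0 kv kv0 D0 v1h t2 /andP[q0 q1] hv1 ht hv.
have v_gt0 := lt_le_trans k0 kv; have v0_gt0 := lt_le_trans k0 kv0.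
have v1_gt0 : 0 < v1 by lra.
have x2 := sqr_ge0 x; have y2 := sqr_ge0 y.
have ki : 0 < k^-1 by rewrite invr_gt0.
have vi : v^-1 <= k^-1 by rewrite lef_pV2 ?posrE.
have v0i : v0^-1 <= k^-1 by rewrite lef_pV2 ?posrE.
have e1 : `|x ^+ 2 / (2 * v1) - x ^+ 2 / (2 * 1)| <= D * x ^+ 2.
  have -> : x ^+ 2 / (2 * v1) - x ^+ 2 / (2 * 1) = (1 - v1) * (x ^+ 2 * (2 * v1)^-1).
    by field; rewrite gt_eqF.
  have i0 : 0 <= x ^+ 2 * (2 * v1)^-1 by rewrite mulr_ge0// invr_ge0; lra.
  rewrite normrM (ger0_norm i0) (distrC 1 v1); apply: ler_pM => //.
  by rewrite ler_piMr// invf_le1; lra.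
have e2 : `|(y - t * x) ^+ 2 / (2 * v) - (y - q * x) ^+ 2 / (2 * v)| <= D * k^-1 * (4 * x ^+ 2 + y ^+ 2).
  have -> : (y - t * x) ^+ 2 / (2 * v) - (y - q * x) ^+ 2 / (2 * v) =
    ((q - t) * (x * (2 * y - (t + q) * x))) * (2 * v)^-1.
    by field; rewrite gt_eqF.
  have h : `|x * (2 * y - (t + q) * x)| <= 4 * x ^+ 2 + y ^+ 2.
    have tq : `|t + q| <= 3 by rewrite (le_trans (ler_normD _ _))// (ger0_norm q0); lra.
    rewrite ler_norml; move: tq; rewrite ler_norml => /andP[? ?].
    have := sqr_ge0 (x - y); have := sqr_ge0 (x + y); rewrite sqrrB sqrrD.
    by nra.
  have iv0 : 0 <= (2 * v)^-1 by rewrite invr_ge0; lra.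
  rewrite normrM (ger0_norm iv0) normrM (distrC q t) invfM.
  apply: (@le_trans _ _ (2 * D * (4 * x ^+ 2 + y ^+ 2) * (2^-1 * k^-1))); last lra.
  apply: ler_pM; [by rewrite mulr_ge0|by rewrite mulr_ge0 ?invr_ge0// ltW| |].
    exact: ler_pM.
  by rewrite ler_pM2l ?invr_gt0.
have e3 : `|(y - q * x) ^+ 2 / (2 * v) - (y - q * x) ^+ 2 / (2 * v0)| <= 5 * D * k^-1 ^+ 2 * (x ^+ 2 + y ^+ 2).
  have -> : (y - q * x) ^+ 2 / (2 * v) - (y - q * x) ^+ 2 / (2 * v0) =
    ((v0 - v) * ((y - q * x) ^+ 2 / 2)) * (v^-1 * v0^-1).
    by field; rewrite !gt_eqF.
  have i1 : 0 <= (y - q * x) ^+ 2 / 2 by rewrite divr_ge0// sqr_ge0.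
  have i2 : 0 <= v^-1 * v0^-1 by rewrite mulr_ge0// invr_ge0 ltW.
  rewrite normrM (ger0_norm i2) normrM (ger0_norm i1) (distrC v0 v).
  have h : (y - q * x) ^+ 2 / 2 <= x ^+ 2 + y ^+ 2.
    have := sqr_ge0 (y + q * x); rewrite sqrrB sqrrD !exprMn.
    have : q ^+ 2 <= 1 by rewrite expr_le1.
    by nra.
  have -> : 5 * D * k^-1 ^+ 2 * (x ^+ 2 + y ^+ 2) = 5 * D * (x ^+ 2 + y ^+ 2) * (k^-1 * k^-1) by ring.
  apply: ler_pM.
  - by rewrite mulr_ge0// divr_ge0// sqr_ge0.
  - exact: i2.
  - by apply: ler_pM => //; rewrite divr_ge0// sqr_ge0.
  - by apply: ler_pM => //; rewrite invr_ge0 ltW.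
have e4 : `|ln v1 - ln 1| <= 2 * D.
  apply: (le_trans (@ln_diff_le (1 / 2) _ _ _ _ _)); [lra|lra|lra|].
  by rewrite mul1r invrK mulrC; lra.
have e5 : `|ln v - ln v0| <= 5 * D * k^-1.
  by apply: (le_trans (@ln_diff_le k _ _ _ _ _)) => //; rewrite ler_pM2r.
have -> : logdens v1 t v x y - logdens 1 q v0 x y =
   (x ^+ 2 / (2 * v1) - x ^+ 2 / (2 * 1)) +
   ((y - t * x) ^+ 2 / (2 * v) - (y - q * x) ^+ 2 / (2 * v)) +
   ((y - q * x) ^+ 2 / (2 * v) - (y - q * x) ^+ 2 / (2 * v0)) +
   ((ln v1 - ln 1) + (ln v - ln v0)) / 2.
  rewrite /logdens; field; rewrite ?gt_eqF//.
have e45 : `|((ln v1 - ln 1) + (ln v - ln v0)) / 2| <= D + 5 / 2 * (D * k^-1).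
  rewrite normrM (@ger0_norm _ (2^-1))//.
  by have := ler_normD (ln v1 - ln 1) (ln v - ln v0); lra.
apply: (le_trans (ler_normD _ _)); apply: (le_trans (lerD (ler_normD _ _) e45)).
apply: (le_trans (lerD (lerD (ler_normD _ _) e3) (lexx _))).
have Dk : 0 <= D * k^-1 by rewrite mulr_ge0// ltW.
have Dk2 : 0 <= D * k^-1 ^+ 2 by rewrite mulr_ge0// exprn_ge0// ltW.
rewrite -exprVn.
set u := D * k^-1 in Dk e1 e2 e3 e45 *; set w := D * k^-1 ^+ 2 in Dk2 *.
have -> : (2 + 7 / k + 5 * k^-1 ^+ 2) * D * (1 + x ^+ 2 + y ^+ 2) =
   (2 * D + 7 * u + 5 * w) * (1 + x ^+ 2 + y ^+ 2) by rewrite /u /w; ring.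
have -> : 5 * D * k^-1 ^+ 2 = 5 * w by rewrite /w; ring.
have := lerD e1 e2; nra.
Qed.

End real_inequalities.

Section comparison.
Context {R : realType}.
Local Notation mu := (@lebesgue_measure R).
Local Notation gam := (normal_prob (0 : R) 1).

Definition bidens (v1 t v : R) (z : R * R) : R :=
  normal_peak 1 ^+ 2 * expR (- logdens v1 t v z.1 z.2).

Lemma bidens_ge0 v1 t v z : 0 <= bidens v1 t v z.
Proof. by rewrite mulr_ge0 ?sqr_ge0 ?expR_ge0. Qed.

Lemma measurable_bidens v1 t v : measurable_fun setT (bidens v1 t v).
Proof. by rewrite /bidens /logdens; mfun. Qed.

Lemma normal_pdf_expR (m s x : R) : 0 < s ->
  normal_pdf m s x = normal_peak 1 * expR (- ((x - m) ^+ 2 / (2 * s ^+ 2) + ln (s ^+ 2) / 2)).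
Proof.
move=> s0; rewrite normal_pdfE ?gt_eqF// opprD expRD mulrCA mulrC /normal_fun.
congr (_ * _).
  by rewrite -mulr_natl mulNr.
have -> : expR (- (ln (s ^+ 2) / 2)) = s^-1.
  rewrite lnXn// -[_ *+ 2]mulr_natr mulfK ?pnatr_eq0// expRN lnK//.
rewrite /normal_peak -!mulrnAr sqrtrM ?sqr_ge0// sqrtr_sqr gtr0_norm//.
by rewrite expr1n mul1r invfM mulrC.
Qed.

(** Given that the first coordinate is x, the second is normal with mean (t / s) x and standard
    deviation u; [bidens] is the marginal density times this conditional one. *)
Lemma gauss_pair_density (s t u : R) (F : R * R -> R) : 0 < s -> 0 < u ->
  measurable_fun setT F -> (forall z, 0 <= F z) ->
  (\int[gam]_x \int[gam]_y (F (s * x, t * x + u * y)%R)%:E =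
   \int[mu \x mu]_z (F z * bidens (s ^+ 2) (t / s) (u ^+ 2) z)%:E)%E.
Proof.
move=> s0 u0 mF F0.
have mH : measurable_fun [set: R * R]
    (fun z => (F z * bidens (s ^+ 2) (t / s) (u ^+ 2) z)%:E).
  apply: measurable_fun_EFin; apply: measurable_funM => //.
  exact: measurable_bidens.
have H0 z : (0 <= (F z * bidens (s ^+ 2) (t / s) (u ^+ 2) z)%:E)%E.
  by rewrite lee_fin mulr_ge0// bidens_ge0.
rewrite (integral_prod1 mu mu mH H0).
have mF2 : measurable_fun [set: R * R] (fun z => (F z)%:E) by exact: measurable_fun_EFin.
pose G (x : R) : \bar R := (\int[gam]_y (F (x, t / s * x + u * y)%R)%:E)%E.
have mG : measurable_fun setT G.
  apply: (measurable_integral2 gam (F := fun z => (F (z.1, t / s * z.1 + u * z.2))%:E)).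
    by apply: (measurable_compT mF2); mfun.
  by move=> z; rewrite lee_fin.
have G0 x : (0 <= G x)%E by apply: (integral_real_ge0 gam).
transitivity (\int[gam]_x G (0 + s * x)%R)%E.
  apply: eq_integral => x _; rewrite /G add0r.
  have -> : t / s * (s * x) = t * x by field; rewrite gt_eqF.
  by [].
rewrite (ge0_integral_std_normal 0 s0 mG G0) (ge0_integral_normal_prob 0 s mG G0).
apply: eq_integral => x _.
have mFx := measurable_sec2 x mF2.
rewrite /G (ge0_integral_std_normal (t / s * x) u0 mFx (fun y => _)); last first.
  by move=> y; rewrite lee_fin.
rewrite (ge0_integral_normal_prob (t / s * x) u mFx); last first.
  by move=> y; rewrite lee_fin.
rewrite muleC -ge0_integralZl.
- apply: eq_integral => y _; rewrite -!EFinM; congr EFin.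
  rewrite mulrCA; congr (_ * _); rewrite !normal_pdf_expR// mulrACA -expRD.
  rewrite /bidens/= expr2; congr (_ * expR _); rewrite /logdens; ring.
- exact: measurableT.
- apply: emeasurable_funM => //.
  by apply: measurable_fun_EFin; exact: measurable_normal_pdf.
- by move=> y _; rewrite mule_ge0// lee_fin// normal_pdf_ge0.
- by rewrite lee_fin normal_pdf_ge0.
Qed.

Lemma bigauss_density {d} {T : measurableType d} (m : {measure set T -> \bar R})
    X Y v1 c v2 (F : R * R -> R) : bigauss m X Y v1 c v2 ->
  0 < v1 -> 0 < v2 - c ^+ 2 / v1 -> measurable_fun setT F -> (forall z, 0 <= F z) ->
  (\int[m]_w (F (X w, Y w))%:E =
   \int[mu \x mu]_z (F z * bidens v1 (c / v1) (v2 - c ^+ 2 / v1) z)%:E)%E.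
Proof.
move=> [_ _ [s [t [u [[s0 u0] sE tE uE law]]]]] v10 v0 mF F0.
have s_gt0 : 0 < s.
  by rewrite lt_neqAle s0 andbT; apply: contraTneq v10 => s_eq0; rewrite -sE -s_eq0 expr2 mul0r ltxx.
have sn0 : s != 0 by rewrite gt_eqF.
have tsE : c / v1 = t / s by rewrite -tE -sE; field.
have u2E : v2 - c ^+ 2 / v1 = u ^+ 2 by rewrite -tE -sE -uE; field.
have u_gt0 : 0 < u.
  rewrite lt_neqAle u0 andbT; apply: contraTneq v0 => u_eq0.
  by rewrite u2E -u_eq0 expr2 mul0r ltxx.
rewrite (law (fun z => (F z)%:E)) => [|| z]; last 2 first.
- exact: measurable_fun_EFin.
- by rewrite lee_fin.
by rewrite (gauss_pair_density s t u F s_gt0 u_gt0 mF F0) tsE u2E sE.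
Qed.

Lemma bigauss_std (s t u : R) : 0 <= s -> 0 <= u ->
  bigauss (gam \x gam)%E (fun z => s * z.1) (fun z => t * z.1 + u * z.2)
    (s ^+ 2) (s * t) (t ^+ 2 + u ^+ 2).
Proof.
move=> s0 u0; have m1 : measurable_fun [set: R * R] (fun z => s * z.1) by mfun.
have m2 : measurable_fun [set: R * R] (fun z => t * z.1 + u * z.2) by mfun.
split; [exact: m1|exact: m2|exists s, t, u; split => //].
move=> F mF F0.
exact: (integral_prod1 gam gam (measurable_compT mF (measurable_pair m1 m2)) (fun z => F0 _)).
Qed.

(** One-sided on purpose: the error is an average under the first law, and exchanging the two laws
    gives the reverse bound. *)
Lemma bigauss_compare_le {d d'} {T : measurableType d} {T' : measurableType d'}
    (m : {measure set T -> \bar R}) (m' : {measure set T' -> \bar R})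
    X Y v1 c v2 X' Y' v1' c' v2' (F G : R * R -> R) (k : R) :
  bigauss m X Y v1 c v2 -> bigauss m' X' Y' v1' c' v2' ->
  0 < v1 -> 0 < v2 - c ^+ 2 / v1 -> 0 < v1' -> 0 < v2' - c' ^+ 2 / v1' ->
  measurable_fun setT F -> (forall z, 0 <= F z) ->
  measurable_fun setT G -> (forall z, 0 <= G z) -> 0 <= k ->
  (forall z, F z * `|logdens v1 (c / v1) (v2 - c ^+ 2 / v1) z.1 z.2 -
     logdens v1' (c' / v1') (v2' - c' ^+ 2 / v1') z.1 z.2| <= k * G z) ->
  (\int[m]_w (F (X w, Y w))%:E <=
   \int[m']_w (F (X' w, Y' w))%:E + k%:E * \int[m]_w (G (X w, Y w))%:E)%E.
Proof.
move=> B B' h1 h2 h1' h2' mF F0 mG G0 k0 FG.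
rewrite (bigauss_density m X Y v1 c v2 F B)// (bigauss_density m X Y v1 c v2 G B)//.
rewrite (bigauss_density m' X' Y' v1' c' v2' F B')//.
set p := bidens v1 _ _; set p' := bidens v1' _ _.
have mp : measurable_fun setT p by exact: measurable_bidens.
have mp' : measurable_fun setT p' by exact: measurable_bidens.
have p0 z : 0 <= p z by exact: bidens_ge0.
have p'0 z : 0 <= p' z by exact: bidens_ge0.
have Gp0 z : 0 <= G z * p z by rewrite mulr_ge0.
have Fp0 z : 0 <= F z * p z by rewrite mulr_ge0.
have Fp'0 z : 0 <= F z * p' z by rewrite mulr_ge0.
have mGp : measurable_fun setT (fun z => G z * p z) by exact: measurable_funM.
have mFp : measurable_fun setT (fun z => F z * p z) by exact: measurable_funM.
have mFp' : measurable_fun setT (fun z => F z * p' z) by exact: measurable_funM.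
rewrite -(integralZ_ge0 (mu \x mu)%E k mGp Gp0 k0).
have kG0 z : 0 <= k * (G z * p z) by rewrite mulr_ge0.
have mkG : measurable_fun setT (fun z => k * (G z * p z)).
  by apply: measurable_funM => //; exact: measurable_cst.
rewrite -(integralD_ge0 (mu \x mu)%E mFp' Fp'0 mkG kG0).
refine (le_integral_ge0 (mu \x mu)%E mFp Fp0 (measurable_funD mFp' mkG) _) => z.
change (F z * p z <= F z * p' z + k * (G z * p z)); rewrite mulrA.
apply: (@le_trans _ _ (F z * (p' z + `|logdens v1 (c / v1) (v2 - c ^+ 2 / v1) z.1 z.2 -
     logdens v1' (c' / v1') (v2' - c' ^+ 2 / v1') z.1 z.2| * p z))).
  rewrite ler_wpM2l// /p /p' /bidens; set A := logdens _ _ _ _ _; set B0 := logdens _ _ _ _ _.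
  set K := normal_peak 1 ^+ 2.
  have -> : K * expR (- B0) + `|A - B0| * (K * expR (- A)) =
    K * (expR (- B0) + `|A - B0| * expR (- A)) by ring.
  by rewrite ler_wpM2l ?sqr_ge0//; exact: expR_one_sided.
by rewrite mulrDr lerD2l mulrA ler_wpM2r.
Qed.

Lemma bigauss_wexp {d} {T : measurableType d} (m : {measure set T -> \bar R})
    X Y v1 c v2 (b : R) : bigauss m X Y v1 c v2 -> v1 <= 2 -> v2 <= 2 ->
  (\int[m]_w (wexp b (X w) + wexp b (Y w))%:E <= (4 * expR (b ^+ 2))%:E)%E.
Proof.
move=> B v12 v22; have [mX mY _] := B.
have me (e : R) Z (mZ : measurable_fun setT Z) : measurable_fun setT (fun w : T => expR (e * Z w)) by mfun.
have mw Z (mZ : measurable_fun setT Z) : measurable_fun setT (fun w : T => wexp b (Z w)).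
  by rewrite /wexp; mfun.
have iw (Z : T -> R) (v : R) : measurable_fun setT Z -> v <= 2 ->
    (forall e, \int[m]_w (expR (e * Z w))%:E = (expR (e ^+ 2 * v / 2))%:E)%E ->
    (\int[m]_w (wexp b (Z w))%:E <= (2 * expR (b ^+ 2))%:E)%E.
  move=> mZ v2' iZ; rewrite /wexp integralD_ge0.
  - rewrite !iZ -EFinD lee_fin sqrrN.
    suff : expR (b ^+ 2 * v / 2) <= expR (b ^+ 2) by lra.
    by rewrite ler_expR; have := sqr_ge0 b; nra.
  - exact: me.
  - by move=> x; exact: expR_ge0.
  - exact: me.
  - by move=> x; exact: expR_ge0.
rewrite integralD_ge0.
- have -> : 4 * expR (b ^+ 2) = 2 * expR (b ^+ 2) + 2 * expR (b ^+ 2) by ring.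
  rewrite EFinD; apply: leeD.
    by apply: (iw X v1) => // e; exact: (bigauss_expRl _ _ _ _ _ _ e B).
  by apply: (iw Y v2) => // e; exact: (bigauss_expRr _ _ _ _ _ _ e B).
- exact: mw.
- by move=> x; exact: wexp_ge0.
- exact: mw.
- by move=> x; exact: wexp_ge0.
Qed.

Lemma bigauss_prod_lty {d} {T : measurableType d} (m : {measure set T -> \bar R})
    X Y v1 c v2 (a M : R) (f : R -> R) : bigauss m X Y v1 c v2 -> v1 <= 2 -> v2 <= 2 ->
  measurable_fun setT f -> (forall x, 0 <= f x <= M * wexp a x) ->
  (\int[m]_w (f (X w) * f (Y w))%:E <= (4 * expR ((2 * a) ^+ 2) * M ^+ 2)%:E)%E.
Proof.
move=> B v12 v22 mf fM; have [mX mY _] := B.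
have mw Z (mZ : measurable_fun setT Z) : measurable_fun setT (fun w : T => wexp (2 * a) (Z w)).
  by rewrite /wexp; mfun.
have f0 x : 0 <= f x by case/andP: (fM x).
have ms : measurable_fun setT (fun w => wexp (2 * a) (X w) + wexp (2 * a) (Y w)).
  by apply: measurable_funD; exact: mw.
have s0 w : 0 <= wexp (2 * a) (X w) + wexp (2 * a) (Y w) by rewrite addr_ge0 ?wexp_ge0.
apply: (@le_trans _ _ (\int[m]_w (M ^+ 2 * (wexp (2 * a) (X w) + wexp (2 * a) (Y w)))%:E)%E).
  apply: le_integral_ge0.
  - by apply: measurable_funM; exact: (measurable_compT mf).
  - by move=> w; rewrite mulr_ge0.
  - by apply: measurable_funM => //; exact: measurable_cst.
  - move=> w; apply: (@le_trans _ _ (M * wexp a (X w) * (M * wexp a (Y w)))).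
      by case/andP: (fM (X w)) => ? ?; case/andP: (fM (Y w)) => ? ?; apply: ler_pM.
    rewrite mulrACA -expr2 ler_wpM2l ?sqr_ge0//; exact: wexpM_le.
rewrite integralZ_ge0 ?sqr_ge0// [leRHS]EFinM muleC.
rewrite lee_wpmul2r ?lee_fin ?sqr_ge0//.
exact: (bigauss_wexp _ _ _ _ _ _ _ B).
Qed.

End comparison.

Section compare.
Context {R : realType}.
Local Notation gam := (normal_prob (0 : R) 1).

(** The factor [1 * z.1] keeps the shape of [bigauss_std] with s = 1, so that the two match without
    rewriting under the integral. *)
Definition gauss_corr (q : R) (f : R -> R) : R :=
  fine (\int[(gam \x gam)%E]_z
    (f (1 * z.1) * f (q * z.1 + Num.sqrt (1 - q ^+ 2) * z.2))%:E)%E.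

Lemma fineK_le (x : \bar R) (b : R) : (0 <= x)%E -> (x <= b%:E)%E ->
  x = (fine x)%:E /\ 0 <= fine x <= b.
Proof. by case: x => // r; rewrite !lee_fin => -> ->. Qed.

(** The threshold (1 - q^2) / 10 keeps v1 above 9 / 10; as the conditional variance moves by at most
    5 D, it also keeps that variance above half of its target 1 - q^2. *)
Lemma small_perturb (q v1 c v2 D : R) : 0 <= q -> q < 1 ->
  D = `|v1 - 1| + `|c - q| + `|v2 - 1| -> D <= (1 - q ^+ 2) / 10 ->
  [/\ 9 / 10 <= v1, `|c / v1| <= 2, `|c / v1 - q| <= 2 * D,
      `|v2 - c ^+ 2 / v1 - (1 - q ^+ 2)| <= 5 * D &
      (1 - q ^+ 2) / 2 <= v2 - c ^+ 2 / v1].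
Proof.
move=> q0 q1 DE hD.
have n1 := normr_ge0 (v1 - 1); have n2 := normr_ge0 (c - q); have n3 := normr_ge0 (v2 - 1).
have q2 := sqr_ge0 q.
have h1 : `|v1 - 1| <= D by lra.
have h2 : `|c - q| <= D by lra.
have h3 : `|v2 - 1| <= D by lra.
have v1h : 9 / 10 <= v1 by move: h1; rewrite ler_norml => /andP[? ?]; lra.
have v10 : 0 < v1 by lra.
have vn0 : v1 != 0 by rewrite gt_eqF.
have e1 : `|c / v1 - q| <= 2 * D.
  have -> : c / v1 - q = (c - q + q * (1 - v1)) / v1 by field.
  rewrite normrM normfV (gtr0_norm v10) ler_pdivrMr//.
  apply: (le_trans (ler_normD _ _)); rewrite normrM (ger0_norm q0) (distrC 1 v1).
  have : q * `|v1 - 1| <= 1 * `|v1 - 1| by rewrite ler_wpM2r// ltW.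
  have D0 : 0 <= D by lra.
  have v1h' : 0 <= v1 - 9 / 10 by rewrite subr_ge0.
  by have := mulr_ge0 D0 v1h'; lra.
have e2 : `|c / v1| <= 2.
  have -> : c / v1 = (c / v1 - q) + q by ring.
  by rewrite (le_trans (ler_normD _ _))// (ger0_norm q0); lra.
have e3 : `|v2 - c ^+ 2 / v1 - (1 - q ^+ 2)| <= 5 * D.
  have -> : v2 - c ^+ 2 / v1 - (1 - q ^+ 2) =
    (v2 - 1) + ((q - c) * (c / v1) + q * (q - c / v1)) by field.
  apply: (le_trans (ler_normD _ _)).
  have : `|(q - c) * (c / v1) + q * (q - c / v1)| <= 4 * D.
    apply: (le_trans (ler_normD _ _)); rewrite (normrM (q - c)) (normrM q) (ger0_norm q0) (distrC q c) (distrC q (c / v1)).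
    have -> : 4 * D = D * 2 + 1 * (2 * D) by ring.
    apply: lerD; first exact: ler_pM.
    by apply: ler_pM => //; exact: ltW.
  lra.
split => //.
by move: e3; rewrite ler_norml => /andP[? ?]; lra.
Qed.

(** [C] is named before the measure space, the pair, f and M: one constant serves every N, every
    site and every frozen cavity measure. *)
Definition compare_cst (q a C : R) : Prop := forall d (T : measurableType d) (m : {measure set T -> \bar R}) X Y v1 c v2
    (f : R -> R) (M : R),
  bigauss m X Y v1 c v2 -> v1 <= 2 -> v2 <= 2 -> measurable_fun setT f ->
  (forall x, 0 <= f x <= M * wexp a x) ->
  exists2 r : R, (\int[m]_w (f (X w) * f (Y w))%:E = r%:E)%E &
   `|r - gauss_corr q f| <= C * M ^+ 2 * (`|v1 - 1| + `|c - q| + `|v2 - 1|).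

(** Two regimes. Far from the target covariance the pair may have no density, but both correlations
    are at most B M^2 while the deviation is bounded below. Close to it the densities exist and are
    compared in both directions. *)
Lemma bigauss_compare (q a : R) : 0 <= q -> q < 1 -> 0 <= a ->
  exists2 C : R, 0 <= C & compare_cst q a C.
Proof.
move=> q0 q1 a0.
have v00 : 0 < 1 - q ^+ 2 by rewrite subr_gt0 expr_lt1.
set v0 := 1 - q ^+ 2 in v00 *.
pose k := v0 / 2; have k0 : 0 < k by rewrite divr_gt0.
pose B : R := 4 * expR ((2 * a) ^+ 2).
have B0 : 0 <= B by rewrite mulr_ge0 ?expR_ge0.
pose L := 2 + 7 / k + 5 / k ^+ 2.
have L0 : 0 <= L by rewrite !addr_ge0 ?divr_ge0 ?exprn_ge0// ltW.
pose E : R := 4 * expR ((2 * (a + 1)) ^+ 2).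
have E0 : 0 <= E by rewrite mulr_ge0 ?expR_ge0.
(* The first summand is for the far regime. In the second, 64 comes from [wexp_quad_le], [L] from
   [logdens_lip], and [E] bounds the mean of the weight [G]. *)
exists (B / (v0 / 10) + 64 * L * E).
  by rewrite addr_ge0 ?mulr_ge0// invr_ge0 divr_ge0// ltW.
move=> d T m X Y v1 c v2 f M BG v12 v22 mf fM.
have s0 : 0 <= Num.sqrt v0 by exact: sqrtr_ge0.
have := bigauss_std 1 q (Num.sqrt v0) ler01 s0.
rewrite expr1n mul1r sqr_sqrtr ?(ltW v00)// {2}/v0 addrC subrK => BG'.
have f0 x : 0 <= f x by case/andP: (fM x).
have le12 : 1 <= 2 :> R by lra.
have := bigauss_prod_lty _ _ _ _ _ _ a M f BG v12 v22 mf fM.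
have := bigauss_prod_lty _ _ _ _ _ _ a M f BG' le12 le12 mf fM.
rewrite -/B /=.
have ff0 d1 (T1 : measurableType d1) (m1 : {measure set T1 -> \bar R}) (X1 Y1 : T1 -> R) :
   (0 <= \int[m1]_w (f (X1 w) * f (Y1 w))%:E)%E.
  by apply: integral_real_ge0 => w; rewrite mulr_ge0.
move=> /(fineK_le _ _ (ff0 _ _ _ _ _))[]; rewrite -/(gauss_corr q f) => tE /andP[t0 tB].
move=> /(fineK_le _ _ (ff0 _ _ _ _ _))[].
set r := fine _ => rE /andP[r0 rB].
exists r; first exact: rE.
set D := _ + _ + _; have DE : D = `|v1 - 1| + `|c - q| + `|v2 - 1| by [].
have D0 : 0 <= D by rewrite !addr_ge0.
have M2 := sqr_ge0 M.
have [Dbig|Dsmall] := leP (v0 / 10) D.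
  apply: (@le_trans _ _ (B * M ^+ 2)).
    by rewrite ler_norml; lra.
  apply: (@le_trans _ _ (B / (v0 / 10) * M ^+ 2 * D)).
    have -> : B / (v0 / 10) * M ^+ 2 * D = B * M ^+ 2 * (D / (v0 / 10)) by ring.
    have v010 : 0 < v0 / 10 by rewrite divr_gt0.
    have h : 1 <= D / (v0 / 10) by rewrite ler_pdivlMr ?mul1r.
    rewrite -[leLHS]mulr1 ler_wpM2l//; exact: mulr_ge0.
  by rewrite ler_wpM2r// ler_wpM2r// lerDl; apply: mulr_ge0 => //; apply: mulr_ge0.
have [v1h t2 tq vv0 vk] := small_perturb q v1 c v2 D q0 q1 DE (ltW Dsmall).
pose F (z : R * R) := f z.1 * f z.2.
have mF : measurable_fun setT F by apply: measurable_funM; apply: (measurable_compT mf); mfun.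
have F0 z : 0 <= F z by rewrite mulr_ge0.
pose G (z : R * R) := wexp (2 * (a + 1)) z.1 + wexp (2 * (a + 1)) z.2.
have mG : measurable_fun setT G by rewrite /G /wexp; mfun.
have G0 z : 0 <= G z by rewrite addr_ge0 ?wexp_ge0.
have q01 : 0 <= q <= 1 by rewrite q0 ltW.
have FL z : F z * `|logdens v1 (c / v1) (v2 - c ^+ 2 / v1) z.1 z.2 -
    logdens 1 (q / 1) (1 - q ^+ 2 / 1) z.1 z.2| <= 64 * L * M ^+ 2 * D * G z.
  rewrite !divr1 -/v0.
  apply: (@le_trans _ _ ((M ^+ 2 * (wexp a z.1 * wexp a z.2)) * (L * D * (1 + z.1 ^+ 2 + z.2 ^+ 2)))).
    apply: ler_pM => //.
      rewrite /F; have -> : M ^+ 2 * (wexp a z.1 * wexp a z.2) = (M * wexp a z.1) * (M * wexp a z.2) by ring.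
      by case/andP: (fM z.1) => ? ?; case/andP: (fM z.2) => ? ?; apply: ler_pM.
    have kv0 : k <= v0 by rewrite /k; lra.
    have v1h2 : 1 / 2 <= v1 by lra.
    have hv1 : `|v1 - 1| <= D.
      by rewrite DE; have := normr_ge0 (c - q); have := normr_ge0 (v2 - 1); lra.
    exact: (logdens_lip _ _ _ _ _ k D _ _ k0 vk kv0 D0 v1h2 t2 q01 hv1 tq vv0).
  have := wexp_quad_le a z.1 z.2 a0; rewrite -/(G z) => h.
  have -> : M ^+ 2 * (wexp a z.1 * wexp a z.2) * (L * D * (1 + z.1 ^+ 2 + z.2 ^+ 2)) =
    (L * M ^+ 2 * D) * (wexp a z.1 * wexp a z.2 * (1 + z.1 ^+ 2 + z.2 ^+ 2)) by ring.
  have -> : 64 * L * M ^+ 2 * D * G z = (L * M ^+ 2 * D) * (64 * G z) by ring.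
  rewrite ler_wpM2l//; apply: mulr_ge0 => //; exact: mulr_ge0.
have kk0 : 0 <= 64 * L * M ^+ 2 * D.
  by apply: mulr_ge0 => //; apply: mulr_ge0 => //; apply: mulr_ge0.
have v1_gt0 : 0 < v1 by lra.
have vv_gt0 : 0 < v2 - c ^+ 2 / v1 by exact: (lt_le_trans k0 vk).
have vv0_gt0 : 0 < 1 - q ^+ 2 / 1 by rewrite divr1.
have bG := bigauss_wexp _ _ _ _ _ _ (2 * (a + 1)) BG v12 v22.
have bG' := bigauss_wexp _ _ _ _ _ _ (2 * (a + 1)) BG' le12 le12.
have fin1 (r1 r2 : R) (g : \bar R) : (g <= E%:E)%E -> (r1%:E <= r2%:E + (64 * L * M ^+ 2 * D)%:E * g)%E ->
   r1 <= r2 + 64 * L * M ^+ 2 * D * E.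
  move=> gE h; rewrite -lee_fin EFinD EFinM (le_trans h)// leeD2l//.
  by rewrite lee_wpmul2l// lee_fin.
have le1 : r <= gauss_corr q f + 64 * L * M ^+ 2 * D * E.
  apply: (fin1 _ _ _ bG); rewrite -rE -tE.
  exact: (bigauss_compare_le _ _ _ _ _ _ _ _ _ _ _ _ F G _ BG BG' v1_gt0 vv_gt0 ltr01 vv0_gt0 mF F0 mG G0 kk0 FL).
have le2 : gauss_corr q f <= r + 64 * L * M ^+ 2 * D * E.
  apply: (fin1 _ _ _ bG'); rewrite -rE -tE.
  apply: (bigauss_compare_le _ _ _ _ _ _ _ _ _ _ _ _ F G _ BG' BG ltr01 vv0_gt0 v1_gt0 vv_gt0 mF F0 mG G0 kk0) => z.
  by rewrite distrC.
apply: (@le_trans _ _ (64 * L * E * M ^+ 2 * D)).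
  rewrite ler_norml; have -> : 64 * L * E * M ^+ 2 * D = 64 * L * M ^+ 2 * D * E by ring.
  by lra.
by rewrite ler_wpM2r// ler_wpM2r// lerDr mulr_ge0// invr_ge0 divr_ge0// ltW.
Qed.

End compare.

(** * Averages of Gaussian fields *)

Section smoothing.
Context {R : realType}.
Local Notation gam := (normal_prob (0 : R) 1).
Variables (f : R -> R) (M a : R).
Hypothesis mf : measurable_fun setT f.
Hypothesis fM : forall x, 0 <= f x <= M * wexp a x.

Definition gsmooth (s : R) (g : R -> R) (r : R) : R :=
  fine (\int[gam]_z (g (r + s * z))%:E)%E.

Let f0 x : 0 <= f x. Proof. by case/andP: (fM x). Qed.

Lemma gsmooth_fin s r : (\int[gam]_z (f (r + s * z))%:E = (gsmooth s f r)%:E)%E.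
Proof.
rewrite /gsmooth fineK// ge0_fin_numE; last by apply: integral_real_ge0 => z; exact: f0.
have M0 : 0 <= M.
  by have /andP[h1 h2] := fM 0; have := le_trans h1 h2; rewrite pmulr_lge0// wexp_gt0.
have me (e : R) : measurable_fun setT (fun z : R => expR (e * (r + s * z))) by mfun.
apply: (@le_lt_trans _ _ (\int[gam]_z (M * wexp a (r + s * z))%:E)%E).
  apply: le_integral_ge0.
  - by apply: (measurable_compT mf); mfun.
  - by move=> z; exact: f0.
  - by rewrite /wexp; mfun.
  - by move=> z; case/andP: (fM (r + s * z)).
have ie e : (\int[gam]_z (expR (e * (r + s * z)))%:E = (expR (e * r) * expR ((e * s) ^+ 2 / 2))%:E)%E.
  rewrite EFinM -(gauss_expR (e * s)) -integralZ_ge0; last 3 first.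
  - by mfun.
  - by move=> z; exact: expR_ge0.
  - exact: expR_ge0.
  by apply: eq_integral => z _; rewrite -expRD; congr (expR _)%:E; ring.
rewrite integralZ_ge0; last 3 first.
- by rewrite /wexp; mfun.
- by move=> z; exact: wexp_ge0.
- exact: M0.
rewrite /wexp integralD_ge0; last 4 first.
- exact: me.
- by move=> z; exact: expR_ge0.
- exact: me.
- by move=> z; exact: expR_ge0.
by rewrite !ie -EFinD -EFinM ltry.
Qed.

Lemma gsmooth_ge0 s r : 0 <= gsmooth s f r.
Proof. by rewrite -lee_fin -gsmooth_fin; apply: integral_real_ge0 => z; exact: f0. Qed.

Lemma measurable_gsmooth s : measurable_fun setT (gsmooth s f).
Proof.
apply/measurable_EFinP.
have -> : EFin \o gsmooth s f = fun r => (\int[gam]_z (f (r + s * z))%:E)%E.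
  by apply/funext => r /=; rewrite gsmooth_fin.
apply: (measurable_integral2 gam (F := fun z : R * R => (f (z.1 + s * z.2))%:E)).
  by apply: measurable_fun_EFin; apply: (measurable_compT mf); mfun.
by move=> z; rewrite lee_fin f0.
Qed.

End smoothing.

(** * Mean-square approximation of a weighted average over the field *)

Section core.
Context {R : realType} {d : measure_display} {T : measurableType d}.
Variables (P : probability T R) (J : finType) (p : pred J) (Z : J -> T -> R).
Local Notation gam := (normal_prob (0 : R) 1).

Definition dot (u v : J -> R) : R := \sum_(j | p j) u j * v j.
Definition lin (u : J -> R) (w : T) : R := \sum_(j | p j) u j * Z j w.

Hypothesis HZ : forall u v, bigauss P (lin u) (lin v) (dot u u) (dot u v) (dot v v).

Variables (S : finType) (x : S -> J -> R) (pi : S -> R).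
Hypothesis pi0 : forall s, 0 <= pi s.
Hypothesis pi1 : \sum_s pi s = 1.

Definition bary (j : J) : R := \sum_s pi s * x s j.

Lemma lin_comb (a b c : R) (u v y : J -> R) w :
  lin (fun j => a * u j + b * v j + c * y j) w = a * lin u w + b * lin v w + c * lin y w.
Proof.
rewrite /lin !mulr_sumr -!big_split; apply: eq_bigr => j _ /=; ring.
Qed.

Lemma dot_comb (a b c a' b' c' : R) (u v y : J -> R) :
  dot (fun j => a * u j + b * v j + c * y j) (fun j => a' * u j + b' * v j + c' * y j) =
  a * a' * dot u u + b * b' * dot v v + c * c' * dot y y +
  (a * b' + b * a') * dot u v + (a * c' + c * a') * dot u y + (b * c' + c * b') * dot v y.
Proof.
rewrite /dot !mulr_sumr -!big_split; apply: eq_bigr => j _ /=; ring.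
Qed.

Lemma lin_bary w : lin bary w = \sum_s pi s * lin (x s) w.
Proof.
rewrite /lin; under eq_bigr do rewrite mulr_suml.
rewrite exchange_big/=; apply: eq_bigr => s _; rewrite mulr_sumr.
by apply: eq_bigr => j _; rewrite mulrA.
Qed.

Lemma dot_baryr u : dot u bary = \sum_s pi s * dot u (x s).
Proof.
rewrite /dot; under eq_bigr do rewrite mulr_sumr.
rewrite exchange_big/=; apply: eq_bigr => s _; rewrite mulr_sumr.
by apply: eq_bigr => j _; ring.
Qed.

Lemma dotC u v : dot u v = dot v u.
Proof. by apply: eq_bigr => j _; rewrite mulrC. Qed.

Lemma measurable_lin u : measurable_fun setT (lin u).
Proof. by have [] := HZ u u. Qed.

Variables (q eta : R).
Hypothesis q0 : 0 <= q.
Hypothesis q1 : q < 1.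
Hypothesis eta0 : 0 <= eta.
Hypothesis dot_diag : forall s, dot (x s) (x s) = 1 - eta.
Hypothesis dot_le1 : forall s s', dot (x s) (x s') <= 1.

Definition odev s s' : R := `|dot (x s) (x s') - q|.
Definition Delta : R := \sum_s \sum_s' pi s * pi s' * odev s s'.

Definition rowdev s : R := \sum_s' pi s' * odev s s'.

Lemma pi_rowdev : \sum_s pi s * rowdev s = Delta.
Proof.
apply: eq_bigr => s _; rewrite mulr_sumr; apply: eq_bigr => s' _; exact: mulrA.
Qed.

Lemma wavg_cst (c : R) : \sum_s pi s * c = c.
Proof. by rewrite -mulr_suml pi1 mul1r. Qed.

Lemma wavg_sub (F : S -> R) (c : R) : \sum_s pi s * F s - c = \sum_s pi s * (F s - c).
Proof. by rewrite -[X in _ - X]wavg_cst -sumrB; apply: eq_bigr => s _; rewrite mulrBr. Qed.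

Lemma wavg_norm_le (F : S -> R) : `|\sum_s pi s * F s| <= \sum_s pi s * `|F s|.
Proof.
apply: (le_trans (ler_norm_sum _ _ _)); apply: ler_sum => s _.
by rewrite normrM ger0_norm.
Qed.

Lemma wavg_le (F G : S -> R) : (forall s, F s <= G s) -> \sum_s pi s * F s <= \sum_s pi s * G s.
Proof. by move=> FG; apply: ler_sum => s _; rewrite ler_wpM2l. Qed.

Lemma dot_bary_dev s : `|dot (x s) bary - q| <= rowdev s.
Proof. by rewrite dot_baryr wavg_sub; exact: wavg_norm_le. Qed.

Lemma dot_barybary_dev : `|dot bary bary - q| <= Delta.
Proof.
rewrite dot_baryr wavg_sub -pi_rowdev; apply: (le_trans (wavg_norm_le _)).
by apply: wavg_le => s; rewrite dotC; exact: dot_bary_dev.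
Qed.

Lemma dot_bary_le1 s : dot (x s) bary <= 1.
Proof.
rewrite dot_baryr -[leRHS](wavg_cst 1); apply: wavg_le => s'; exact: dot_le1.
Qed.

Lemma dot_barybary_le1 : dot bary bary <= 1.
Proof.
by rewrite dot_baryr -[leRHS](wavg_cst 1); apply: wavg_le => s; rewrite dotC dot_bary_le1.
Qed.

(** The smoothed function of the barycentre is an average over an auxiliary normal z, so each term
    of the expanded square is a correlation of f over some Gaussian pair. All are close to the same
    number [t0], which the coefficients 1, -2, 1 cancel. *)
Lemma core_estimate (a C M : R) (f : R -> R) : compare_cst q a C -> 0 <= C ->
  measurable_fun setT f -> (forall y, 0 <= f y <= M * wexp a y) ->
  (\int[P]_w ((\sum_s pi s * f (lin (x s) w) -
      gsmooth (Num.sqrt (1 - q)) f (lin bary w)) ^+ 2)%:E <=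
   (C * M ^+ 2 * (4 * eta + 8 * Delta))%:E)%E.
Proof.
move=> hC C0 mf fM.
have f0 y : 0 <= f y by case/andP: (fM y).
set sq := Num.sqrt (1 - q); have sq2 : sq ^+ 2 = 1 - q by rewrite sqr_sqrtr// subr_ge0 ltW.
set t0 := gauss_corr q f.
pose G := gsmooth sq f.
have mG : measurable_fun setT G by exact: (measurable_gsmooth f M a mf fM).
have G0 y : 0 <= G y by exact: (gsmooth_ge0 f M a mf fM).
have GE y : (\int[gam]_z (f (y + sq * z))%:E = (G y)%:E)%E by exact: (gsmooth_fin f M a mf fM).
have mfl u : measurable_fun setT (fun w => f (lin u w)).
  by apply: (measurable_compT mf); exact: measurable_lin.
have mGb : measurable_fun setT (fun w => G (lin bary w)).
  by apply: (measurable_compT mG); exact: measurable_lin.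
have M2 := sqr_ge0 M.
have CM : 0 <= C * M ^+ 2 by rewrite mulr_ge0.
have De0 : 0 <= Delta.
  by apply: sumr_ge0 => s _; apply: sumr_ge0 => s' _; rewrite !mulr_ge0 ?normr_ge0.
have le12 : 1 - eta <= 2 by rewrite (le_trans (lerB (lexx _) eta0))// subr0 ler1n.
have bb2 : dot bary bary + (1 - q) <= 2.
  by have h1 := dot_barybary_le1; have h2 := q0; lra.
have bbd := dot_barybary_dev.
have bbE : `|dot bary bary + (1 - q) - 1| = `|dot bary bary - q| by congr `|_|; ring.
have etaE : `|1 - eta - 1| = eta by rewrite addrAC subrr add0r normrN ger0_norm.
(* The three kinds of pairs: two replicas, a replica and the smoothed barycentre,
   the smoothed barycentre with itself. *)
have hrr s s' : exists2 r : R, (\int[P]_w (f (lin (x s) w) * f (lin (x s') w))%:E = r%:E)%E &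
    `|r - t0| <= C * M ^+ 2 * (2 * eta + odev s s').
  have := HZ (x s) (x s'); rewrite !dot_diag => B.
  have [r rE hr] := hC _ _ _ _ _ _ _ _ f M B le12 le12 mf fM.
  exists r => //; move: hr; rewrite etaE -/(odev s s') -/t0.
  have -> : eta + odev s s' + eta = 2 * eta + odev s s' by ring.
  by [].
(* The auxiliary variable is added to the barycentre only: its variance rises from about q to about
   1, while the covariance with the replica stays near q. *)
have hrb s : exists2 r : R, (\int[P]_w (f (lin (x s) w) * G (lin bary w))%:E = r%:E)%E &
    `|r - t0| <= C * M ^+ 2 * (eta + rowdev s + Delta).
  have := bigauss_add P _ _ _ _ _ 0 sq (HZ (x s) bary).
  rewrite dot_diag sq2 mul0r expr2 mul0r !addr0 => B.
  have [r rE hr] := hC _ _ _ _ _ _ _ _ f M B le12 bb2 mf fM.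
  exists r.
    rewrite -rE.
    have mH : measurable_fun [set: T * R] (fun z => (f (lin (x s) z.1 + 0 * z.2) * f (lin bary z.1 + sq * z.2))%:E).
      apply: measurable_fun_EFin; apply: measurable_funM; apply: (measurable_compT mf).
        apply: measurable_funD; last by mfun.
        exact: (measurable_compT (measurable_lin (x s)) measurable_fst).
      apply: measurable_funD; last by mfun.
      exact: (measurable_compT (measurable_lin bary) measurable_fst).
    rewrite (integral_prod1 P gam mH) => [|z]; last by rewrite lee_fin mulr_ge0.
    apply: eq_integral => w _ /=.
    rewrite EFinM -GE -integralZ_ge0.
    - by apply: eq_integral => z _; rewrite mul0r addr0.
    - by apply: (measurable_compT mf); mfun.
    - by move=> z; exact: f0.
    - exact: f0.
  apply: (le_trans hr); rewrite etaE bbE ler_wpM2l//.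
  by apply: lerD => //; rewrite lerD2l; exact: dot_bary_dev.
(* The square of [G] needs two independent auxiliary variables, one per factor; they raise both
   variances and leave the covariance at [dot bary bary]. *)
have [r3 r3E hr3] : exists2 r : R, (\int[P]_w (G (lin bary w) * G (lin bary w))%:E = r%:E)%E &
    `|r - t0| <= C * M ^+ 2 * (3 * Delta).
  have B1 := bigauss_add P _ _ _ _ _ sq 0 (HZ bary bary).
  pose PG : probability (T * measurableTypeR R)%type R := (P \x gam)%E.
  have := bigauss_add PG _ _ _ _ _ 0 sq B1.
  have -> : dot bary bary + sq ^+ 2 + 0 ^+ 2 = dot bary bary + (1 - q) by rewrite sq2; ring.
  have -> : dot bary bary + 0 ^+ 2 + sq ^+ 2 = dot bary bary + (1 - q) by rewrite sq2; ring.
  have -> : dot bary bary + sq * 0 + 0 * sq = dot bary bary by ring.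
  move=> B.
  have [r rE hr] := hC _ _ _ _ _ _ _ _ f M B bb2 bb2 mf fM.
  exists r; last first.
    by apply: (le_trans hr); rewrite bbE ler_wpM2l//; lra.
  rewrite -rE.
  have mlb : measurable_fun [set: T * R] (fun z => lin bary z.1).
    exact: (measurable_compT (measurable_lin bary) measurable_fst).
  have mH : measurable_fun [set: (T * R) * R] (fun z => (f (lin bary z.1.1 + sq * z.1.2 + 0 * z.2) *
      f (lin bary z.1.1 + 0 * z.1.2 + sq * z.2))%:E).
    have m1 : measurable_fun [set: (T * R) * R] (fun z => lin bary z.1.1).
      exact: (measurable_compT mlb measurable_fst).
    have m2 : measurable_fun [set: (T * R) * R] (fun z => z.1.2).
      exact: (measurable_compT measurable_snd measurable_fst).
    by apply: measurable_fun_EFin; apply: measurable_funM; apply: (measurable_compT mf); mfun.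
  rewrite (integral_prod1 PG gam mH) => [|z]; last by rewrite lee_fin mulr_ge0.
  have inner (z : T * R) : (\int[gam]_y (f (lin bary z.1 + sq * z.2 + 0 * y) * f (lin bary z.1 + 0 * z.2 + sq * y))%:E =
      (f (lin bary z.1 + sq * z.2) * G (lin bary z.1))%:E)%E.
    rewrite EFinM -GE -integralZ_ge0.
    - by apply: eq_integral => y _; rewrite !mul0r !addr0.
    - by apply: (measurable_compT mf); mfun.
    - by move=> y; exact: f0.
    - exact: f0.
  have -> : (\int[(P \x gam)%E]_z \int[gam]_y (f (lin bary z.1 + sq * z.2 + 0 * y) * f (lin bary z.1 + 0 * z.2 + sq * y))%:E =
     \int[(P \x gam)%E]_z (f (lin bary z.1 + sq * z.2) * G (lin bary z.1))%:E)%E.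
    by apply: eq_integral => z _; exact: inner.
  have mH2 : measurable_fun [set: T * R] (fun z => (f (lin bary z.1 + sq * z.2) * G (lin bary z.1))%:E).
    apply: measurable_fun_EFin; apply: measurable_funM; last exact: (measurable_compT mG mlb).
    by apply: (measurable_compT mf); mfun.
  rewrite (integral_prod1 P gam mH2) => [|z]; last by rewrite lee_fin mulr_ge0.
  apply: eq_integral => w _ /=.
  rewrite [LHS]EFinM -{1}GE muleC -integralZ_ge0.
  - by apply: eq_integral => z _; rewrite mulrC.
  - by apply: (measurable_compT mf); mfun.
  - by move=> z; exact: f0.
  - exact: G0.
have [rr rrP] : {rr : S -> S -> R | forall s s',
    (\int[P]_w (f (lin (x s) w) * f (lin (x s') w))%:E = (rr s s')%:E)%E /\
    `|rr s s' - t0| <= C * M ^+ 2 * (2 * eta + odev s s')}.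
  exists (fun s s' => sval (cid2 (hrr s s'))) => s s'.
  by case: cid2.
have [rb rbP] : {rb : S -> R | forall s,
    (\int[P]_w (f (lin (x s) w) * G (lin bary w))%:E = (rb s)%:E)%E /\
    `|rb s - t0| <= C * M ^+ 2 * (eta + rowdev s + Delta)}.
  by exists (fun s => sval (cid2 (hrb s))) => s; case: cid2.
pose A w := \sum_s pi s * f (lin (x s) w).
pose B w := G (lin bary w).
have mA : measurable_fun setT A.
  by apply: measurable_sum => s; apply: measurable_funM; [exact: measurable_cst|exact: mfl].
have A0 w : 0 <= A w by apply: sumr_ge0 => s _; rewrite mulr_ge0.
have IA : (\int[P]_w (A w * A w)%:E = (\sum_s pi s * \sum_s' pi s' * rr s s')%:E)%E.
  transitivity (\int[P]_w (\sum_s pi s * \sum_s' pi s' * (f (lin (x s) w) * f (lin (x s') w)))%:E)%E.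
    apply: eq_integral => w _; congr EFin; rewrite {1}/A mulr_suml; apply: eq_bigr => s _.
    rewrite -mulrA; congr (_ * _); rewrite mulr_sumr; apply: eq_bigr => s' _; ring.
  have mff s s' : measurable_fun setT (fun w => f (lin (x s) w) * f (lin (x s') w)) by exact: measurable_funM.
  have ff0 s s' w : 0 <= f (lin (x s) w) * f (lin (x s') w) by rewrite mulr_ge0.
  have msum s : measurable_fun setT (fun w => \sum_s' pi s' * (f (lin (x s) w) * f (lin (x s') w))).
    by apply: measurable_sum => s'; apply: measurable_funM; [exact: measurable_cst|].
  have sum0 s w : 0 <= \sum_s' pi s' * (f (lin (x s) w) * f (lin (x s') w)).
    by apply: sumr_ge0 => s' _; rewrite mulr_ge0.
  rewrite integral_sum_ge0.
  - rewrite -sumEFin; apply: eq_bigr => s _.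
    rewrite (integralZ_ge0 P _ (msum s) (sum0 s) (pi0 s)) EFinM; congr (_ * _)%E.
    rewrite integral_sum_ge0.
    + rewrite -sumEFin; apply: eq_bigr => s' _.
      by rewrite (integralZ_ge0 P _ (mff s s') (ff0 s s') (pi0 s')) (rrP s s').1.
    + by move=> s'; apply: measurable_funM; [exact: measurable_cst|].
    + by move=> s' w; rewrite mulr_ge0.
  - by move=> s; apply: measurable_funM; [exact: measurable_cst|].
  - by move=> s w; rewrite mulr_ge0.
have IAB : (\int[P]_w (A w * B w)%:E = (\sum_s pi s * rb s)%:E)%E.
  transitivity (\int[P]_w (\sum_s pi s * (f (lin (x s) w) * G (lin bary w)))%:E)%E.
    apply: eq_integral => w _; congr EFin; rewrite /A mulr_suml; apply: eq_bigr => s _.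
    by rewrite -mulrA.
  have mfG s : measurable_fun setT (fun w => f (lin (x s) w) * G (lin bary w)) by exact: measurable_funM.
  have fG0 s w : 0 <= f (lin (x s) w) * G (lin bary w) by rewrite mulr_ge0.
  rewrite integral_sum_ge0.
  - rewrite -sumEFin; apply: eq_bigr => s _.
    by rewrite (integralZ_ge0 P _ (mfG s) (fG0 s) (pi0 s)) (rbP s).1.
  - by move=> s; apply: measurable_funM; [exact: measurable_cst|].
  - by move=> s w; rewrite mulr_ge0.
(* The cross term stands on the left so that all integrands are nonnegative; all values being
   finite, it is subtracted afterwards. *)
have key : (\int[P]_w ((A w - B w) ^+ 2)%:E + (2 * \sum_s pi s * rb s)%:E =
   (\sum_s pi s * (\sum_s' pi s' * rr s s') + r3)%:E)%E.
  have mB : measurable_fun setT B by exact: mGb.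
  have m2 : measurable_fun setT (fun w => (A w - B w) ^+ 2) by mfun.
  have mAB : measurable_fun setT (fun w => A w * B w) by mfun.
  have AB0 w : 0 <= A w * B w by rewrite mulr_ge0// G0.
  rewrite EFinM -IAB -(integralZ_ge0 P 2 mAB AB0)//.
  rewrite -integralD_ge0; [|exact: m2|by move=> w; exact: sqr_ge0|mfun|by move=> w; rewrite mulr_ge0].
  rewrite EFinD -IA -r3E -integralD_ge0.
  - by apply: eq_integral => w _; congr EFin; rewrite /B; ring.
  - by mfun.
  - by move=> w; rewrite mulr_ge0.
  - by mfun.
  - by move=> w; rewrite mulr_ge0.
have -> : (\int[P]_w ((\sum_s pi s * f (lin (x s) w) - G (lin bary w)) ^+ 2)%:E =
   (\sum_s pi s * (\sum_s' pi s' * rr s s') + r3 - 2 * \sum_s pi s * rb s)%:E)%E.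
  move: key; rewrite -/(A _) -/(B _).
  have : (0 <= \int[P]_w ((A w - B w) ^+ 2)%:E)%E by apply: integral_real_ge0 => w; exact: sqr_ge0.
  rewrite /A /B; case: integral => // i _ [h]; congr EFin.
  by rewrite -h; ring.
rewrite lee_fin.
set K := C * M ^+ 2 in CM hr3 *.
have E1 : \sum_s pi s * (\sum_s' pi s' * rr s s') - t0 <= K * (2 * eta + Delta).
  rewrite wavg_sub.
  have -> : K * (2 * eta + Delta) = \sum_s pi s * (K * (2 * eta + rowdev s)).
    rewrite -pi_rowdev -{1}(wavg_cst (2 * eta)) -big_split mulr_sumr; apply: eq_bigr => s _ /=; ring.
  apply: wavg_le => s; rewrite wavg_sub.
  have -> : K * (2 * eta + rowdev s) = \sum_s' pi s' * (K * (2 * eta + odev s s')).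
    rewrite /rowdev -{1}(wavg_cst (2 * eta)) -big_split mulr_sumr; apply: eq_bigr => s' _ /=; ring.
  apply: wavg_le => s'; apply: (le_trans (ler_norm _)); exact: (rrP s s').2.
have E2 : t0 - \sum_s pi s * rb s <= K * (eta + 2 * Delta).
  have -> : t0 - \sum_s pi s * rb s = \sum_s pi s * (t0 - rb s).
    by rewrite -opprB wavg_sub -sumrN; apply: eq_bigr => s _; ring.
  have -> : K * (eta + 2 * Delta) = \sum_s pi s * (K * (eta + rowdev s + Delta)).
    have -> : eta + 2 * Delta = (eta + Delta) + Delta by ring.
    rewrite -{2}pi_rowdev -{1}(wavg_cst (eta + Delta)) -big_split mulr_sumr.
    by apply: eq_bigr => s _ /=; ring.
  apply: wavg_le => s; apply: (le_trans (ler_norm _)); rewrite distrC; exact: (rbP s).2.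
have E3 : r3 - t0 <= K * (3 * Delta) by exact: (le_trans (ler_norm _) hr3).
have -> : K * (4 * eta + 8 * Delta) = K * (2 * eta + Delta) + 2 * (K * (eta + 2 * Delta)) + K * (3 * Delta) by ring.
lra.
Qed.

End core.

(** * Centring of the field under an exponential tilt *)

Section tilt.
Context {R : realType} {d : measure_display} {T : measurableType d}.
Variables (P : probability T R) (J : finType) (p : pred J) (Z : J -> T -> R).
Local Notation dot := (dot J p).
Local Notation lin := (lin J p Z).
Hypothesis HZ : forall u v, bigauss P (lin u) (lin v) (dot u u) (dot u v) (dot v v).
Variables (S : finType) (x : S -> J -> R) (pi : S -> R).
Hypothesis pi0 : forall s, 0 <= pi s.
Hypothesis pi1 : \sum_s pi s = 1.
Local Notation bary := (bary J S x pi).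
Variables (q eta : R).
Hypothesis q0 : 0 <= q.
Hypothesis q1 : q < 1.
Hypothesis eta01 : 0 <= eta <= 1.
Hypothesis dot_diag : forall s, dot (x s) (x s) = 1 - eta.
Hypothesis dot_abs_le1 : forall s s', -1 <= dot (x s) (x s') <= 1.
Local Notation odev := (odev J p S x q).
Local Notation rowdev := (rowdev J p S x pi q).
Local Notation Delta := (Delta J p S x pi q).

(** exp(2 b^2) bounds the mass exp(Var / 2) of the tilt by two replicas. The 7 bounds
    [eta + D12 + D1 + D2], whose terms are at most 1, 2, 2 and 2. *)
Definition tilt_cst (b : R) : R := expR (2 * b ^+ 2) * (7 * b ^+ 2 + gauss_m2).

Lemma tilt_cst_ge0 b : 0 <= tilt_cst b.
Proof. by rewrite mulr_ge0 ?expR_ge0// addr_ge0 ?gauss_m2_ge0// mulr_ge0// sqr_ge0. Qed.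

(** Write l, l' for the fields of two replicas and r for that of the barycentre. When the overlaps
    are near q, the tilt by exp(b l + b l') moves the mean of l - r by about b (1 - q), which is
    what is subtracted, and l - r and l' - r are nearly uncorrelated. Hence each pair contributes at
    most a multiple of its overlap deviations. *)
Lemma tilt_estimate (b : R) :
  (\int[P]_w ((\sum_s pi s * ((lin (x s) w - lin bary w - b * (1 - q)) * expR (b * lin (x s) w))) ^+ 2)%:E
   <= (tilt_cst b * (eta + 4 * Delta))%:E)%E.
Proof.
have eta0 : 0 <= eta by case/andP: eta01.
have eta1 : eta <= 1 by case/andP: eta01.
have dle s s' : dot (x s) (x s') <= 1 by case/andP: (dot_abs_le1 s s').
set e := b * (1 - q).
(* Polarisation: the product of the factors of two replicas is a quarter of [U] minus [V], both
   nonnegative. [zz] is the direction of the tilt, [yp] and [ym] are the sum and the difference of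
   the centred fields. *)
pose zz s s' j := b * x s j + b * x s' j + 0 * bary j.
pose yp s s' j := 1 * x s j + 1 * x s' j + (- 2) * bary j.
pose ym s s' j := 1 * x s j + (- 1) * x s' j + 0 * bary j.
pose U s s' w := (lin (yp s s') w - 2 * e) ^+ 2 * expR (lin (zz s s') w).
pose V s s' w := (lin (ym s s') w - 0) ^+ 2 * expR (lin (zz s s') w).
have mlin u : measurable_fun setT (lin u) by exact: (measurable_lin P J p Z HZ).
have mU s s' : measurable_fun setT (U s s') by rewrite /U; mfun; exact: mlin.
have mV s s' : measurable_fun setT (V s s') by rewrite /V; mfun; exact: mlin.
have U0 s s' w : 0 <= U s s' w by rewrite mulr_ge0 ?sqr_ge0 ?expR_ge0.
have V0 s s' w : 0 <= V s s' w by rewrite mulr_ge0 ?sqr_ge0 ?expR_ge0.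
pose iU s s' := expR (dot (zz s s') (zz s s') / 2) *
  ((dot (zz s s') (yp s s') - 2 * e) ^+ 2 + gauss_m2 * dot (yp s s') (yp s s')).
pose iV s s' := expR (dot (zz s s') (zz s s') / 2) *
  ((dot (zz s s') (ym s s') - 0) ^+ 2 + gauss_m2 * dot (ym s s') (ym s s')).
have IU s s' : (\int[P]_w (U s s' w)%:E = (iU s s')%:E)%E.
  exact: (bigauss_quad _ _ _ _ _ _ _ (HZ (zz s s') (yp s s'))).
have IV s s' : (\int[P]_w (V s s' w)%:E = (iV s s')%:E)%E.
  exact: (bigauss_quad _ _ _ _ _ _ _ (HZ (zz s s') (ym s s'))).
pose k s w := (lin (x s) w - lin bary w - e) * expR (b * lin (x s) w).
have kk s s' w : k s w * k s' w + 4^-1 * V s s' w = 4^-1 * U s s' w.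
  rewrite /k /U /V /zz /yp /ym !(lin_comb J p Z) !mul0r !addr0 expRD.
  by field.
have sqE w : (\sum_s pi s * k s w) ^+ 2 + 4^-1 * (\sum_s \sum_s' pi s * pi s' * V s s' w) =
    4^-1 * (\sum_s \sum_s' pi s * pi s' * U s s' w).
  have -> : (\sum_s pi s * k s w) ^+ 2 = \sum_s \sum_s' pi s * pi s' * (k s w * k s' w).
    rewrite expr2 mulr_suml; apply: eq_bigr => s _; rewrite mulr_sumr.
    by apply: eq_bigr => s' _; ring.
  rewrite !mulr_sumr -big_split; apply: eq_bigr => s _ /=.
  rewrite !mulr_sumr -big_split; apply: eq_bigr => s' _ /=.
  by rewrite [RHS]mulrCA -kk; ring.
have intS (F : S -> S -> T -> R) (i : S -> S -> R) :
    (forall s s', measurable_fun setT (F s s')) -> (forall s s' w, 0 <= F s s' w) ->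
    (forall s s', \int[P]_w (F s s' w)%:E = (i s s')%:E)%E ->
    (\int[P]_w (4^-1 * (\sum_s \sum_s' pi s * pi s' * F s s' w))%:E =
      (4^-1 * \sum_s \sum_s' pi s * pi s' * i s s')%:E)%E.
  move=> mF F0 iF.
  have pp0 s s' : 0 <= pi s * pi s' by rewrite mulr_ge0.
  have mF1 s s' : measurable_fun setT (fun w => pi s * pi s' * F s s' w).
    by apply: measurable_funM; [exact: measurable_cst|].
  have F10 s s' w : 0 <= pi s * pi s' * F s s' w by rewrite mulr_ge0.
  have mF2 s : measurable_fun setT (fun w => \sum_s' pi s * pi s' * F s s' w).
    by apply: measurable_sum => s'.
  have F20 s w : 0 <= \sum_s' pi s * pi s' * F s s' w by apply: sumr_ge0.
  rewrite integralZ_ge0.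
  - rewrite EFinM; congr (_ * _)%E; rewrite (integral_sum_ge0 P _ _ mF2 F20) -sumEFin.
    apply: eq_bigr => s _; rewrite (integral_sum_ge0 P _ _ (mF1 s) (F10 s)) -sumEFin.
    by apply: eq_bigr => s' _; rewrite (integralZ_ge0 P _ (mF s s') (F0 s s') (pp0 s s')) iF.
  - by apply: measurable_sum => s.
  - by move=> w; apply: sumr_ge0.
  - by rewrite invr_ge0.
have mk w : measurable_fun setT (fun w => \sum_s pi s * k s w).
  apply: measurable_sum => s; apply: measurable_funM; first exact: measurable_cst.
  by rewrite /k; mfun; exact: mlin.
have key : (\int[P]_w ((\sum_s pi s * k s w) ^+ 2)%:E + (4^-1 * \sum_s \sum_s' pi s * pi s' * iV s s')%:E =
  (4^-1 * \sum_s \sum_s' pi s * pi s' * iU s s')%:E)%E.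
  rewrite -(intS U iU mU U0 IU) -(intS V iV mV V0 IV).
  rewrite -integralD_ge0.
  - by apply: eq_integral => w _; rewrite sqE.
  - by apply: measurable_funX; exact: mk.
  - by move=> w; exact: sqr_ge0.
  - apply: measurable_funM; first exact: measurable_cst.
    apply: measurable_sum => s; apply: measurable_sum => s'.
    by apply: measurable_funM; [exact: measurable_cst|].
  - move=> w; rewrite mulr_ge0 ?invr_ge0//; apply: sumr_ge0 => s _.
    by apply: sumr_ge0 => s' _; apply: mulr_ge0 => //; apply: mulr_ge0.
have -> : (\int[P]_w ((\sum_s pi s * ((lin (x s) w - lin bary w - e) * expR (b * lin (x s) w))) ^+ 2)%:E =
   (\sum_s \sum_s' pi s * pi s' * (4^-1 * (iU s s' - iV s s')))%:E)%E.
  move: key; rewrite -/(k _ _).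
  have : (0 <= \int[P]_w ((\sum_s pi s * k s w) ^+ 2)%:E)%E by apply: integral_real_ge0 => w; exact: sqr_ge0.
  rewrite /k; case: integral => // i _ [h]; congr EFin.
  apply: (addIr (4^-1 * \sum_s \sum_s' pi s * pi s' * iV s s')); rewrite h.
  rewrite !mulr_sumr -big_split; apply: eq_bigr => s _ /=.
  by rewrite !mulr_sumr -big_split; apply: eq_bigr => s' _ /=; ring.
rewrite lee_fin.
have dev s s' : `|dot (x s) (x s') - q| = odev s s' by [].
have devm s : `|dot (x s) bary - q| <= rowdev s by exact: (dot_bary_dev J p S x pi pi0 pi1).
have devmm : `|dot bary bary - q| <= Delta by exact: (dot_barybary_dev J p S x pi pi0 pi1).
have odev2 s s' : odev s s' <= 2.
  rewrite -dev ler_norml; have /andP[? ?] := dot_abs_le1 s s'.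
  by have := q0; have := q1; lra.
have rowdev2 s : rowdev s <= 2.
  by rewrite -[leRHS](wavg_cst S pi pi1); apply: (wavg_le S pi pi0).
have pair s s' : 4^-1 * (iU s s' - iV s s') <=
    tilt_cst b * (eta + odev s s' + rowdev s + rowdev s' + Delta).
  rewrite /iU /iV /zz /yp /ym !(dot_comb J p) !dot_diag.
  have := devm s; have := devm s'; have := devmm; have := dev s s'; have := odev2 s s'.
  have := rowdev2 s; have := rowdev2 s'.
  have := dot_abs_le1 s s'.
  move: (odev s s') (rowdev s) (rowdev s') (Delta) => D12 D1 D2 Dm.
  move: (dot (x s) (x s')) (dot (x s) bary) (dot (x s') bary) (dot bary bary) => d12 d1 d2 dm.
  move=> /andP[d12l d12u] D2le D1le D12le D12E hm h2 h1.
  have m20 := gauss_m2_ge0 (R := R).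
  set E := expR _; set m2 := gauss_m2 in m20 *.
  have E0 : 0 <= E by exact: expR_ge0.
  have b2 := sqr_ge0 b.
  have EE : E <= expR (2 * b ^+ 2).
    rewrite ler_expR.
    have -> : (b * b * (1 - eta) + b * b * (1 - eta) + 0 * 0 * dm + (b * b + b * b) * d12 +
      (b * 0 + 0 * b) * d1 + (b * 0 + 0 * b) * d2) / 2 = b ^+ 2 * (1 - eta + d12) by field.
    by rewrite mulrC ler_wpM2r//; lra.
  (* [b * A] is the tilted mean of l - r minus [e], and [W] is the covariance of l - r and l' - r;
     both vanish when eta = 0 and all products equal q. *)
  set A := - eta + (d12 - q) - (d1 - q) - (d2 - q).
  set W := (d12 - q) - (d1 - q) - (d2 - q) + (dm - q).
  set LHS := (X in X <= _).
  have -> : LHS = E * (b ^+ 2 * A ^+ 2 + m2 * W).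
    by rewrite /LHS /A /W /e; field.
  set B := eta + D12 + D1 + D2 + Dm.
  have D120 : 0 <= D12 by rewrite -D12E.
  have D10 : 0 <= D1 by exact: (le_trans (normr_ge0 _) h1).
  have D20 : 0 <= D2 by exact: (le_trans (normr_ge0 _) h2).
  have Dm0 : 0 <= Dm by exact: (le_trans (normr_ge0 _) hm).
  have B0 : 0 <= B by rewrite /B !addr_ge0.
  move: D12E => /eqP; rewrite eq_sym => /eqP D12E.
  have D12E' : `|d12 - q| <= D12 by rewrite D12E.
  move: h1 h2 hm D12E'; rewrite !ler_norml => /andP[l1 u1] /andP[l2 u2] /andP[lm um] /andP[l12 u12].
  have AB : `|A| <= eta + D12 + D1 + D2 by rewrite ler_norml /A; apply/andP; split; lra.
  have A2 : A ^+ 2 <= 7 * B.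
    rewrite -real_normK ?num_real// expr2.
    apply: ler_pM => //; first by rewrite (le_trans AB)//; lra.
    by rewrite (le_trans AB)// /B; lra.
  have WB : W <= B by rewrite /W /B; lra.
  have h : b ^+ 2 * A ^+ 2 + m2 * W <= (7 * b ^+ 2 + m2) * B.
    have -> : (7 * b ^+ 2 + m2) * B = b ^+ 2 * (7 * B) + m2 * B by ring.
    by apply: lerD; rewrite ler_wpM2l.
  apply: (@le_trans _ _ (E * ((7 * b ^+ 2 + m2) * B))); first by rewrite ler_wpM2l.
  rewrite /tilt_cst -mulrA ler_wpM2r//; apply: mulr_ge0 => //.
  by rewrite addr_ge0// mulr_ge0.
apply: (@le_trans _ _ (\sum_s pi s * \sum_s' pi s' * (tilt_cst b * (eta + odev s s' + rowdev s + rowdev s' + Delta)))).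
  apply: ler_sum => s _; rewrite mulr_sumr; apply: ler_sum => s' _.
  by rewrite -mulrA ler_wpM2l// ler_wpM2l.
have inner s : \sum_s' pi s' * (tilt_cst b * (eta + odev s s' + rowdev s + rowdev s' + Delta)) =
   tilt_cst b * (eta + 2 * Delta) + tilt_cst b * (2 * rowdev s).
  transitivity (\sum_s' pi s' * (tilt_cst b * (eta + rowdev s + Delta)) +
     tilt_cst b * (\sum_s' pi s' * odev s s') + tilt_cst b * (\sum_s' pi s' * rowdev s')).
    by rewrite !mulr_sumr -!big_split; apply: eq_bigr => s' _ /=; ring.
  rewrite (wavg_cst S pi pi1) (pi_rowdev J p S x pi) -/(rowdev s).
  by ring.
under eq_bigr do rewrite inner.
have -> : \sum_s pi s * (tilt_cst b * (eta + 2 * Delta) + tilt_cst b * (2 * rowdev s)) =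
  \sum_s pi s * (tilt_cst b * (eta + 2 * Delta)) + tilt_cst b * 2 * \sum_s pi s * rowdev s.
  by rewrite !mulr_sumr -!big_split; apply: eq_bigr => s' _ /=; ring.
rewrite (wavg_cst S pi pi1) (pi_rowdev J p S x pi) le_eqVlt; apply/orP; left.
by apply/eqP; ring.
Qed.

End tilt.

(** * The cavity measure *)

Section cavity.
Context {R : realType} {d : measure_display} {T : measurableType d} {N : nat}.
Variables (beta h : R) (g : 'I_N -> 'I_N -> T -> R) (i : 'I_N).

Lemma spin_sqr (b : bool) : spin b * spin b = 1 :> R.
Proof. by case: b; rewrite /spin; ring. Qed.

Lemma normr_spin (b : bool) : `|spin b : R| = 1.
Proof. by case: b; rewrite /spin ?normrN normr1. Qed.

Definition offi : pred 'I_N := fun j => j != i.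

Definition replica (s : config N) (j : 'I_N) : R := (Num.sqrt N%:R)^-1 * spin (s j).

Definition field (w : T) (s : config N) : R := lin 'I_N offi (gsym g i) (replica s) w.

Lemma local_fieldE w s : local_field g i w s = field w s.
Proof.
rewrite /local_field /field /lin mulr_sumr; apply: eq_bigr => j _.
by rewrite /replica; ring.
Qed.

Definition cavH (w : T) (s : config N) : R :=
  beta / Num.sqrt N%:R *
    (\sum_(a < N | a != i) \sum_(b < N | (a < b)%N && (b != i)) g a b w * spin (s a) * spin (s b))
  + h * \sum_(j < N | j != i) spin (s j).

Definition cavE (w : T) (s : config N) : R := spin (s i) * (beta * field w s + h).

Lemma split_pairs (E : 'I_N -> 'I_N -> R) :
  \sum_(a < N) \sum_(b < N | (a < b)%N) E a b =
  \sum_(a < N | a != i) \sum_(b < N | (a < b)%N && (b != i)) E a b +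
  \sum_(j < N | j != i) (if (i < j)%N then E i j else E j i).
Proof.
rewrite (bigD1 i)//= addrC.
have -> : \sum_(a < N | a != i) \sum_(b < N | (a < b)%N) E a b =
  \sum_(a < N | a != i) \sum_(b < N | (a < b)%N && (b != i)) E a b +
  \sum_(a < N | a != i) (if (a < i)%N then E a i else 0).
  rewrite -big_split; apply: eq_bigr => a _ /=.
  rewrite (bigID (fun b => b == i))/= addrC; congr (_ + _).
  case: ifPn => ai.
    rewrite (bigD1 i) ?ai ?eqxx//= big1 ?addr0// => b /andP[/andP[_ /eqP->]].
    by rewrite eqxx.
  by rewrite big1// => b /andP[ab /eqP bi]; rewrite -bi ab in ai.
rewrite -addrA; congr (_ + _).
have -> : \sum_(j < N | (i < j)%N) E i j = \sum_(j < N | j != i) (if (i < j)%N then E i j else 0).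
  rewrite -big_mkcondr; apply: eq_bigl => j.
  by case: ltnP; rewrite ?andbF ?andbT// => ij; apply/esym; apply: contraTneq ij => ->; rewrite ltnn.
rewrite -big_split; apply: eq_bigr => j ji /=.
have : (i < j)%N || (j < i)%N by rewrite -neq_ltn eq_sym.
by case: ltngtP => //; rewrite ?addr0 ?add0r.
Qed.

Lemma hamil_cav w s : hamil beta h g w s = cavH w s + cavE w s.
Proof.
rewrite /hamil split_pairs (bigD1 i (P := predT))//= /cavH /cavE /field /lin.
rewrite mulrDr !mulrDr -!addrA; congr (_ + _).
have -> : beta / Num.sqrt N%:R *
  (\sum_(j < N | j != i) (if (i < j)%N then g i j w * spin (s i) * spin (s j) else g j i w * spin (s j) * spin (s i))) =
  spin (s i) * (beta * \sum_(j | offi j) replica s j * gsym g i j w).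
  rewrite !mulr_sumr; apply: eq_bigr => j _.
  by rewrite /replica /gsym; case: ifP => _; ring.
ring.
Qed.

Definition cavZ (w : T) : R := \sum_(s : config N) expR (cavH w s).
Definition cavpi (w : T) (s : config N) : R := expR (cavH w s) / cavZ w.

Lemma config_sum_gt0 (F : config N -> R) : (forall s, 0 < F s) -> 0 < \sum_s F s.
Proof.
move=> F0; rewrite (bigD1 [ffun=> true])//= ltr_pwDl// sumr_ge0// => s _.
exact: ltW.
Qed.

Lemma cavZ_gt0 w : 0 < cavZ w.
Proof. by apply: config_sum_gt0 => s; exact: expR_gt0. Qed.

Lemma cavpi_ge0 w s : 0 <= cavpi w s.
Proof. by rewrite divr_ge0 ?expR_ge0// ltW// cavZ_gt0. Qed.

Lemma cavpi_sum w : \sum_s cavpi w s = 1.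
Proof. by rewrite -mulr_suml divff// gt_eqF// cavZ_gt0. Qed.

Definition flip (s : config N) : config N :=
  [ffun j => if j == i then ~~ s j else s j].

Lemma flipK : involutive flip.
Proof. by move=> s; apply/ffunP => j; rewrite !ffunE; case: eqP; rewrite ?negbK. Qed.

Lemma flip_i s : spin (flip s i) = - spin (s i) :> R.
Proof. by rewrite ffunE eqxx /spin; case: (s i) => /=; rewrite ?opprK. Qed.

Lemma flip_ne s j : j != i -> flip s j = s j.
Proof. by move=> ji; rewrite ffunE (negbTE ji). Qed.

Lemma field_flip w s : field w (flip s) = field w s.
Proof. by apply: eq_bigr => j ji; rewrite /replica flip_ne. Qed.

Lemma cavH_flip w s : cavH w (flip s) = cavH w s.
Proof.
rewrite /cavH; congr (_ * _ + _ * _); last by apply: eq_bigr => j ji; rewrite flip_ne.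
apply: eq_bigr => a ai; apply: eq_bigr => b /andP[_ bi].
by rewrite !flip_ne.
Qed.

Lemma cavpi_flip w s : cavpi w (flip s) = cavpi w s.
Proof. by rewrite /cavpi cavH_flip. Qed.

Lemma sum_flip (F : config N -> R) : \sum_s F (flip s) = \sum_s F s.
Proof. by rewrite [RHS](reindex_inj (inv_inj flipK)). Qed.

Definition chx (y : R) : R := (expR (beta * y + h) + expR (- (beta * y + h))) / 2.
Definition shx (y : R) : R := (expR (beta * y + h) - expR (- (beta * y + h))) / 2.

(** [cavpi] does not see spin i, so F may be replaced by its mean over the two values of that spin;
    the involution [flip] achieves this without configurations on N - 1 sites. *)
Lemma sum_symm (w : T) (F G : config N -> R) :
  (forall s, F (flip s) + F s = G s + G s) ->
  (forall s, G (flip s) = G s) ->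
  \sum_s cavpi w s * F s = \sum_s cavpi w s * G s.
Proof.
move=> FG Gf; have E : \sum_s cavpi w s * F s + \sum_s cavpi w s * F s =
    \sum_s cavpi w s * G s + \sum_s cavpi w s * G s.
  rewrite -{1}sum_flip -!big_split; apply: eq_bigr => s _ /=.
  by rewrite cavpi_flip -!mulrDr FG.
lra.
Qed.

Lemma cavE_flip w s : cavE w (flip s) = - cavE w s.
Proof. by rewrite /cavE field_flip flip_i; ring. Qed.

Lemma expR_cavE w s : expR (cavE w (flip s)) + expR (cavE w s) = chx (field w s) + chx (field w s).
Proof.
rewrite cavE_flip /cavE /chx; case: (s i); rewrite /spin.
  by rewrite mul1r; field.
by rewrite mulN1r opprK; field.
Qed.

Lemma spin_cavE w s : spin (flip s i) * expR (cavE w (flip s)) + spin (s i) * expR (cavE w s) =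
  shx (field w s) + shx (field w s).
Proof.
rewrite flip_i cavE_flip /cavE /shx; case: (s i); rewrite /spin.
  by rewrite mul1r; field.
by rewrite mulN1r !opprK; field.
Qed.

(** The quotient of the full partition function by [cavZ], as the proof of [Gibbs_cav] shows. *)
Definition cavB (w : T) : R := \sum_s cavpi w s * chx (field w s).

Lemma chx_ge1 y : 1 <= chx y.
Proof.
rewrite /chx; set a := _ + h; have := sqr_ge0 (expR (a / 2) - expR (- a / 2)).
rewrite sqrrB -!expRM_natr -expRD.
have -> : a / 2 * 2 = a by field.
have -> : - a / 2 * 2 = - a by field.
have -> : a / 2 + - a / 2 = 0 by field.
rewrite expR0 -/a; lra.
Qed.

Lemma cavB_ge1 w : 1 <= cavB w.
Proof.
rewrite -(wavg_cst _ (cavpi w) (cavpi_sum w) 1).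
by apply: ler_sum => s _; rewrite ler_wpM2l ?cavpi_ge0// chx_ge1.
Qed.

Lemma cavBE w : cavB w = \sum_s cavpi w s * expR (cavE w s).
Proof.
apply/esym/sum_symm => s; first exact: expR_cavE.
by rewrite field_flip.
Qed.

Lemma cavBEN w : cavB w = \sum_s cavpi w s * expR (- cavE w s).
Proof.
rewrite cavBE -sum_flip; apply: eq_bigr => s _.
by rewrite cavpi_flip cavE_flip.
Qed.

Lemma Gibbs_cav w s : Gibbs beta h g w s * cavB w = cavpi w s * expR (cavE w s).
Proof.
have Zp : Zpart beta h g w = cavZ w * cavB w.
  rewrite cavBE mulr_sumr; apply: eq_bigr => s' _.
  rewrite hamil_cav expRD /cavpi; field.
  by rewrite gt_eqF// cavZ_gt0.
have B0 : cavB w != 0 by rewrite gt_eqF// (lt_le_trans ltr01)// cavB_ge1.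
have Z0 : cavZ w != 0 by rewrite gt_eqF// cavZ_gt0.
rewrite /Gibbs Zp hamil_cav expRD /cavpi; field.
by rewrite Z0 B0.
Qed.

Lemma gavg1_cav w (F : config N -> R) :
  gavg1 beta h g F w * cavB w = \sum_s cavpi w s * (F s * expR (cavE w s)).
Proof.
rewrite /gavg1 mulr_suml; apply: eq_bigr => s _.
by rewrite -mulrA Gibbs_cav; ring.
Qed.

Lemma gavg1_field w (F : R -> R) :
  gavg1 beta h g (fun s => F (field w s)) w * cavB w = \sum_s cavpi w s * (F (field w s) * chx (field w s)).
Proof.
rewrite gavg1_cav; apply: sum_symm => s; last by rewrite field_flip.
by rewrite field_flip -mulrDr expR_cavE mulrDr.
Qed.

Lemma gavg1_spin w :
  gavg1 beta h g (fun s => spin (s i)) w * cavB w = \sum_s cavpi w s * shx (field w s).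
Proof.
rewrite gavg1_cav; apply: sum_symm => s; last by rewrite field_flip.
exact: spin_cavE.
Qed.

Lemma Gibbs_ge0 w s : 0 <= Gibbs beta h g w s.
Proof. by rewrite divr_ge0 ?expR_ge0// sumr_ge0// => s' _; exact: expR_ge0. Qed.

Lemma Gibbs_sum w : \sum_s Gibbs beta h g w s = 1.
Proof.
rewrite -mulr_suml divff// gt_eqF//.
by apply: config_sum_gt0 => s; exact: expR_gt0.
Qed.

End cavity.

Lemma measurable_invr_gt0 {d} {T : measurableType d} {R : realType} (f : T -> R) :
  measurable_fun setT f -> (forall w, 0 < f w) -> measurable_fun setT (fun w => (f w)^-1).
Proof.
move=> mf f0; have -> : (fun w => (f w)^-1) = (fun w => expR (- ln (f w))).
  by apply/funext => w; rewrite expRN lnK// posrE.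
apply: measurable_fun_expR; apply: measurable_funN.
exact: (measurable_compT (measurable_ln (R := R)) mf).
Qed.

Lemma measurable_sum_cond {d} {T : measurableType d} {R : realType} (I : finType)
    (p : pred I) (f : I -> T -> R) :
  (forall j, p j -> measurable_fun setT (f j)) ->
  measurable_fun setT (fun w => \sum_(j | p j) f j w).
Proof.
move=> mf; have -> : (fun w => \sum_(j | p j) f j w) =
    (fun w => \sum_j (if p j then f j w else 0)).
  by apply/funext => w; rewrite big_mkcond.
apply: measurable_sum => j; case: (boolP (p j)) => pj; first exact: mf.
exact: measurable_cst.
Qed.

(** * The row of site i and the remaining couplings *)

Section disorder.
Context {R : realType} {d : measure_display} {T : measurableType d} {N : nat}.
Variables (P : probability T R) (beta h : R) (g : 'I_N -> 'I_N -> T -> R) (i : 'I_N).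
Hypothesis hSK : SK_disorder P g.

Local Notation K := ('I_N * 'I_N)%type.
Local Notation X := (fun (k : K) (w : T) => g k.1 k.2 w).
Definition upper : {set K} := [set k : K | (k.1 < k.2)%N]%SET.
Definition rowset : {set K} := [set k : K | (k.1 < k.2)%N && ((k.1 == i) || (k.2 == i))]%SET.
Definition restset : {set K} := [set k : K | (k.1 < k.2)%N && ((k.1 != i) && (k.2 != i))]%SET.
Local Notation Trow := (g_sigma_algebraType (rects (prod 'I_N 'I_N) X rowset)).
Local Notation Trest := (g_sigma_algebraType (rects (prod 'I_N 'I_N) X restset)).

Lemma SK_measurable k : k \in upper -> measurable_fun setT (X k).
Proof. by rewrite inE => k12; case: hSK => [mg _]; exact: mg. Qed.

Lemma SK_indep (S : {set K}) (B : K -> set R) : S \subset upper ->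
  (forall k, measurable (B k)) ->
  P (\bigcap_(k in [set k | k \in S]) (X k @^-1` B k)) =
  (\prod_(k in S) P (X k @^-1` B k))%E.
Proof.
move=> SU mB; case: hSK => [_ [_ ind]]; apply: ind => // k kS.
by have := fintype.subsetP SU k kS; rewrite inE.
Qed.

Lemma SK_normal k B : k \in upper -> measurable B -> P (X k @^-1` B) = normal_prob 0 1 B.
Proof. by rewrite inE => k12 mB; case: hSK => [_ [nrm _]]; exact: nrm. Qed.

Lemma row_upper : rowset \subset upper.
Proof. by apply/fintype.subsetP => k; rewrite !inE => /andP[]. Qed.

Lemma rest_upper : restset \subset upper.
Proof. by apply/fintype.subsetP => k; rewrite !inE => /andP[]. Qed.

Lemma row_rest k : k \in rowset -> k \notin restset.
Proof. by rewrite !inE => /andP[-> /=]; rewrite -negb_or negbK. Qed.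

Definition rowpair (j : 'I_N) : K := if (i < j)%N then (i, j) else (j, i).
Definition rowother (k : K) : 'I_N := if k.1 == i then k.2 else k.1.

Lemma gsym_rowpair j w : gsym g i j w = X (rowpair j) w.
Proof. by rewrite /gsym /rowpair; case: ifP. Qed.

Lemma rowpair_row j : j != i -> rowpair j \in rowset.
Proof.
move=> ji; rewrite inE /rowpair.
have /orP[ij|ij] : (i < j)%N || (j < i)%N by rewrite -neq_ltn eq_sym.
  by rewrite ij /= ij eqxx.
by rewrite (ltnNge i) (ltnW ij) /= ij eqxx orbT.
Qed.

Lemma rowpairK j : j != i -> rowother (rowpair j) = j.
Proof.
move=> ji; rewrite /rowother /rowpair; case: ltnP => //= _; first by rewrite eqxx.
by rewrite (negbTE ji).
Qed.

(** Only couplings with sorted indices are independent normals: [rowpair] lists those of site i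
    without repetition, and [rowother] recovers the other site. *)
Lemma bigauss_row (u v : 'I_N -> R) :
  bigauss P (lin 'I_N (offi i) (gsym g i) u) (lin 'I_N (offi i) (gsym g i) v)
    (dot 'I_N (offi i) u u) (dot 'I_N (offi i) u v) (dot 'I_N (offi i) v v).
Proof.
pose l := [seq rowpair j | j <- index_enum 'I_N & offi i j].
have ul : uniq l.
  rewrite map_inj_in_uniq; first by rewrite filter_uniq// index_enum_uniq.
  move=> a b; rewrite !mem_filter => /andP[ai _] /andP[bi _] ab.
  by rewrite -(rowpairK _ ai) ab rowpairK.
have lU : {subset l <= upper}.
  move=> k /mapP[j]; rewrite mem_filter => /andP[ji _] ->.
  exact: (fintype.subsetP row_upper _ (rowpair_row _ ji)).
have bigE (F : K -> R) : \sum_(k <- l) F k = \sum_(j | offi i j) F (rowpair j).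
  by rewrite big_map big_filter.
have := bigauss_linear P _ X upper SK_measurable SK_indep SK_normal l
  (fun k => u (rowother k)) (fun k => v (rowother k)) ul lU.
rewrite !bigE.
have -> : (fun w => \sum_(k <- l) u (rowother k) * X k w) = lin 'I_N (offi i) (gsym g i) u.
  by apply/funext => w; rewrite bigE; apply: eq_bigr => j ji; rewrite rowpairK// gsym_rowpair.
have -> : (fun w => \sum_(k <- l) v (rowother k) * X k w) = lin 'I_N (offi i) (gsym g i) v.
  by apply/funext => w; rewrite bigE; apply: eq_bigr => j ji; rewrite rowpairK// gsym_rowpair.
have -> : \sum_(j | offi i j) u (rowother (rowpair j)) ^+ 2 = dot 'I_N (offi i) u u.
  by apply: eq_bigr => j ji; rewrite rowpairK// expr2.
have -> : \sum_(j | offi i j) u (rowother (rowpair j)) * v (rowother (rowpair j)) = dot 'I_N (offi i) u v.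
  by apply: eq_bigr => j ji; rewrite rowpairK.
have -> : \sum_(j | offi i j) v (rowother (rowpair j)) ^+ 2 = dot 'I_N (offi i) v v.
  by apply: eq_bigr => j ji; rewrite rowpairK// expr2.
by [].
Qed.

Lemma measurable_field_row (s : config N) :
  measurable_fun setT (fun w : Trow => field g i w s).
Proof.
apply: measurable_sum_cond => j ji.
apply: measurable_funM; first exact: measurable_cst.
have -> : gsym g i j = X (rowpair j) by apply/funext => w; exact: gsym_rowpair.
exact: (measurable_Tsub _ X _ (rowpair_row _ ji)).
Qed.

Lemma measurable_cavH (s : config N) :
  measurable_fun setT (fun w : Trest => cavH beta h g i w s).
Proof.
rewrite /cavH; apply: measurable_funD; last exact: measurable_cst.
apply: measurable_funM; first exact: measurable_cst.
apply: measurable_sum_cond => a ai; apply: measurable_sum_cond => b /andP[ab bi].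
apply: measurable_funM; last exact: measurable_cst.
apply: measurable_funM; last exact: measurable_cst.
have abS : (a, b) \in restset by rewrite inE/= ab ai bi.
exact: (measurable_Tsub _ X (a, b) abS).
Qed.

Lemma measurable_cavpi_rest (s : config N) :
  measurable_fun setT (fun w : Trest => cavpi beta h g i w s).
Proof.
rewrite /cavpi; apply: measurable_funM.
  by apply: measurable_fun_expR; exact: measurable_cavH.
apply: measurable_invr_gt0; last by move=> w; exact: cavZ_gt0.
apply: measurable_sum => s'.
by apply: measurable_fun_expR; exact: measurable_cavH.
Qed.

Lemma measurable_field s : measurable_fun setT (fun w : T => field g i w s).
Proof.
exact: (measurable_compT (measurable_field_row s) (measurable_idsub _ X _ SK_measurable row_upper)).
Qed.

Lemma measurable_cavpi s : measurable_fun setT (fun w : T => cavpi beta h g i w s).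
Proof.
exact: (measurable_compT (measurable_cavpi_rest s) (measurable_idsub _ X _ SK_measurable rest_upper)).
Qed.

(** The common scheme of [cav_core], [cav_tilt] and [cavB4]: in [Psi w1 w2] the first argument feeds
    the row and the second the cavity measure, so that the row is integrated with the cavity measure
    frozen. *)
Lemma decouple_le (Psi : T -> T -> R) (Th : T -> R) :
  measurable_fun setT (fun z : Trow * Trest => Psi z.1 z.2) ->
  (forall w1 w2, 0 <= Psi w1 w2) -> measurable_fun setT Th ->
  (forall w2, \int[P]_w1 (Psi w1 w2)%:E <= (Th w2)%:E)%E ->
  (\int[P]_w (Psi w w)%:E <= \int[P]_w (Th w)%:E)%E.
Proof.
move=> mPsi Psi0 mTh le.
have mF : measurable_fun setT (fun z : Trow * Trest => (Psi z.1 z.2)%:E) by exact: measurable_fun_EFin.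
have F0 (z : Trow * Trest) : (0 <= (Psi z.1 z.2)%:E)%E by rewrite lee_fin.
rewrite (decouple P _ X _ SK_measurable SK_indep _ row_upper rest_upper row_rest mF F0).
have m1 := measurable_idsub _ X _ SK_measurable row_upper.
have m2 := measurable_idsub _ X _ SK_measurable rest_upper.
have mFT : measurable_fun setT (fun z : T * T => (Psi z.1 z.2)%:E).
  exact: (measurable_compT mF (measurable_pair (measurable_compT m1 measurable_fst) (measurable_compT m2 measurable_snd))).
apply: ge0_le_integral => //.
- by move=> w _; apply: integral_real_ge0.
- exact: (measurable_integral1 P mFT (fun z => F0 z)).
- exact: measurable_fun_EFin.
- by move=> w _; exact: le.
Qed.

End disorder.

(** * Cavity estimates averaged over the disorder *)

Section estimates.
Context {R : realType} {d : measure_display} {T : measurableType d} {N : nat}.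
Variables (P : probability T R) (beta h : R) (g : 'I_N -> 'I_N -> T -> R) (i : 'I_N).
Hypothesis hSK : SK_disorder P g.
Local Notation field := (field g i).
Local Notation cavpi := (cavpi beta h g i).
Local Notation cavB := (cavB beta h g i).
Local Notation Trow := (g_sigma_algebraType (rects (prod 'I_N 'I_N) (fun k w => g k.1 k.2 w) (rowset i))).
Local Notation Trest := (g_sigma_algebraType (rects (prod 'I_N 'I_N) (fun k w => g k.1 k.2 w) (restset i))).

Let N0 : (0 < N)%N. Proof. exact: leq_ltn_trans (ltn_ord i). Qed.
Let NR0 : 0 < N%:R :> R. Proof. by rewrite ltr0n. Qed.
Let Nn0 : N%:R != 0 :> R. Proof. by rewrite gt_eqF. Qed.

Lemma sum_off1 : \sum_(j < N | j != i) 1 = N%:R - 1 :> R.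
Proof.
have : \sum_(j < N) 1 = N%:R :> R by rewrite sumr_const card_ord.
by rewrite (bigD1 i)//= => <-; ring.
Qed.

Lemma dot_replica (s s' : config N) : dot 'I_N (offi i) (replica s) (replica s') =
  N%:R^-1 * \sum_(j < N | j != i) spin (s j) * spin (s' j) :> R.
Proof.
rewrite /dot mulr_sumr; apply: eq_bigr => j _; rewrite /replica.
have -> : N%:R^-1 = (Num.sqrt N%:R)^-1 * (Num.sqrt N%:R)^-1 :> R.
  by rewrite -invfM -expr2 sqr_sqrtr// ltW.
by ring.
Qed.

Lemma dot_replica_diag (s : config N) :
  dot 'I_N (offi i) (replica s) (replica s) = 1 - N%:R^-1 :> R.
Proof.
rewrite dot_replica; under eq_bigr do rewrite spin_sqr.
by rewrite sum_off1 mulrBr mulVf// mulr1.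
Qed.

Lemma dot_replica_abs (s s' : config N) :
  -1 <= (dot 'I_N (offi i) (replica s) (replica s') : R) <= 1.
Proof.
rewrite -ler_norml dot_replica normrM ger0_norm ?invr_ge0 ?(ltW NR0)//.
rewrite mulrC ler_pdivrMr// mul1r.
apply: (le_trans (ler_norm_sum _ _ _)).
under eq_bigr do rewrite normrM !normr_spin mulr1.
by rewrite sum_off1 gerBl.
Qed.

Lemma overlap_replica (s s' : config N) : overlap s s' =
  dot 'I_N (offi i) (replica s) (replica s') + N%:R^-1 * (spin (s i) * spin (s' i)) :> R.
Proof. by rewrite /overlap dot_replica -mulrDr (bigD1 i)//= addrC. Qed.

Definition cavr (w : T) : R := \sum_s cavpi w s * field w s.

Definition cavDelta (q : R) (w : T) : R :=
  Delta 'I_N (offi i) (config N) replica (cavpi w) q.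

Lemma cavDelta_ge0 q w : 0 <= cavDelta q w.
Proof.
apply: sumr_ge0 => s _; apply: sumr_ge0 => s' _; apply: mulr_ge0; last exact: normr_ge0.
by apply: mulr_ge0; exact: cavpi_ge0.
Qed.

Lemma measurable_cavDelta q : measurable_fun setT (cavDelta q).
Proof.
apply: measurable_sum => s; apply: measurable_sum => s'.
apply: measurable_funM; last exact: measurable_cst.
by apply: measurable_funM; exact: (measurable_cavpi P).
Qed.

Lemma mfst_field s : measurable_fun setT (fun z : Trow * Trest => field z.1 s).
Proof. exact: (measurable_compT (measurable_field_row g i s) measurable_fst). Qed.

Lemma msnd_cavpi s : measurable_fun setT (fun z : Trow * Trest => cavpi z.2 s).
Proof. exact: (measurable_compT (measurable_cavpi_rest beta h g i s) measurable_snd). Qed.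

Lemma measurable_cavr2 : measurable_fun setT
  (fun z : Trow * Trest => \sum_s cavpi z.2 s * field z.1 s).
Proof.
by apply: measurable_sum => s; apply: measurable_funM; [exact: msnd_cavpi|exact: mfst_field].
Qed.

Lemma measurable_cavr : measurable_fun setT cavr.
Proof.
apply: measurable_sum => s; apply: measurable_funM.
  exact: (measurable_cavpi P).
exact: (measurable_field P).
Qed.

Lemma lin_bary_cav w1 w2 :
  lin 'I_N (offi i) (gsym g i) (bary 'I_N (config N) replica (cavpi w2)) w1 =
  \sum_s cavpi w2 s * field w1 s.
Proof. exact: lin_bary. Qed.

Lemma cav_core (q a C M : R) (f : R -> R) : 0 <= q -> q < 1 ->
  compare_cst q a C -> 0 <= C ->
  measurable_fun setT f -> (forall y, 0 <= f y <= M * wexp a y) ->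
  (\int[P]_w ((\sum_s cavpi w s * f (field w s) - gsmooth (Num.sqrt (1 - q)) f (cavr w)) ^+ 2)%:E <=
   \int[P]_w (C * M ^+ 2 * (4 * N%:R^-1 + 8 * cavDelta q w))%:E)%E.
Proof.
move=> q0 q1 hC C0 mf fM.
have mG := measurable_gsmooth f M a mf fM (Num.sqrt (1 - q)).
apply: (decouple_le P g i hSK (fun w1 w2 =>
  (\sum_s cavpi w2 s * f (field w1 s) -
   gsmooth (Num.sqrt (1 - q)) f (\sum_s cavpi w2 s * field w1 s)) ^+ 2)).
- apply: measurable_funX; apply: measurable_funB.
    apply: measurable_sum => s; apply: measurable_funM; first exact: msnd_cavpi.
    exact: (measurable_compT mf (mfst_field s)).
  exact: (measurable_compT mG measurable_cavr2).
- by move=> w1 w2; exact: sqr_ge0.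
- apply: measurable_funM; first exact: measurable_cst.
  apply: measurable_funD; first exact: measurable_cst.
  by apply: measurable_funM; [exact: measurable_cst|exact: measurable_cavDelta].
- move=> w2.
  have eta0 : 0 <= N%:R^-1 :> R by rewrite invr_ge0 ltW.
  have le1 s s' : dot 'I_N (offi i) (replica s) (replica s') <= 1 :> R.
    by case/andP: (dot_replica_abs s s').
  have := core_estimate P 'I_N (offi i) (gsym g i) (bigauss_row P g i hSK) (config N)
    replica (cavpi w2) (cavpi_ge0 _ _ _ _ w2) (cavpi_sum _ _ _ _ w2) q _ q0 q1 eta0 dot_replica_diag le1
    a C M f hC C0 mf fM.
  have -> : (\int[P]_w1 ((\sum_s cavpi w2 s * f (field w1 s) -
       gsmooth (Num.sqrt (1 - q)) f (\sum_s cavpi w2 s * field w1 s)) ^+ 2)%:E =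
     \int[P]_w ((\sum_s cavpi w2 s * f (lin 'I_N (offi i) (gsym g i) (replica s) w) -
      gsmooth (Num.sqrt (1 - q)) f (lin 'I_N (offi i) (gsym g i) (bary 'I_N (config N) replica (cavpi w2)) w)) ^+ 2)%:E)%E.
    by apply: eq_integral => w _; rewrite lin_bary_cav.
  by [].
Qed.

Definition cavK (q b : R) (w : T) : R :=
  \sum_s cavpi w s * ((field w s - cavr w - b * (1 - q)) * expR (b * field w s)).

Lemma cav_tilt (q b : R) : 0 <= q -> q < 1 ->
  (\int[P]_w ((cavK q b w) ^+ 2)%:E <=
   \int[P]_w (tilt_cst b * (N%:R^-1 + 4 * cavDelta q w))%:E)%E.
Proof.
move=> q0 q1.
apply: (decouple_le P g i hSK (fun w1 w2 =>
  (\sum_s cavpi w2 s * ((field w1 s - \sum_s cavpi w2 s * field w1 s - b * (1 - q)) * expR (b * field w1 s))) ^+ 2)).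
- apply: measurable_funX; apply: measurable_sum => s.
  apply: measurable_funM; first exact: msnd_cavpi.
  apply: measurable_funM.
    apply: measurable_funB; last exact: measurable_cst.
    by apply: measurable_funB; [exact: mfst_field|exact: measurable_cavr2].
  apply: measurable_fun_expR; apply: measurable_funM; first exact: measurable_cst.
  exact: mfst_field.
- by move=> w1 w2; exact: sqr_ge0.
- apply: measurable_funM; first exact: measurable_cst.
  apply: measurable_funD; first exact: measurable_cst.
  by apply: measurable_funM; [exact: measurable_cst|exact: measurable_cavDelta].
- move=> w2.
  have eta01 : 0 <= (N%:R^-1 : R) <= 1.
    by rewrite invr_ge0 ltW//= invf_le1// ler1n.
  have := tilt_estimate P 'I_N (offi i) (gsym g i) (bigauss_row P g i hSK) (config N)
    replica (cavpi w2) (cavpi_ge0 _ _ _ _ w2) (cavpi_sum _ _ _ _ w2) q _ q0 q1 eta01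
    dot_replica_diag dot_replica_abs b.
  have -> : (\int[P]_w1 ((\sum_s cavpi w2 s * ((field w1 s - \sum_s cavpi w2 s * field w1 s - b * (1 - q)) * expR (b * field w1 s))) ^+ 2)%:E =
    \int[P]_w ((\sum_s cavpi w2 s * ((lin 'I_N (offi i) (gsym g i) (replica s) w -
      lin 'I_N (offi i) (gsym g i) (bary 'I_N (config N) replica (cavpi w2)) w - b * (1 - q)) *
      expR (b * lin 'I_N (offi i) (gsym g i) (replica s) w))) ^+ 2)%:E)%E.
    by apply: eq_integral => w _; rewrite lin_bary_cav.
  by [].
Qed.

(** The expectation of exp(4 spin (beta l + h)) is at most exp(4 |h|) times exp((4 beta)^2 / 2),
    since l has variance at most 1. *)
Definition B4_cst : R := expR (4 * `|h| + 8 * beta ^+ 2).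

Lemma wavg_sqr_le (w : T) (F : config N -> R) :
  (\sum_s cavpi w s * F s) ^+ 2 <= \sum_s cavpi w s * F s ^+ 2.
Proof.
set m := \sum_s cavpi w s * F s.
have : 0 <= \sum_s cavpi w s * (F s - m) ^+ 2.
  by apply: sumr_ge0 => s _; rewrite mulr_ge0 ?cavpi_ge0// sqr_ge0.
have -> : \sum_s cavpi w s * (F s - m) ^+ 2 =
   \sum_s cavpi w s * F s ^+ 2 - 2 * m * m + \sum_s cavpi w s * m ^+ 2.
  rewrite {3}/m mulr_sumr -sumrB -big_split; apply: eq_bigr => s _ /=; ring.
by rewrite (wavg_cst _ _ (cavpi_sum _ _ _ _ w)); lra.
Qed.

Lemma measurable_cavB : measurable_fun setT cavB.
Proof.
apply: measurable_sum => s; apply: measurable_funM; first exact: (measurable_cavpi P).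
by rewrite /chx; mfun; exact: (measurable_field P).
Qed.

(** Jensen, as two successive squarings, moves the fourth power inside the cavity average; the row
    is then integrated configuration by configuration. *)
Lemma cavB4 : (\int[P]_w (cavB w ^+ 4)%:E <= B4_cst%:E)%E.
Proof.
pose Psi w1 w2 := \sum_s cavpi w2 s * expR (4 * (spin (s i) * (beta * field w1 s + h))).
apply: (@le_trans _ _ (\int[P]_w (Psi w w)%:E)%E).
  apply: le_integral_ge0.
  - by apply: measurable_funX; exact: measurable_cavB.
  - by move=> w; rewrite exprn_ge0// (le_trans ler01)// cavB_ge1.
  - apply: measurable_sum => s; apply: measurable_funM; first exact: (measurable_cavpi P).
    by mfun; exact: (measurable_field P).
  - move=> w; rewrite cavBE (_ : 4%N = (2 * 2)%N)// exprM.
    apply: (@le_trans _ _ ((\sum_s cavpi w s * expR (cavE beta h g i w s) ^+ 2) ^+ 2)).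
      apply: lerXn2r; rewrite ?nnegrE; [exact: sqr_ge0| |exact: wavg_sqr_le].
      by apply: sumr_ge0 => s _; apply: mulr_ge0; [exact: cavpi_ge0|exact: sqr_ge0].
    apply: (le_trans (wavg_sqr_le _ _)).
    apply: ler_sum => s _; rewrite ler_wpM2l ?cavpi_ge0//.
    by rewrite -exprM -expRM_natr /cavE mulrC.
apply: (@le_trans _ _ (\int[P]_w B4_cst%:E)%E).
  apply: (decouple_le P g i hSK Psi).
  - apply: measurable_sum => s; apply: measurable_funM; first exact: msnd_cavpi.
    by mfun; exact: mfst_field.
  - by move=> w1 w2; apply: sumr_ge0 => s _; rewrite mulr_ge0 ?cavpi_ge0 ?expR_ge0.
  - exact: measurable_cst.
  - move=> w2; have mf (s : config N) : measurable_fun setT (fun w1 : T => expR (4 * (spin (s i) * (beta * field w1 s + h)))).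
      by mfun; exact: (measurable_field P).
    rewrite integral_sum_ge0; last 2 first.
    + by move=> s; apply: measurable_funM; [exact: measurable_cst|exact: mf].
    + by move=> s w; rewrite mulr_ge0 ?cavpi_ge0 ?expR_ge0.
    rewrite -[leRHS]/(B4_cst%:E) -(wavg_cst _ _ (cavpi_sum beta h g i w2) B4_cst) -sumEFin.
    apply: lee_sum => s _.
    rewrite integralZ_ge0; [|exact: mf|by move=> w; exact: expR_ge0|exact: cavpi_ge0].
    rewrite [leRHS]EFinM lee_wpmul2l ?lee_fin ?cavpi_ge0//.
    have -> : (\int[P]_w1 (expR (4 * (spin (s i) * (beta * field w1 s + h))))%:E =
       \int[P]_w1 (expR (4 * spin (s i) * h) * expR (4 * spin (s i) * beta * field w1 s))%:E)%E.
      by apply: eq_integral => w _; rewrite -expRD; congr (expR _)%:E; ring.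
    rewrite integralZ_ge0; last 3 first.
    + by mfun; exact: (measurable_field P).
    + by move=> w; exact: expR_ge0.
    + exact: expR_ge0.
    rewrite (bigauss_expRl _ _ _ _ _ _ (4 * spin (s i) * beta) (bigauss_row P g i hSK (replica s) (replica s))).
    rewrite dot_replica_diag -EFinM lee_fin -expRD ler_expR.
    have s2 : spin (s i) ^+ 2 = 1 :> R by rewrite expr2 spin_sqr.
    have -> : (4 * spin (s i) * beta) ^+ 2 * (1 - N%:R^-1) / 2 = 8 * beta ^+ 2 * (1 - N%:R^-1).
      by transitivity (8 * (spin (s i) ^+ 2) * beta ^+ 2 * (1 - N%:R^-1)); [field|rewrite s2; ring].
    apply: lerD.
      rewrite -mulrA ler_wpM2l//; apply: (le_trans (ler_norm _)).
      by rewrite normrM normr_spin mul1r.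
    have b80 : 0 <= 8 * beta ^+ 2 by apply: mulr_ge0 => //; exact: sqr_ge0.
    have n1 : 1 - N%:R^-1 <= 1 :> R by rewrite gerBl invr_ge0 ltW.
    by rewrite ler_piMr.
by rewrite integral_cst// [X in (_ * X)%E]probability_setT mule1.
Qed.

End estimates.

(** * From Gibbs overlaps to cavity overlaps *)

Section overlap_moment.
Context {R : realType} {d : measure_display} {T : measurableType d} {N : nat}.
Variables (P : probability T R) (beta h : R) (g : 'I_N -> 'I_N -> T -> R) (i : 'I_N).
Hypothesis hSK : SK_disorder P g.
Local Notation field := (field g i).
Local Notation cavpi := (cavpi beta h g i).
Local Notation cavB := (cavB beta h g i).
Local Notation cavE := (cavE beta h g i).
Local Notation Gibbs := (Gibbs beta h g).

Let NR0 : 0 < N%:R :> R. Proof. by rewrite ltr0n (leq_ltn_trans _ (ltn_ord i)). Qed.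

Lemma cavB_gt0 w : 0 < cavB w.
Proof. exact: lt_le_trans ltr01 (cavB_ge1 _ _ _ _ w). Qed.

Lemma cavpi_Gibbs w s : cavpi w s = Gibbs w s * (cavB w * expR (- cavE w s)).
Proof.
by rewrite mulrA Gibbs_cav -mulrA -expRD subrr expR0 mulr1.
Qed.

(** Gibbs weights are cavity weights times exp(cavE) / cavB. One factor exp(- cavE) cancels the
    exponential, and by the flip symmetry the cavity average of the other is [cavB]. The second
    moment of the change of weights is thus exact, without any new exponential moment. *)
Lemma Gibbs_tilt w : \sum_s Gibbs w s * expR (- cavE w s) ^+ 2 = 1.
Proof.
have B0 : cavB w != 0 by rewrite gt_eqF// cavB_gt0.
apply: (mulfI B0); rewrite mulr1 {2}cavBEN mulr_sumr; apply: eq_bigr => s _.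
rewrite mulrA (mulrC (cavB w)) Gibbs_cav -mulrA; congr (_ * _).
by rewrite expr2 mulrA -expRD subrr expR0 mul1r.
Qed.

Lemma measurable_Gibbs s : measurable_fun setT (fun w => Gibbs w s).
Proof.
have -> : (fun w => Gibbs w s) = (fun w => cavpi w s * expR (cavE w s) * (cavB w)^-1).
  by apply/funext => w; rewrite -Gibbs_cav mulfK// gt_eqF// cavB_gt0.
apply: measurable_funM; last first.
  by apply: measurable_invr_gt0; [exact: (measurable_cavB P)|exact: cavB_gt0].
apply: measurable_funM; first exact: (measurable_cavpi P).
by rewrite /cavE; mfun; exact: (measurable_field P).
Qed.

Definition overlap4 (q : R) (w : T) : R :=
  gavg2 beta h g (fun s1 s2 => (overlap s1 s2 - q) ^+ 4) w.

Lemma overlap4_ge0 q w : 0 <= overlap4 q w.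
Proof.
apply: sumr_ge0 => s _; apply: sumr_ge0 => s' _.
apply: mulr_ge0; last exact: Gibbs_ge0.
by apply: mulr_ge0; [exact: exprn_even_ge0|exact: Gibbs_ge0].
Qed.

Lemma measurable_overlap4 q : measurable_fun setT (overlap4 q).
Proof.
apply: measurable_sum => s; apply: measurable_sum => s'.
apply: measurable_funM; last exact: measurable_Gibbs.
by apply: measurable_funM; [exact: measurable_cst|exact: measurable_Gibbs].
Qed.

Lemma gibbs_weighted (w : T) (c : R) (F : config N -> R) :
  \sum_s \sum_s' Gibbs w s * Gibbs w s' * (c * F s * F s') = c * (\sum_s Gibbs w s * F s) ^+ 2.
Proof.
rewrite expr2 mulr_suml mulr_sumr; apply: eq_bigr => s _.
by rewrite mulr_sumr mulr_sumr; apply: eq_bigr => s' _; ring.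
Qed.

(** The summand 1 / N is the price of dropping site i from the overlap. In the proof [b] is the
    density of two cavity replicas with respect to two Gibbs replicas; by [Gibbs_tilt] its second
    moment is the fourth power of [cavB]. *)
Lemma cavDelta_le (q : R) (w : T) :
  cavDelta beta h g i q w <= N%:R^-1 + Num.sqrt N%:R * N%:R / 4 * overlap4 q w +
    (4 * Num.sqrt N%:R)^-1 + (2 * Num.sqrt N%:R)^-1 * cavB w ^+ 4.
Proof.
set r := Num.sqrt N%:R; have r0 : 0 < r by rewrite sqrtr_gt0.
have r2 : r ^+ 2 = N%:R by rewrite sqr_sqrtr// ltW.
pose b s s' := cavB w ^+ 2 * expR (- cavE w s) * expR (- cavE w s').
(* Young twice at the scale r = sqrt N: c |y| against c^2 and y^2, then y^2 against y^4 and 1. The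
   weights make every term of order 1 / r when y^4 has mean of order N^(-2). *)
have young (y c : R) : c * `|y| <= r * N%:R / 4 * y ^+ 4 + (4 * r)^-1 + (2 * r)^-1 * c ^+ 2.
  have h1 : 0 <= (c - r * `|y|) ^+ 2 / (2 * r) by rewrite divr_ge0 ?sqr_ge0// mulr_ge0// ltW.
  have h2 : 0 <= (N%:R * y ^+ 2 - 1) ^+ 2 * (4 * r)^-1.
    by rewrite mulr_ge0 ?sqr_ge0// invr_ge0 mulr_ge0// ltW.
  have y2 : `|y| ^+ 2 = y ^+ 2 by rewrite real_normK ?num_real.
  have e1 : (c - r * `|y|) ^+ 2 / (2 * r) = (2 * r)^-1 * c ^+ 2 + r / 2 * y ^+ 2 - c * `|y|.
    by rewrite -y2; field; rewrite gt_eqF.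
  have e2 : (N%:R * y ^+ 2 - 1) ^+ 2 * (4 * r)^-1 = r * N%:R / 4 * y ^+ 4 - r / 2 * y ^+ 2 + (4 * r)^-1.
    by rewrite -r2; field; rewrite gt_eqF.
  lra.
have term s s' : cavpi w s * cavpi w s' * odev 'I_N (offi i) (config N) replica q s s' <=
    cavpi w s * cavpi w s' * N%:R^-1 + (Gibbs w s * Gibbs w s') *
     (r * N%:R / 4 * (overlap s s' - q) ^+ 4 + (4 * r)^-1 + (2 * r)^-1 * b s s' ^+ 2).
  have p0 : 0 <= cavpi w s * cavpi w s' by rewrite mulr_ge0 ?cavpi_ge0.
  have G0 : 0 <= Gibbs w s * Gibbs w s' by rewrite mulr_ge0 ?Gibbs_ge0.
  have dev : odev 'I_N (offi i) (config N) replica q s s' <= N%:R^-1 + `|overlap s s' - q|.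
    rewrite /odev (overlap_replica i).
    set D := dot _ _ _ _; set t := N%:R^-1 * _.
    have -> : D - q = - t + (D + t - q) by ring.
    apply: (le_trans (ler_normD _ _)); rewrite lerD2r normrN /t normrM.
    rewrite normrM !normr_spin !mulr1 ger0_norm// invr_ge0 ltW//.
  apply: (le_trans (ler_wpM2l p0 dev)); rewrite mulrDr lerD2l.
  have -> : cavpi w s * cavpi w s' = Gibbs w s * Gibbs w s' * b s s'.
    by rewrite !cavpi_Gibbs /b; ring.
  rewrite -(mulrA (Gibbs w s * Gibbs w s')) ler_wpM2l//; exact: young.
apply: (le_trans (ler_sum _ (fun s _ => ler_sum _ (fun s' _ => term s s')))).
have split3 : \sum_s \sum_s' (cavpi w s * cavpi w s' * N%:R^-1 + (Gibbs w s * Gibbs w s') *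
     (r * N%:R / 4 * (overlap s s' - q) ^+ 4 + (4 * r)^-1 + (2 * r)^-1 * b s s' ^+ 2)) =
  (\sum_s cavpi w s * \sum_s' cavpi w s' * N%:R^-1) + r * N%:R / 4 * overlap4 q w +
  (4 * r)^-1 * (\sum_s Gibbs w s * 1) ^+ 2 +
  (2 * r)^-1 * cavB w ^+ 4 * (\sum_s Gibbs w s * expR (- cavE w s) ^+ 2) ^+ 2.
  rewrite -(gibbs_weighted w _ (fun=> 1)) -(gibbs_weighted w _ (fun s => expR (- cavE w s) ^+ 2)) /overlap4 /gavg2 mulr_sumr -!big_split; apply: eq_bigr => s _ /=.
  rewrite !mulr_sumr -!big_split; apply: eq_bigr => s' _ /=.
  by rewrite /b; ring.
rewrite split3 Gibbs_tilt; under [X in _ * X ^+ 2]eq_bigr do rewrite mulr1.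
rewrite Gibbs_sum expr1n !mulr1.
by rewrite !(wavg_cst _ _ (cavpi_sum _ _ _ _ w)).
Qed.

(** 5 / 4 is 1 for the lost site, as 1 / N <= 1 / sqrt N, plus 1 / 4 from the constant term of
    Young's inequality. *)
Definition Delta_cst (C0 : R) : R := 5 / 4 + `|C0| / 4 + B4_cst beta h / 2.

Lemma integral_cavDelta (q C0 : R) :
  (\int[P]_w (overlap4 q w)%:E <= (C0 / (N%:R ^+ 2))%:E)%E ->
  (\int[P]_w (cavDelta beta h g i q w)%:E <= (Delta_cst C0 / Num.sqrt N%:R)%:E)%E.
Proof.
move=> H.
set r := Num.sqrt N%:R; have r0 : 0 < r by rewrite sqrtr_gt0.
have r2 : r ^+ 2 = N%:R by rewrite sqr_sqrtr// ltW.
have r1 : 1 <= r by rewrite -sqrtr1 ler_wsqrtr// ler1n -(ltr0n R).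
have mB4 : measurable_fun setT (fun w => cavB w ^+ 4).
  by apply: measurable_funX; exact: (measurable_cavB P).
have B40 w : 0 <= cavB w ^+ 4 by exact: exprn_even_ge0.
have c1 : 0 <= r * N%:R / 4 by rewrite divr_ge0// mulr_ge0 ?ltW.
have c2 : 0 <= (2 * r)^-1 by rewrite invr_ge0 mulr_ge0// ltW.
have c3 : 0 <= N%:R^-1 + (4 * r)^-1 :> R.
  by rewrite addr_ge0// invr_ge0 ?mulr_ge0 ?ltW.
have mO : measurable_fun setT (fun w => r * N%:R / 4 * overlap4 q w).
  by apply: measurable_funM; [exact: measurable_cst|exact: measurable_overlap4].
have O0 w : 0 <= r * N%:R / 4 * overlap4 q w by rewrite mulr_ge0// overlap4_ge0.
have mB : measurable_fun setT (fun w => (2 * r)^-1 * cavB w ^+ 4).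
  by apply: measurable_funM; [exact: measurable_cst|].
have B0 w : 0 <= (2 * r)^-1 * cavB w ^+ 4 by exact: mulr_ge0.
apply: (@le_trans _ _ (\int[P]_w ((N%:R^-1 + (4 * r)^-1) + (r * N%:R / 4 * overlap4 q w + (2 * r)^-1 * cavB w ^+ 4))%:E)%E).
  apply: le_integral_ge0.
  - exact: (measurable_cavDelta P).
  - by move=> w; exact: cavDelta_ge0.
  - apply: measurable_funD; first exact: measurable_cst.
    exact: measurable_funD.
  - by move=> w; apply: (le_trans (cavDelta_le q w)); rewrite -/r; lra.
rewrite integralD_ge0; last 4 first.
- exact: measurable_cst.
- by move=> w; exact: c3.
- exact: measurable_funD.
- by move=> w; exact: addr_ge0.
rewrite (integralD_ge0 P mO O0 mB B0).
rewrite (integralZ_ge0 P _ (measurable_overlap4 q) (overlap4_ge0 q) c1).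
rewrite (integralZ_ge0 P _ mB4 B40 c2).
have -> : (\int[P]_w (N%:R^-1 + (4 * r)^-1)%:E = (N%:R^-1 + (4 * r)^-1)%:E)%E.
  by rewrite integral_cst// [X in (_ * X)%E]probability_setT mule1.
apply: (@le_trans _ _ ((N%:R^-1 + (4 * r)^-1)%:E + ((r * N%:R / 4)%:E * (C0 / (N%:R ^+ 2))%:E + ((2 * r)^-1)%:E * (B4_cst beta h)%:E))%E).
  rewrite leeD2l// leeD//.
    by rewrite lee_wpmul2l ?lee_fin.
  by rewrite lee_wpmul2l ?lee_fin//; exact: (cavB4 P).
rewrite -!EFinM -!EFinD lee_fin /Delta_cst.
have h1 : N%:R^-1 <= r^-1.
  by rewrite lef_pV2 ?posrE// -r2 expr2 ler_peMr// ltW.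
have h2 : r * N%:R / 4 * (C0 / N%:R ^+ 2) <= `|C0| / 4 * r^-1.
  have -> : r * N%:R / 4 * (C0 / N%:R ^+ 2) = C0 / 4 * r^-1.
    by rewrite -r2; field; rewrite gt_eqF.
  by rewrite ler_wpM2r ?invr_ge0 ?(ltW r0)// ler_wpM2r// ler_norm.
have -> : (4 * r)^-1 = 4^-1 * r^-1 by rewrite invfM.
have -> : (2 * r)^-1 = 2^-1 * r^-1 by rewrite invfM.
lra.
Qed.

End overlap_moment.

(** * The limiting mixture *)

Section mixture.
Context {R : realType}.
Variables (beta h q : R).
Hypothesis q1 : q < 1.
Local Notation mu := (@lebesgue_measure R).
Local Notation gam := (normal_prob (0 : R) 1).
Local Notation v := (1 - q).
Local Notation sv := (Num.sqrt (1 - q)).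
Local Notation chx := (chx beta h).

Let v0 : 0 < v. Proof. by rewrite subr_gt0. Qed.
Let sv0 : 0 < sv. Proof. by rewrite sqrtr_gt0. Qed.
Let sv2 : sv ^+ 2 = v. Proof. by rewrite sqr_sqrtr// ltW. Qed.

Definition mixw (r : R) : R :=
  expR (beta * r + h) / (expR (beta * r + h) + expR (- (beta * r) - h)).

(** The integral against nu_i as a deterministic function of its centre, see [integral_mixture];
    this allows it to be evaluated at [cavr] as well as at [r_field]. *)
Definition mixint (u : R -> R) (r : R) : R :=
  mixw r * gsmooth sv u (r + beta * v) + (1 - mixw r) * gsmooth sv u (r - beta * v).

Lemma mixw01 r : 0 <= mixw r <= 1.
Proof.
have D0 : 0 < expR (beta * r + h) + expR (- (beta * r) - h) by rewrite addr_gt0 ?expR_gt0.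
rewrite /mixw divr_ge0 ?expR_ge0 ?(ltW D0)//= ler_pdivrMr// mul1r lerDl.
exact: expR_ge0.
Qed.

Lemma measurable_mixw : measurable_fun setT mixw.
Proof.
rewrite /mixw; apply: measurable_funM; first by mfun.
by apply: measurable_invr_gt0; [mfun|move=> r; rewrite addr_gt0 ?expR_gt0].
Qed.

Lemma mixw_lip (x y : R) : `|mixw x - mixw y| <= 2 * `|beta| * `|x - y|.
Proof.
have h1 (a b : R) : mixw a - mixw b <= 2 * `|beta| * `|a - b|.
  have -> : 2 * `|beta| * `|a - b| = 2 * `|beta * (a - b)| by rewrite normrM mulrA.
  rewrite /mixw; set A := beta * a + h; set B := beta * b + h.
  have -> : - (beta * a) - h = - A by rewrite /A; ring.
  have -> : - (beta * b) - h = - B by rewrite /B; ring.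
  have -> : beta * (a - b) = A - B by rewrite /A /B; ring.
  have p1 := expR_gt0 A; have p2 := expR_gt0 B; have p3 := expR_gt0 (- A); have p4 := expR_gt0 (- B).
  have D0 : 0 < (expR A + expR (- A)) * (expR B + expR (- B)) by rewrite mulr_gt0// addr_gt0.
  have -> : expR A / (expR A + expR (- A)) - expR B / (expR B + expR (- B)) =
      (expR A * expR (- B) - expR (- A) * expR B) / ((expR A + expR (- A)) * (expR B + expR (- B))).
    by field; rewrite !gt_eqF// addr_gt0.
  rewrite ler_pdivrMr//.
  have e1 : expR A * expR (- B) - expR (- A) * expR B = expR A * expR (- B) * (1 - expR (- (2 * (A - B)))).
    rewrite mulrBr mulr1 -!expRD; congr (_ - expR _); ring.
  have e2 : 1 - expR (- (2 * (A - B))) <= 2 * `|A - B|.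
    have := expR_ge1Dx (- (2 * (A - B))); have := ler_norm (A - B); lra.
  rewrite e1; apply: (@le_trans _ _ (expR A * expR (- B) * (2 * `|A - B|))).
    by rewrite ler_wpM2l// mulr_ge0// ltW.
  rewrite mulrC ler_wpM2l ?mulr_ge0//.
  have := mulr_gt0 p1 p2; have := mulr_gt0 p3 p2; have := mulr_gt0 p3 p4.
  by nra.
by rewrite ler_norml lerNl opprB h1 andbT distrC h1.
Qed.

Section bounded.
Variables (u : R -> R) (U : R).
Hypothesis mu_ : measurable_fun setT u.
Hypothesis u0U : forall x, 0 <= u x <= U.

Let U0 : 0 <= U. Proof. by case/andP: (u0U 0) => h1 h2; exact: (le_trans h1 h2). Qed.

(** [wexp 0] is the constant 2, so bounded functions belong to the growth class with a = 0. *)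
Lemma bounded_wexp x : 0 <= u x <= U * wexp 0 x.
Proof.
case/andP: (u0U x) => -> uU /=; apply: (le_trans uU).
by rewrite ler_peMr// (le_trans _ (wexp_ge2 0 x))// ler1n.
Qed.

Lemma gsmooth_bounded m : (\int[gam]_z (u (m + sv * z))%:E = (gsmooth sv u m)%:E)%E.
Proof. exact: (gsmooth_fin u U 0 mu_ bounded_wexp). Qed.

Lemma gsmooth_le m : 0 <= gsmooth sv u m <= U.
Proof.
rewrite (gsmooth_ge0 u U 0 mu_ bounded_wexp)/= -lee_fin -gsmooth_bounded.
rewrite -[leRHS](integral_normal_cst 0 1); last by rewrite lee_fin.
apply: le_integral_ge0.
- by apply: (measurable_compT mu_); mfun.
- by move=> z; case/andP: (u0U (m + sv * z)).
- exact: measurable_cst.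
- by move=> z; case/andP: (u0U (m + sv * z)).
Qed.

(** As u has no regularity, the shift is moved to the Gaussian by the Cameron-Martin formula. Then 1
    - exp(a z - a^2 / 2) is at most a^2 / 2 - a z, and |z| <= z^2 + 1 reduces the error to the
    second moment. *)
Lemma gsmooth_shift m (e : R) :
  gsmooth sv u m <= gsmooth sv u (m + e) +
    U * (`|e / sv| * (gauss_m2 + 1) + (e / sv) ^+ 2 / 2).
Proof.
set a := e / sv.
pose F z := u (m + sv * z).
have mF : measurable_fun setT F by apply: (measurable_compT mu_); mfun.
have mF' : measurable_fun setT (fun z => (F z)%:E) by exact: measurable_fun_EFin.
have F0 z : 0 <= F z by case/andP: (u0U (m + sv * z)).
have FU z : F z <= U by case/andP: (u0U (m + sv * z)).
have tilt := gauss_tilt a (fun z => (F z)%:E) mF' (fun z => F0 z).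
have shift : (\int[gam]_z (F (a + z))%:E = (gsmooth sv u (m + e))%:E)%E.
  rewrite -gsmooth_bounded; apply: eq_integral => z _; congr (u _)%:E.
  by rewrite /a; field; rewrite gt_eqF.
have mFe : measurable_fun setT (fun z => F z * expR (a * z)) by apply: measurable_funM => //; mfun.
have Fe0 z : 0 <= F z * expR (a * z) by rewrite mulr_ge0// expR_ge0.
have E1 : (\int[gam]_z (expR (- (a ^+ 2 / 2)) * (F z * expR (a * z)))%:E = (gsmooth sv u (m + e))%:E)%E.
  rewrite (integralZ_ge0 gam _ mFe Fe0 (expR_ge0 _)).
  have -> : (\int[gam]_z (F z * expR (a * z))%:E = (expR (a ^+ 2 / 2))%:E * (gsmooth sv u (m + e))%:E)%E.
    by rewrite -shift -tilt; apply: eq_integral => z _; rewrite EFinM.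
  by rewrite -!EFinM mulrA -expRD addNr expR0 mul1r.
have a0 := normr_ge0 a; have a2 := sqr_ge0 a.
have m2 := gauss_m2_ge0 (R := R).
pose H z : R := U * (`|a| * 1) * z ^+ 2 + U * (`|a| + a ^+ 2 / 2).
have UA : 0 <= U * (`|a| * 1) by rewrite !mulr_ge0.
have UB : 0 <= U * (`|a| + a ^+ 2 / 2) by rewrite mulr_ge0// addr_ge0// divr_ge0.
have EH : (\int[gam]_z (H z)%:E = (U * (`|a| * (gauss_m2 + 1) + a ^+ 2 / 2))%:E)%E.
  rewrite /H integralD_ge0; last 4 first.
  - by mfun.
  - by move=> z; rewrite mulr_ge0// sqr_ge0.
  - exact: measurable_cst.
  - by move=> z.
  rewrite integralZ_ge0; [|mfun|by move=> z; exact: sqr_ge0|by []].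
  rewrite gauss_m2E integral_normal_cst ?lee_fin// -EFinM -EFinD; congr EFin; ring.
rewrite -lee_fin EFinD -gsmooth_bounded -E1 -EH -integralD_ge0.
- apply: le_integral_ge0.
  + exact: mF.
  + exact: F0.
  + apply: measurable_funD; last by rewrite /H; mfun.
    by apply: measurable_funM; [exact: measurable_cst|].
  + move=> z; rewrite -/(F z).
    have -> : expR (- (a ^+ 2 / 2)) * (F z * expR (a * z)) = F z * expR (a * z - a ^+ 2 / 2).
      by rewrite mulrCA -expRD; congr (_ * expR _); ring.
    have e1 := expR_ge1Dx (a * z - a ^+ 2 / 2).
    have e2 : - (a * z) <= `|a| * (z ^+ 2 + 1).
      apply: (le_trans (ler_norm _)); rewrite normrN normrM ler_wpM2l//.
      by have := sqr_ge0 (`|z| - 1); rewrite sqrrB real_normK ?num_real// mulr1; have := sqr_ge0 z; have := normr_ge0 z; nra.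
    have e3 : F z * (1 - expR (a * z - a ^+ 2 / 2)) <= F z * (`|a| * (z ^+ 2 + 1) + a ^+ 2 / 2).
      by rewrite ler_wpM2l//; lra.
    have e4 : F z * (`|a| * (z ^+ 2 + 1) + a ^+ 2 / 2) <= U * (`|a| * (z ^+ 2 + 1) + a ^+ 2 / 2).
      by rewrite ler_wpM2r// addr_ge0 ?divr_ge0// mulr_ge0// addr_ge0 ?sqr_ge0.
    have -> : H z = U * (`|a| * (z ^+ 2 + 1) + a ^+ 2 / 2) by rewrite /H; ring.
    move: e3; rewrite mulrBr mulr1; lra.
- by apply: measurable_funM; [exact: measurable_cst|].
- by move=> z; rewrite mulr_ge0// expR_ge0.
- by rewrite /H; mfun.
- by move=> z; rewrite /H addr_ge0// mulr_ge0// sqr_ge0.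
Qed.

(** The first two summands serve shifts shorter than 1, whose square is at most their length; the
    last serves longer shifts, where the oscillation [U] is enough. *)
Definition shift_cst : R := (gauss_m2 + 1) / sv + (2 * v)^-1 + 1.

Lemma gsmooth_lip (m m' : R) :
  `|gsmooth sv u m - gsmooth sv u m'| <= shift_cst * U * `|m - m'|.
Proof.
have h1 (a b : R) : gsmooth sv u a - gsmooth sv u b <= shift_cst * U * `|a - b|.
  have /andP[ga gaU] := gsmooth_le a; have /andP[gb gbU] := gsmooth_le b.
  have n0 := normr_ge0 (a - b).
  have m2 := gauss_m2_ge0 (R := R).
  have c1 : 0 <= (gauss_m2 + 1) / sv by rewrite divr_ge0 ?(ltW sv0)// addr_ge0.
  have c2 : 0 <= (2 * v)^-1 by rewrite invr_ge0 mulr_ge0// ltW.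
  have Un : 0 <= U * `|a - b| by exact: mulr_ge0.
  have c1n := mulr_ge0 c1 Un; have c2n := mulr_ge0 c2 Un.
  have -> : shift_cst * U * `|a - b| =
    (gauss_m2 + 1) / sv * (U * `|a - b|) + (2 * v)^-1 * (U * `|a - b|) + U * `|a - b|.
    by rewrite /shift_cst; ring.
  have [big|small] := leP 1 `|a - b|.
    have : U <= U * `|a - b| by rewrite ler_peMr.
    lra.
  have := gsmooth_shift a (b - a); rewrite subrKC.
  have -> : U * (`|(b - a) / sv| * (gauss_m2 + 1) + ((b - a) / sv) ^+ 2 / 2) =
     (gauss_m2 + 1) / sv * (U * `|a - b|) + (2 * v)^-1 * (U * (`|a - b| * `|a - b|)).
    have -> : `|(b - a) / sv| = `|a - b| / sv.
      by rewrite normrM normfV (gtr0_norm sv0) (distrC b a).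
    have -> : ((b - a) / sv) ^+ 2 = (`|a - b| * `|a - b|) / v.
      by rewrite -expr2 real_normK ?num_real// expr_div_n sv2 -sqrrN opprB.
    have sn0 : sv != 0 by rewrite gt_eqF.
    have vn0 : v != 0 by rewrite gt_eqF.
    by field; rewrite sn0 vn0.
  have : (2 * v)^-1 * (U * (`|a - b| * `|a - b|)) <= (2 * v)^-1 * (U * `|a - b|).
    by rewrite ler_wpM2l// ler_wpM2l// ler_piMr// ltW.
  lra.
by rewrite ler_norml lerNl opprB h1 andbT distrC h1.
Qed.

Lemma mixint_le r : 0 <= mixint u r <= U.
Proof.
have /andP[p0 p1] := mixw01 r.
have /andP[a0 aU] := gsmooth_le (r + beta * v); have /andP[b0 bU] := gsmooth_le (r - beta * v).
have p1' : 0 <= 1 - mixw r by rewrite subr_ge0.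
rewrite /mixint addr_ge0 ?mulr_ge0//=.
have := ler_wpM2l p0 aU; have := ler_wpM2l p1' bU; lra.
Qed.

Definition mix_cst : R := shift_cst + 2 * `|beta|.

Lemma mixint_lip (r r' : R) :
  `|mixint u r - mixint u r'| <= mix_cst * U * `|r - r'|.
Proof.
have /andP[p0 p1] := mixw01 r.
have p1' : 0 <= 1 - mixw r by rewrite subr_ge0.
set a := gsmooth sv u (r + beta * v); set b := gsmooth sv u (r - beta * v).
set a' := gsmooth sv u (r' + beta * v); set b' := gsmooth sv u (r' - beta * v).
have ha : `|a - a'| <= shift_cst * U * `|r - r'|.
  have := gsmooth_lip (r + beta * v) (r' + beta * v).
  by have -> : r + beta * v - (r' + beta * v) = r - r' by ring.
have hb : `|b - b'| <= shift_cst * U * `|r - r'|.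
  have := gsmooth_lip (r - beta * v) (r' - beta * v).
  by have -> : r - beta * v - (r' - beta * v) = r - r' by ring.
have hab : `|a' - b'| <= U.
  have /andP[? ?] := gsmooth_le (r' + beta * v); have /andP[? ?] := gsmooth_le (r' - beta * v).
  rewrite ler_norml /a' /b'; lra.
have -> : mixint u r - mixint u r' =
   mixw r * (a - a') + (1 - mixw r) * (b - b') + (mixw r - mixw r') * (a' - b').
  by rewrite /mixint -/a -/b -/a' -/b'; ring.
apply: (le_trans (ler_normD _ _)).
have h1 : `|(mixw r - mixw r') * (a' - b')| <= 2 * `|beta| * `|r - r'| * U.
  by rewrite normrM; apply: ler_pM => //; exact: mixw_lip.
have h2 : `|mixw r * (a - a') + (1 - mixw r) * (b - b')| <= shift_cst * U * `|r - r'|.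
  apply: (le_trans (ler_normD _ _)); rewrite (normrM (mixw r)) (normrM (1 - mixw r)) (ger0_norm p0) (ger0_norm p1').
  have := ler_wpM2l p0 ha; have := ler_wpM2l p1' hb; lra.
rewrite /mix_cst; lra.
Qed.

Lemma measurable_mixint : measurable_fun setT (mixint u).
Proof.
have mg := measurable_gsmooth u U 0 mu_ bounded_wexp sv.
rewrite /mixint; apply: measurable_funD; apply: measurable_funM.
- exact: measurable_mixw.
- by apply: (measurable_compT mg); mfun.
- by apply: measurable_funB; [exact: measurable_cst|exact: measurable_mixw].
- by apply: (measurable_compT mg); mfun.
Qed.

Lemma integral_mixture r :
  (\int[mu]_x (u x * (mixw r * normal_pdf (r + beta * v) sv x +
     (1 - mixw r) * normal_pdf (r - beta * v) sv x))%:E = (mixint u r)%:E)%E.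
Proof.
have /andP[p0 p1] := mixw01 r.
have p1' : 0 <= 1 - mixw r by rewrite subr_ge0.
have u0 x : 0 <= u x by case/andP: (u0U x).
have mup m : measurable_fun [set: R] (fun x => u x * normal_pdf m sv x).
  by apply: measurable_funM => //; exact: measurable_normal_pdf.
have up0 m x : 0 <= u x * normal_pdf m sv x by rewrite mulr_ge0// normal_pdf_ge0.
have iu m : (\int[mu]_x (u x * normal_pdf m sv x)%:E = (gsmooth sv u m)%:E)%E.
  have mue : measurable_fun [set: R] (fun x => (u x)%:E) by exact: measurable_fun_EFin.
  have ue0 x : (0 <= (u x)%:E)%E by rewrite lee_fin.
  rewrite -gsmooth_bounded (ge0_integral_std_normal m sv0 mue ue0) (ge0_integral_normal_prob m sv mue ue0).
  by apply: eq_integral => x _; rewrite EFinM.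
have -> : (\int[mu]_x (u x * (mixw r * normal_pdf (r + beta * v) sv x +
     (1 - mixw r) * normal_pdf (r - beta * v) sv x))%:E =
  \int[mu]_x (mixw r * (u x * normal_pdf (r + beta * v) sv x) +
     (1 - mixw r) * (u x * normal_pdf (r - beta * v) sv x))%:E)%E.
  by apply: eq_integral => x _; congr EFin; ring.
rewrite integralD_ge0; last 4 first.
- by apply: measurable_funM; [exact: measurable_cst|exact: mup].
- by move=> x; rewrite mulr_ge0.
- by apply: measurable_funM; [exact: measurable_cst|exact: mup].
- by move=> x; rewrite mulr_ge0.
rewrite (integralZ_ge0 mu _ (mup _) (up0 _) p0) (integralZ_ge0 mu _ (mup _) (up0 _) p1').
by rewrite !iu -!EFinM -EFinD.
Qed.

(** Each exponential in cosh tilts z and moves the mean by beta (1 - q) up or down, with weight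
    proportional to exp(beta r + h) or its inverse: this produces the two peaks and [mixw]. The
    prefactor does not depend on u, so it is also the approximation of [cavB] and cancels in the
    quotient. *)
Lemma gsmooth_chx r : gsmooth sv (fun y => u y * chx y) r =
  expR (beta ^+ 2 * v / 2) * chx r * mixint u r.
Proof.
pose F z := u (r + sv * z).
have mF : measurable_fun setT F by apply: (measurable_compT mu_); mfun.
have mF' : measurable_fun setT (fun z => (F z)%:E) by exact: measurable_fun_EFin.
have F0 z : 0 <= F z by case/andP: (u0U (r + sv * z)).
have side (b : R) : (\int[gam]_z (F z * expR (b * sv * z))%:E =
    (expR (b ^+ 2 * v / 2) * gsmooth sv u (r + b * v))%:E)%E.
  have := gauss_tilt (b * sv) (fun z => (F z)%:E) mF' (fun z => F0 z).
  have -> : (\int[gam]_z ((F z)%:E * (expR (b * sv * z))%:E) = \int[gam]_z (F z * expR (b * sv * z))%:E)%E.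
    by apply: eq_integral => z _; rewrite EFinM.
  move=> ->; rewrite EFinM exprMn sv2; congr (_ * _)%E.
  rewrite -gsmooth_bounded; apply: eq_integral => z _; congr (u _)%:E.
  by transitivity (r + b * sv ^+ 2 + sv * z); [ring|rewrite sv2].
have me b : measurable_fun setT (fun z => F z * expR (b * sv * z)) by apply: measurable_funM => //; mfun.
have e0 b z : 0 <= F z * expR (b * sv * z) by rewrite mulr_ge0// expR_ge0.
rewrite /gsmooth.
set c1 := expR (beta * r + h) / 2; set c2 := expR (- (beta * r) - h) / 2.
have c10 : 0 <= c1 by rewrite divr_ge0// expR_ge0.
have c20 : 0 <= c2 by rewrite divr_ge0// expR_ge0.
have -> : (\int[gam]_z (u (r + sv * z) * chx (r + sv * z))%:E =
  \int[gam]_z (c1 * (F z * expR (beta * sv * z)) + c2 * (F z * expR (- beta * sv * z)))%:E)%E.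
  apply: eq_integral => z _; congr EFin; rewrite /chx /c1 /c2 -/(F z).
  have -> : beta * (r + sv * z) + h = (beta * r + h) + beta * sv * z by ring.
  have -> : - (beta * r + h + beta * sv * z) = (- (beta * r) - h) + - beta * sv * z by ring.
  by rewrite !expRD; field.
rewrite integralD_ge0; last 4 first.
- by apply: measurable_funM; [exact: measurable_cst|exact: me].
- by move=> z; rewrite mulr_ge0.
- by apply: measurable_funM; [exact: measurable_cst|exact: me].
- by move=> z; rewrite mulr_ge0.
rewrite (integralZ_ge0 gam _ (me _) (e0 _) c10) (integralZ_ge0 gam _ (me _) (e0 _) c20) !side.
rewrite -!EFinM -EFinD /= /mixint /mixw /chx /c1 /c2 mulNr sqrrN.
have -> : - (beta * r + h) = - (beta * r) - h by ring.
field.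
by rewrite gt_eqF// addr_gt0 ?expR_gt0.
Qed.

End bounded.

End mixture.

Section supremum_norm.
Context {R : realType} (u : R -> R).
Hypothesis bu : exists M : R, forall x, `|u x| <= M.

Lemma le_supnorm x : `|u x| <= supnorm u.
Proof.
case: bu => M hM; apply: ub_le_sup; last by exists x.
by exists M => _ [y _ <-].
Qed.

Lemma supnorm_ge0 : 0 <= supnorm u.
Proof. exact: le_trans (normr_ge0 (u 0)) (le_supnorm 0). Qed.

(** The Gaussian comparison is stated for nonnegative observables; both parts are again bounded by
    [supnorm u]. *)
Definition pos_part (x : R) : R := Num.max (u x) 0.
Definition neg_part (x : R) : R := Num.max (- u x) 0.

Lemma pos_neg_part x : u x = pos_part x - neg_part x.
Proof.
by rewrite /pos_part /neg_part; case: (leP (u x) 0); case: (leP (- u x) 0); lra.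
Qed.

Lemma pos_part01 x : 0 <= pos_part x <= supnorm u.
Proof.
rewrite /pos_part le_max lexx orbT ge_max supnorm_ge0 andbT.
exact: le_trans (ler_norm _) (le_supnorm x).
Qed.

Lemma neg_part01 x : 0 <= neg_part x <= supnorm u.
Proof.
rewrite /neg_part le_max lexx orbT ge_max supnorm_ge0 andbT.
by apply: le_trans (ler_norm _) _; rewrite normrN; exact: le_supnorm.
Qed.

Hypothesis mu_ : measurable_fun setT u.

Lemma measurable_pos_part : measurable_fun setT pos_part.
Proof. by apply: measurable_maxr => //; exact: measurable_cst. Qed.

Lemma measurable_neg_part : measurable_fun setT neg_part.
Proof. by apply: measurable_maxr; mfun. Qed.

End supremum_norm.

(** * Comparison at one site for a fixed disorder *)

Section one_site.
Context {R : realType} {d : measure_display} {T : measurableType d} {N : nat}.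
Variables (P : probability T R) (beta h q : R) (g : 'I_N -> 'I_N -> T -> R) (i : 'I_N).
Hypothesis hSK : SK_disorder P g.
Hypothesis q1 : q < 1.
Local Notation field := (field g i).
Local Notation cavpi := (cavpi beta h g i).
Local Notation cavB := (cavB beta h g i).
Local Notation cavr := (cavr beta h g i).
Local Notation cavK := (cavK beta h g i q).
Local Notation cavDelta := (cavDelta beta h g i q).
Local Notation Gibbs := (Gibbs beta h g).
Local Notation chx := (chx beta h).
Local Notation shx := (shx beta h).
Local Notation mixint := (mixint beta h q).
Local Notation r_field := (r_field beta h g q i).
Local Notation sv := (Num.sqrt (1 - q)).

Lemma r_fieldE w : r_field w =
  gavg1 beta h g (field w) w - beta * (1 - q) * gavg1 beta h g (fun s => spin (s i)) w.
Proof.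
rewrite /r_field /mag; congr (_ - _).
rewrite /gavg1 mulr_sumr.
under eq_bigr do rewrite mulr_sumr mulr_sumr.
rewrite exchange_big /=; apply: eq_bigr => s _.
rewrite -local_fieldE /local_field mulr_sumr mulr_suml.
by apply: eq_bigr => j _; rewrite !mulrA.
Qed.

Lemma measurable_gavg1_field (F : R -> R) : measurable_fun setT F ->
  measurable_fun setT (fun w => gavg1 beta h g (fun s => F (field w s)) w).
Proof.
move=> mF; apply: measurable_sum => s; apply: measurable_funM.
  by apply: (measurable_compT mF); exact: (measurable_field P).
exact: (measurable_Gibbs P _ _ _ i).
Qed.

Lemma measurable_r_field : measurable_fun setT r_field.
Proof.
have -> : r_field = (fun w => gavg1 beta h g (field w) w -
    beta * (1 - q) * gavg1 beta h g (fun s => spin (s i)) w).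
  by apply/funext => w; exact: r_fieldE.
apply: measurable_funB; first exact: (measurable_gavg1_field id (@measurable_id _ _ setT)).
apply: measurable_funM; first exact: measurable_cst.
apply: measurable_sum => s; apply: measurable_funM; first exact: measurable_cst.
exact: (measurable_Gibbs P _ _ _ i).
Qed.

(** Multiplied by [cavB], the Gibbs mean of the field l is the cavity average of l cosh(beta l + h),
    and that of spin i is the cavity average of sinh(beta l + h). Splitting both into exponentials
    leaves the centred averages [cavK] with b = beta and b = - beta. *)
Lemma r_field_cavr w : (r_field w - cavr w) * cavB w =
  expR h / 2 * cavK beta w + expR (- h) / 2 * cavK (- beta) w.
Proof.
rewrite r_fieldE !mulrBl -(mulrA (beta * (1 - q))).
rewrite (gavg1_field beta h g i w id) (gavg1_spin beta h g i w) /cavB /cavK !mulr_sumr -!sumrB -big_split.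
apply: eq_bigr => s _ /=; rewrite /chx /shx.
have -> : - (beta * field w s + h) = - beta * field w s + - h by ring.
by rewrite !expRD; field.
Qed.

Lemma r_field_cavr_sqr w : (r_field w - cavr w) ^+ 2 <=
  expR `|h| ^+ 2 / 2 * (cavK beta w ^+ 2 + cavK (- beta) w ^+ 2).
Proof.
have B1 := cavB_ge1 beta h g i w.
apply: (@le_trans _ _ (((r_field w - cavr w) * cavB w) ^+ 2)).
  by rewrite exprMn ler_peMr ?sqr_ge0// expr_ge1// (le_trans ler01).
rewrite r_field_cavr; set K := cavK beta w; set K' := cavK (- beta) w.
have e1 : 0 <= expR h <= expR `|h| by rewrite expR_ge0 ler_expR ler_norm.
have e2 : 0 <= expR (- h) <= expR `|h| by rewrite expR_ge0 ler_expR -normrN ler_norm.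
have sq (x y : R) : 0 <= x <= y -> x ^+ 2 <= y ^+ 2.
  by case/andP => x0 xy; rewrite lerXn2r// nnegrE// (le_trans x0).
have h1 : expR h ^+ 2 * K ^+ 2 <= expR `|h| ^+ 2 * K ^+ 2 by rewrite ler_wpM2r ?sqr_ge0// sq.
have h2 : expR (- h) ^+ 2 * K' ^+ 2 <= expR `|h| ^+ 2 * K' ^+ 2 by rewrite ler_wpM2r ?sqr_ge0// sq.
have := sqr_ge0 (expR h * K - expR (- h) * K'); nra.
Qed.

Section bounded_observable.
Variables (u : R -> R) (U : R).
Hypothesis mu_ : measurable_fun setT u.
Hypothesis u0U : forall x, 0 <= u x <= U.

Let U0 : 0 <= U. Proof. by case/andP: (u0U 0) => h1 h2; exact: (le_trans h1 h2). Qed.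

Lemma chx_wexp y : chx y <= expR `|h| * wexp beta y.
Proof.
rewrite /chx /wexp opprD !expRD ?mulNr.
have e1 : expR h <= expR `|h| by rewrite ler_expR ler_norm.
have e2 : expR (- h) <= expR `|h| by rewrite ler_expR -normrN ler_norm.
have e0 := expR_ge0 `|h|.
have a0 := expR_ge0 (beta * y); have b0 := expR_ge0 (- (beta * y)).
have := ler_wpM2l a0 e1; have := ler_wpM2l b0 e2.
rewrite mulrDr (mulrC (expR `|h|)) (mulrC (expR `|h|)).
have := mulr_ge0 a0 e0; have := mulr_ge0 b0 e0; lra.
Qed.

Definition cav_err (w : T) : R :=
  \sum_s cavpi w s * (u (field w s) * chx (field w s)) -
  expR (beta ^+ 2 * (1 - q) / 2) * chx (cavr w) * mixint u (cavr w).

Lemma measurable_chx : measurable_fun setT chx.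
Proof. by rewrite /chx; mfun. Qed.

Lemma measurable_cav_err : measurable_fun setT cav_err.
Proof.
have mr : measurable_fun setT cavr by exact: (measurable_cavr P).
apply: measurable_funB.
  apply: measurable_sum => s; apply: measurable_funM; first exact: (measurable_cavpi P).
  apply: measurable_funM.
    by apply: (measurable_compT mu_); exact: (measurable_field P).
  by apply: (measurable_compT measurable_chx); exact: (measurable_field P).
apply: measurable_funM.
  apply: measurable_funM; first exact: measurable_cst.
  exact: (measurable_compT measurable_chx).
exact: (measurable_compT (measurable_mixint beta h q u U mu_ u0U)).
Qed.

Lemma integral_cav_err C : 0 <= q -> 0 <= C -> compare_cst q beta C ->
  (\int[P]_w (cav_err w ^+ 2)%:E <=
   \int[P]_w (C * (U * expR `|h|) ^+ 2 * (4 * N%:R^-1 + 8 * cavDelta w))%:E)%E.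
Proof.
move=> q0 C0 hC.
have mf : measurable_fun setT (fun y => u y * chx y).
  by apply: measurable_funM => //; exact: measurable_chx.
have fM y : 0 <= u y * chx y <= U * expR `|h| * wexp beta y.
  have c0 : 0 <= chx y by exact: le_trans ler01 (chx_ge1 _ _ _).
  case/andP: (u0U y) => u0 uU; rewrite mulr_ge0//= -mulrA.
  by apply: ler_pM => //; exact: chx_wexp.
have := cav_core P beta h g i hSK q beta C (U * expR `|h|) _ q0 q1 hC C0 mf fM.
have -> : (\int[P]_w ((\sum_s cavpi w s * (u (field w s) * chx (field w s)) -
    gsmooth sv (fun y => u y * chx y) (cavr w)) ^+ 2)%:E = \int[P]_w (cav_err w ^+ 2)%:E)%E.
  by apply: eq_integral => w _; rewrite (gsmooth_chx beta h q q1 u U mu_ u0U).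
by [].
Qed.

End bounded_observable.

Lemma mixint1 r : mixint (fun=> 1) r = 1.
Proof.
have g1 m : gsmooth sv (fun=> (1 : R)) m = 1.
  by rewrite /gsmooth integral_normal_cst ?lee_fin.
by rewrite /mixint !g1 !mulr1 subrKC.
Qed.

Lemma cav_err1 w : cav_err (fun=> 1) w =
  cavB w - expR (beta ^+ 2 * (1 - q) / 2) * chx (cavr w).
Proof.
rewrite /cav_err mixint1 mulr1; congr (_ - _).
by apply: eq_bigr => s _; rewrite mul1r.
Qed.

Section difference.
Variables (u : R -> R).
Hypothesis mu_ : measurable_fun setT u.
Hypothesis bu : exists M : R, forall x, `|u x| <= M.
Local Notation U := (supnorm u).
Local Notation uP := (pos_part u).
Local Notation uN := (neg_part u).

Let muP := measurable_pos_part u mu_.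
Let muN := measurable_neg_part u mu_.
Let uP0 := pos_part01 u bu.
Let uN0 := neg_part01 u bu.

Lemma nu_integralE w :
  nu_integral beta h g q u i w = mixint uP (r_field w) - mixint uN (r_field w).
Proof.
set r := r_field w.
pose dens x := mixw beta h r * normal_pdf (r + beta * (1 - q)) sv x +
     (1 - mixw beta h r) * normal_pdf (r - beta * (1 - q)) sv x.
have /andP[p0 p1] := mixw01 beta h r.
have d0 x : 0 <= dens x.
  by rewrite addr_ge0// mulr_ge0 ?normal_pdf_ge0// subr_ge0.
have md : measurable_fun setT dens.
  by apply: measurable_funD; apply: measurable_funM;
    [exact: measurable_cst|exact: measurable_normal_pdf|exact: measurable_cst|exact: measurable_normal_pdf].
(* [u] may change sign, so integrability against the mixture is checked for its two parts before the
   integral is split. *)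
have int (f : R -> R) : measurable_fun setT f -> (forall x, 0 <= f x <= U) ->
   (@lebesgue_measure R).-integrable setT (EFin \o (fun x => f x * dens x)).
  move=> mf f0; apply/integrableP; split.
    by apply: measurable_fun_EFin; exact: measurable_funM.
  have -> : (\int[lebesgue_measure]_x `|(EFin \o (fun x => (f x * dens x)%R)) x|)%E =
     (mixint f r)%:E.
    rewrite -(integral_mixture beta h q q1 f U mf f0 r); apply: eq_integral => x _ /=.
    by rewrite ger0_norm// mulr_ge0//; case/andP: (f0 x).
  exact: ltry.
rewrite /nu_integral.
have -> : (\int[lebesgue_measure]_x (u x * nu_density beta h g q i w x)%:E =
   \int[lebesgue_measure]_x ((uP x * dens x)%:E - (uN x * dens x)%:E))%E.
  by apply: eq_integral => x _; rewrite -EFinB -mulrBl -(pos_neg_part u x).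
rewrite integralB_EFin//; [|exact: int|exact: int].
by rewrite (integral_mixture beta h q q1 uP U muP uP0 r) (integral_mixture beta h q q1 uN U muN uN0 r).
Qed.

Definition site_diff (w : T) : R :=
  gavg1 beta h g (fun s => u (local_field g i w s)) w - nu_integral beta h g q u i w.

Lemma site_diffE w : site_diff w =
  gavg1 beta h g (fun s => u (field w s)) w - (mixint uP (r_field w) - mixint uN (r_field w)).
Proof.
rewrite /site_diff nu_integralE; congr (_ - _); apply: eq_bigr => s _.
by rewrite local_fieldE.
Qed.

Lemma measurable_site_diff : measurable_fun setT site_diff.
Proof.
have -> : site_diff = (fun w => gavg1 beta h g (fun s => u (field w s)) w -
    (mixint uP (r_field w) - mixint uN (r_field w))).
  by apply/funext => w; exact: site_diffE.
apply: measurable_funB; first exact: measurable_gavg1_field.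
by apply: measurable_funB;
  [apply: (measurable_compT (measurable_mixint beta h q uP U muP uP0))
  |apply: (measurable_compT (measurable_mixint beta h q uN U muN uN0))];
  exact: measurable_r_field.
Qed.

Lemma mixint_diff_le r : `|mixint uP r - mixint uN r| <= U.
Proof.
have /andP[? ?] := mixint_le beta h q uP U muP uP0 r.
have /andP[? ?] := mixint_le beta h q uN U muN uN0 r.
by rewrite ler_norml; apply/andP; split; lra.
Qed.

Lemma site_diff_trivial w : site_diff w ^+ 2 <= 4 * U ^+ 2.
Proof.
have U0 := supnorm_ge0 u bu.
have h1 : `|gavg1 beta h g (fun s => u (field w s)) w| <= U.
  apply: (le_trans (ler_norm_sum _ _ _)).
  apply: (@le_trans _ _ (\sum_s U * Gibbs w s)); last by rewrite -mulr_sumr Gibbs_sum mulr1.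
  apply: ler_sum => s _; rewrite normrM (ger0_norm (Gibbs_ge0 _ _ _ w s)).
  by apply: ler_wpM2r; [exact: Gibbs_ge0|exact: le_supnorm].
have h2 := mixint_diff_le (r_field w).
have h3 : `|site_diff w| <= 2 * U.
  by rewrite site_diffE; apply: (le_trans (ler_normB _ _)); lra.
rewrite -(real_normK (num_real (site_diff w))).
have -> : 4 * U ^+ 2 = (2 * U) ^+ 2 by ring.
by rewrite lerXn2r// nnegrE// mulr_ge0.
Qed.

(** Multiplied by [cavB], the difference [A - m] is a combination of three errors, the one for the
    constant 1 accounting for the denominator; [cavB_ge1] lets the factor be dropped. Moving the
    centre from [cavr] to [r_field] costs [m - m']. *)
Lemma site_diff_le w : site_diff w ^+ 2 <=
  4 * cav_err uP w ^+ 2 + 4 * cav_err uN w ^+ 2 + 4 * U ^+ 2 * cav_err (fun=> 1) w ^+ 2 +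
  8 * (mix_cst beta q * U * expR `|h|) ^+ 2 * (cavK beta w ^+ 2 + cavK (- beta) w ^+ 2).
Proof.
have U0 := supnorm_ge0 u bu.
have B1 := cavB_ge1 beta h g i w.
set m := mixint uP (cavr w) - mixint uN (cavr w).
pose m' := mixint uP (r_field w) - mixint uN (r_field w).
set A := gavg1 beta h g (fun s => u (field w s)) w.
have e0 : (A - m) * cavB w = cav_err uP w - cav_err uN w - m * cav_err (fun=> 1) w.
  rewrite cav_err1 mulrBl {1}/A gavg1_field.
  have -> : \sum_s cavpi w s * (u (field w s) * chx (field w s)) =
     \sum_s cavpi w s * (uP (field w s) * chx (field w s)) -
     \sum_s cavpi w s * (uN (field w s) * chx (field w s)).
    by rewrite -sumrB; apply: eq_bigr => s _; rewrite (pos_neg_part u (field w s)); ring.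
  by rewrite /cav_err /m; ring.
have e1 : (A - m) ^+ 2 <= (cav_err uP w - cav_err uN w - m * cav_err (fun=> 1) w) ^+ 2.
  by rewrite -e0 exprMn ler_peMr ?sqr_ge0// expr_ge1// (le_trans ler01).
have m2 : m ^+ 2 <= U ^+ 2.
  rewrite -(real_normK (num_real m)) lerXn2r ?nnegrE//; exact: mixint_diff_le.
have e2 : `|m - m'| <= 2 * (mix_cst beta q * U) * `|r_field w - cavr w|.
  have hP := mixint_lip beta h q q1 uP U muP uP0 (cavr w) (r_field w).
  have hN := mixint_lip beta h q q1 uN U muN uN0 (cavr w) (r_field w).
  have -> : m - m' = (mixint uP (cavr w) - mixint uP (r_field w)) -
     (mixint uN (cavr w) - mixint uN (r_field w)) by rewrite /m /m'; ring.
  by apply: (le_trans (ler_normB _ _)); rewrite (distrC (r_field w)); lra.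
have e3 : (m - m') ^+ 2 <= 4 * (mix_cst beta q * U) ^+ 2 * (r_field w - cavr w) ^+ 2.
  rewrite -(real_normK (num_real (m - m'))) -(real_normK (num_real (r_field w - cavr w))).
  have -> : 4 * (mix_cst beta q * U) ^+ 2 * `|r_field w - cavr w| ^+ 2 =
     (2 * (mix_cst beta q * U) * `|r_field w - cavr w|) ^+ 2 by ring.
  by rewrite lerXn2r// nnegrE// (le_trans _ e2).
have e4 : 4 * (mix_cst beta q * U) ^+ 2 * (r_field w - cavr w) ^+ 2 <=
    2 * (mix_cst beta q * U * expR `|h|) ^+ 2 * (cavK beta w ^+ 2 + cavK (- beta) w ^+ 2).
  have c0 : 0 <= 4 * (mix_cst beta q * U) ^+ 2 by rewrite mulr_ge0// sqr_ge0.
  apply: (le_trans (ler_wpM2l c0 (r_field_cavr_sqr w))).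
  by rewrite le_eqVlt; apply/orP; left; apply/eqP; field.
have e5 : (m * cav_err (fun=> 1) w) ^+ 2 <= U ^+ 2 * cav_err (fun=> 1) w ^+ 2.
  by rewrite exprMn ler_wpM2r// sqr_ge0.
have -> : site_diff w = (A - m) + (m - m') by rewrite site_diffE /A /m'; ring.
have three (a b c : R) : (a - b - c) ^+ 2 <= 3 * (a ^+ 2 + b ^+ 2 + c ^+ 2).
  have := sqr_ge0 (a + b); have := sqr_ge0 (a + c); have := sqr_ge0 (b - c); nra.
(* The weights 4 / 3 and 4 are chosen so that, with the factor 3 of [three], each cavity error gets
   the coefficient 4. *)
have two (a b : R) : (a + b) ^+ 2 <= 4 / 3 * a ^+ 2 + 4 * b ^+ 2.
  have := sqr_ge0 (a - 3 * b); nra.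
apply: (le_trans (two _ _)).
have := three (cav_err uP w) (cav_err uN w) (m * cav_err (fun=> 1) w).
lra.
Qed.

End difference.
End one_site.

(** * The bound when 0 <= q *)

Section nonneg_overlap.
Context {R : realType} {d : measure_display} {T : measurableType d} {N : nat}.
Variables (P : probability T R) (beta h q C0 : R) (g : 'I_N -> 'I_N -> T -> R) (i : 'I_N).
Hypothesis hSK : SK_disorder P g.
Hypothesis q0 : 0 <= q.
Hypothesis q1 : q < 1.
Hypothesis moment : (\int[P]_w (overlap4 beta h g q w)%:E <= (C0 / (N%:R ^+ 2))%:E)%E.
Local Notation cavDelta := (cavDelta beta h g i q).
Local Notation cavK := (cavK beta h g i q).
Local Notation rt := (Num.sqrt N%:R : R).

Let NR0 : 0 < N%:R :> R. Proof. by rewrite ltr0n (leq_ltn_trans _ (ltn_ord i)). Qed.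
Let rt0 : 0 < rt. Proof. by rewrite sqrtr_gt0. Qed.

Let invN_le : N%:R^-1 <= rt^-1.
Proof.
have r1 : 1 <= rt by rewrite -[leLHS]sqrtr1 ler_wsqrtr// ler1n -(ltr0n R).
have r2 : rt ^+ 2 = N%:R by rewrite sqr_sqrtr// ltW.
by rewrite lef_pV2 ?posrE// -[leRHS]r2 expr2 ler_peMr// ltW.
Qed.

Lemma integral_affine_cavDelta (a b c : R) : 0 <= a -> 0 <= b -> 0 <= c ->
  (\int[P]_w (c * (a * N%:R^-1 + b * cavDelta w))%:E <=
   (c * (a + b * Delta_cst beta h C0) / rt)%:E)%E.
Proof.
move=> a0 b0 c0.
have mD := measurable_cavDelta P beta h g i hSK q.
have D0 := cavDelta_ge0 beta h g i q.
have aN0 : 0 <= a * N%:R^-1 :> R by rewrite mulr_ge0// invr_ge0 ltW.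
have mbD : measurable_fun setT (fun w => b * cavDelta w).
  by apply: measurable_funM; [exact: measurable_cst|exact: mD].
have bD0 w : 0 <= b * cavDelta w by rewrite mulr_ge0.
have maD : measurable_fun setT (fun w => a * N%:R^-1 + b * cavDelta w).
  by apply: measurable_funD; [exact: measurable_cst|exact: mbD].
have aD0 w : 0 <= a * N%:R^-1 + b * cavDelta w by rewrite addr_ge0.
rewrite (integralZ_ge0 P c maD aD0 c0).
have mc : measurable_fun setT (fun _ : T => a * N%:R^-1) by exact: measurable_cst.
rewrite (integralD_ge0 P mc (fun=> aN0) mbD bD0).
rewrite (integralZ_ge0 P b mD D0 b0).
have -> : (\int[P]_w (a * N%:R^-1)%:E = (a * N%:R^-1)%:E)%E.
  by rewrite integral_cst// [X in (_ * X)%E]probability_setT mule1.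
apply: (@le_trans _ _ (c%:E * ((a * N%:R^-1)%:E + b%:E * (Delta_cst beta h C0 / rt)%:E))%E).
  rewrite lee_wpmul2l ?lee_fin// leeD2l// lee_wpmul2l ?lee_fin//.
  exact: (integral_cavDelta P beta h g i hSK q C0 moment).
rewrite -!EFinM lee_fin -mulrA ler_wpM2l//.
by rewrite (mulrA b) mulrDl lerD2r ler_wpM2l.
Qed.

(** 12 adds the coefficients 4 of three cavity errors: those of the two parts of u and, scaled by
    the squared norm, that of the constant 1. *)
Definition site_cst (C : R) : R :=
  12 * (C * expR `|h| ^+ 2 * (4 + 8 * Delta_cst beta h C0)) +
  8 * (mix_cst beta q * expR `|h|) ^+ 2 *
    ((tilt_cst beta + tilt_cst (- beta)) * (1 + 4 * Delta_cst beta h C0)).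

Variables (u : R -> R) (C : R).
Hypothesis mu_ : measurable_fun setT u.
Hypothesis bu : exists M : R, forall x, `|u x| <= M.
Hypothesis Cge0 : 0 <= C.
Hypothesis hC : compare_cst q beta C.
Local Notation U := (supnorm u).

Let U0 : 0 <= U. Proof. exact: supnorm_ge0. Qed.

Let cav_err_le (v : R -> R) (V : R) : measurable_fun setT v -> (forall x, 0 <= v x <= V) ->
  (\int[P]_w (cav_err beta h q g i v w ^+ 2)%:E <=
   (C * (V * expR `|h|) ^+ 2 * (4 + 8 * Delta_cst beta h C0) / rt)%:E)%E.
Proof.
move=> mv v0; apply: (le_trans (integral_cav_err P beta h q g i hSK q1 v V mv v0 C q0 Cge0 hC)).
by apply: integral_affine_cavDelta => //; rewrite mulr_ge0// sqr_ge0.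
Qed.

Let cavK_le b : (\int[P]_w (cavK b w ^+ 2)%:E <=
   (tilt_cst b * (1 + 4 * Delta_cst beta h C0) / rt)%:E)%E.
Proof.
have := cav_tilt P beta h g i hSK q b q0 q1.
have -> : (\int[P]_w (tilt_cst b * (N%:R^-1 + 4 * cavDelta w))%:E =
   \int[P]_w (tilt_cst b * (1 * N%:R^-1 + 4 * cavDelta w))%:E)%E.
  by apply: eq_integral => w _; rewrite mul1r.
move=> /le_trans; apply; apply: integral_affine_cavDelta => //.
exact: tilt_cst_ge0.
Qed.

Lemma site_diff_bound :
  (\int[P]_w (site_diff beta h q g i u w ^+ 2)%:E <= (site_cst C * U ^+ 2 / rt)%:E)%E.
Proof.
pose eP := cav_err beta h q g i (pos_part u).
pose eN := cav_err beta h q g i (neg_part u).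
pose e1 := cav_err beta h q g i (fun=> 1).
pose c8 : R := 8 * (mix_cst beta q * U * expR `|h|) ^+ 2.
have muP := measurable_pos_part u mu_.
have muN := measurable_neg_part u mu_.
have uP0 := pos_part01 u bu.
have uN0 := neg_part01 u bu.
have one01 (x : R) : 0 <= (1 : R) <= 1 by rewrite ler01 lexx.
have mone : measurable_fun setT (fun _ : R => (1 : R)) by exact: measurable_cst.
have mP2 : measurable_fun setT (fun w => eP w ^+ 2).
  by apply: measurable_funX; exact: (measurable_cav_err P beta h q g i hSK _ _ muP uP0).
have mN2 : measurable_fun setT (fun w => eN w ^+ 2).
  by apply: measurable_funX; exact: (measurable_cav_err P beta h q g i hSK _ _ muN uN0).
have m12 : measurable_fun setT (fun w => e1 w ^+ 2).
  by apply: measurable_funX;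
    exact: (measurable_cav_err P beta h q g i hSK _ _ mone one01).
have mK b : measurable_fun setT (fun w => cavK b w ^+ 2).
  apply: measurable_funX; apply: measurable_sum => s.
  have mf := measurable_field P g i hSK s.
  apply: measurable_funM; first exact: (measurable_cavpi P).
  apply: measurable_funM.
    apply: measurable_funB; last exact: measurable_cst.
    by apply: measurable_funB; [exact: mf|exact: (measurable_cavr P)].
  by apply: measurable_fun_expR; apply: measurable_funM; [exact: measurable_cst|exact: mf].
have sq0 (f : T -> R) w : 0 <= f w ^+ 2 by exact: sqr_ge0.
have four0 : 0 <= 4 :> R by [].
have fU0 : 0 <= 4 * U ^+ 2 by rewrite mulr_ge0// sqr_ge0.
have c80 : 0 <= c8 by rewrite mulr_ge0// sqr_ge0.
have mZ (k : R) f : measurable_fun setT f -> measurable_fun setT (fun w : T => k * f w).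
  by move=> mf; apply: measurable_funM; [exact: measurable_cst|].
have Z0 (k : R) (f : T -> R) : 0 <= k -> (forall w, 0 <= f w) -> forall w, 0 <= k * f w.
  by move=> k0 f0 w; exact: mulr_ge0.
have mKK : measurable_fun setT (fun w => cavK beta w ^+ 2 + cavK (- beta) w ^+ 2).
  exact: (measurable_funD (mK beta) (mK (- beta))).
have KK0 w : 0 <= cavK beta w ^+ 2 + cavK (- beta) w ^+ 2 by rewrite addr_ge0 ?sqr_ge0.
have m3 : measurable_fun setT (fun w => 4 * U ^+ 2 * e1 w ^+ 2 +
    c8 * (cavK beta w ^+ 2 + cavK (- beta) w ^+ 2)).
  exact: (measurable_funD (mZ _ _ m12) (mZ _ _ mKK)).
have m2 : measurable_fun setT (fun w => 4 * eN w ^+ 2 + (4 * U ^+ 2 * e1 w ^+ 2 +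
    c8 * (cavK beta w ^+ 2 + cavK (- beta) w ^+ 2))).
  exact: (measurable_funD (mZ _ _ mN2) m3).
have p3 (w : T) := addr_ge0 (Z0 _ _ fU0 (sq0 e1) w) (Z0 _ _ c80 KK0 w).
have p2 (w : T) := addr_ge0 (Z0 _ _ four0 (sq0 eN) w) (p3 w).
apply: (@le_trans _ _ (\int[P]_w (4 * eP w ^+ 2 + (4 * eN w ^+ 2 + (4 * U ^+ 2 * e1 w ^+ 2 +
    c8 * (cavK beta w ^+ 2 + cavK (- beta) w ^+ 2))))%:E)%E).
  apply: le_integral_ge0.
  - by apply: measurable_funX; exact: (measurable_site_diff P).
  - by move=> w; exact: sqr_ge0.
  - exact: (measurable_funD (mZ _ _ mP2) m2).
  - move=> w; rewrite addrA addrA; exact: site_diff_le.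
rewrite (integralD_ge0 P (mZ 4 _ mP2) (Z0 _ _ four0 (sq0 eP)) m2 p2).
rewrite (integralD_ge0 P (mZ 4 _ mN2) (Z0 _ _ four0 (sq0 eN)) m3 p3).
rewrite (integralD_ge0 P (mZ (4 * U ^+ 2) _ m12) (Z0 _ _ fU0 (sq0 e1)) (mZ c8 _ mKK) (Z0 _ _ c80 KK0)).
rewrite (integralZ_ge0 P 4 mP2 (sq0 eP) four0) (integralZ_ge0 P 4 mN2 (sq0 eN) four0).
rewrite (integralZ_ge0 P _ m12 (sq0 e1) fU0) (integralZ_ge0 P c8 mKK KK0 c80).
rewrite (integralD_ge0 P (mK beta) (sq0 (cavK beta)) (mK (- beta)) (sq0 (cavK (- beta)))).
have bP := cav_err_le _ _ muP uP0.
have bN := cav_err_le _ _ muN uN0.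
have b1 := cav_err_le _ _ mone one01.
set X := C * (U * expR `|h|) ^+ 2 * (4 + 8 * Delta_cst beta h C0) / rt in bP bN.
set X1 := C * (1 * expR `|h|) ^+ 2 * (4 + 8 * Delta_cst beta h C0) / rt in b1.
pose Y b := tilt_cst b * (1 + 4 * Delta_cst beta h C0) / rt.
apply: (@le_trans _ _ (4%:E * X%:E + (4%:E * X%:E + ((4 * U ^+ 2)%:E * X1%:E +
   c8%:E * ((Y beta)%:E + (Y (- beta))%:E))))%E).
  have fE (x : R) : 0 <= x -> (0%E <= x%:E)%E by rewrite lee_fin.
  apply: leeD; first exact: (lee_wpmul2l (fE _ four0) bP).
  apply: leeD; first exact: (lee_wpmul2l (fE _ four0) bN).
  apply: leeD; first exact: (lee_wpmul2l (fE _ fU0) b1).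
  apply: (lee_wpmul2l (fE _ c80)); apply: leeD; exact: cavK_le.
rewrite -!EFinM -!EFinD lee_fin /site_cst /c8 /X /X1 /Y.
rewrite le_eqVlt; apply/orP; left; apply/eqP; ring.
Qed.

End nonneg_overlap.

(** * The bound when q < 0 *)

Section neg_overlap.
Context {R : realType} {d : measure_display} {T : measurableType d} {N : nat}.
Variables (P : probability T R) (beta h q C0 : R) (g : 'I_N -> 'I_N -> T -> R) (i : 'I_N).
Hypothesis hSK : SK_disorder P g.
Hypothesis q0 : q < 0.
Hypothesis moment : (\int[P]_w (overlap4 beta h g q w)%:E <= (C0 / (N%:R ^+ 2))%:E)%E.

Let NR0 : 0 < N%:R :> R. Proof. by rewrite ltr0n (leq_ltn_trans _ (ltn_ord i)). Qed.

(** Two replicas being independent, their mean overlap is the average over the sites of the squared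
    magnetisations. *)
Lemma gavg2_overlap_ge0 w : 0 <= gavg2 beta h g (@overlap R N) w.
Proof.
have -> : gavg2 beta h g (@overlap R N) w = N%:R^-1 * \sum_(j < N) mag beta h g j w ^+ 2.
  rewrite /gavg2 /overlap /mag /gavg1 mulr_sumr.
  under eq_bigr do under eq_bigr do rewrite -mulrA mulr_sumr mulr_suml.
  under eq_bigr do rewrite exchange_big/=.
  rewrite exchange_big /=; apply: eq_bigr => j _.
  rewrite expr2 mulr_suml mulr_sumr; apply: eq_bigr => s _.
  by rewrite mulr_sumr mulr_sumr; apply: eq_bigr => s' _; ring.
rewrite mulr_ge0 ?invr_ge0 ?(ltW NR0)//.
by apply: sumr_ge0 => j _; exact: sqr_ge0.
Qed.

(* A nonnegative mean overlap keeps the fourth moment around [q < 0] above [q ^ 4]. *)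
Lemma overlap4_ge w : q ^+ 4 <= overlap4 beta h g q w.
Proof.
have c0 : 0 <= 4 * (- q) ^+ 3 by rewrite mulr_ge0// exprn_ge0// oppr_ge0 ltW.
have G1 : \sum_(s1 : config N) \sum_(s2 : config N) Gibbs beta h g w s1 * Gibbs beta h g w s2 = 1.
  by under eq_bigr do rewrite -mulr_sumr Gibbs_sum mulr1; exact: Gibbs_sum.
(* The tangent line at y = 0 lies below (y - q)^4, and its slope 4 (-q)^3 is positive, so its linear
   term may be dropped after averaging. *)
apply: (@le_trans _ _ (q ^+ 4 + 4 * (- q) ^+ 3 * gavg2 beta h g (@overlap R N) w)).
  by rewrite lerDl mulr_ge0// gavg2_overlap_ge0.
rewrite -[q ^+ 4 as X in X + _]mulr1 -[X in _ * X + _]G1 /overlap4 /gavg2 !mulr_sumr -big_split.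
apply: ler_sum => s1 _ /=; rewrite !mulr_sumr -big_split; apply: ler_sum => s2 _ /=.
set y := overlap s1 s2; set a := Gibbs _ _ _ _ s1; set b := Gibbs _ _ _ _ s2.
have ab0 : 0 <= a * b by apply: mulr_ge0; exact: Gibbs_ge0.
rewrite [leLHS](_ : _ = (q ^+ 4 + 4 * (- q) ^+ 3 * y) * (a * b)); last by ring.
rewrite -[leRHS]mulrA ler_wpM2r// -subr_ge0.
have -> : (y - q) ^+ 4 - (q ^+ 4 + 4 * (- q) ^+ 3 * y) =
  y ^+ 2 * ((y - 2 * q) ^+ 2 + 2 * q ^+ 2) by ring.
by rewrite mulr_ge0 ?sqr_ge0// addr_ge0 ?sqr_ge0// mulr_ge0 ?sqr_ge0.
Qed.

(** Here q^4 <= C0 / N^2 and sqrt N <= N^2, so |C0| / (q^4 sqrt N) is at least 1 and may multiply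
    the trivial bound. *)
Lemma site_diff_bound_neg (u : R -> R) : q < 1 -> measurable_fun setT u ->
  (exists M : R, forall x, `|u x| <= M) ->
  (\int[P]_w (site_diff beta h q g i u w ^+ 2)%:E <=
   (4 * (`|C0| / q ^+ 4) * supnorm u ^+ 2 / Num.sqrt N%:R)%:E)%E.
Proof.
move=> q1 mu_ bu; have U0 := supnorm_ge0 u bu.
set rt := Num.sqrt N%:R; have rt0 : 0 < rt by rewrite sqrtr_gt0.
have rt1 : 1 <= rt by rewrite -[leLHS]sqrtr1 ler_wsqrtr// ler1n -(ltr0n R).
have rt2 : rt ^+ 2 = N%:R by rewrite sqr_sqrtr// ltW.
have q4 : 0 < q ^+ 4 by rewrite exprn_even_gt0//= lt_eqF.
have hq : q ^+ 4 <= C0 / N%:R ^+ 2.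
  rewrite -lee_fin; apply: le_trans moment.
  rewrite -[leLHS]mule1 -(@probability_setT _ _ _ P) -integral_cst//.
  apply: le_integral_ge0.
  - exact: measurable_cst.
  - by move=> w; exact: ltW.
  - exact: (measurable_overlap4 P beta h g i).
  - exact: overlap4_ge.
have one : 1 <= `|C0| / q ^+ 4 / rt.
  rewrite ler_pdivlMr// mul1r ler_pdivlMr//.
  move: hq; rewrite ler_pdivlMr ?exprn_gt0// => hq.
  apply: (@le_trans _ _ C0); last exact: ler_norm.
  apply: le_trans hq; rewrite mulrC ler_wpM2l ?(ltW q4)// -rt2 -exprM.
  by rewrite -[leLHS]expr1 ler_weXn2l.
apply: (@le_trans _ _ (\int[P]_w (4 * supnorm u ^+ 2)%:E)%E).
  apply: le_integral_ge0.
  - by apply: measurable_funX; exact: (measurable_site_diff P).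
  - by move=> w; exact: sqr_ge0.
  - exact: measurable_cst.
  - by move=> w; exact: site_diff_trivial.
rewrite integral_cst// [X in (_ * X)%E]probability_setT mule1 lee_fin.
have -> : 4 * (`|C0| / q ^+ 4) * supnorm u ^+ 2 / rt =
   4 * supnorm u ^+ 2 * (`|C0| / q ^+ 4 / rt) by ring.
by rewrite ler_peMr// mulr_ge0// sqr_ge0.
Qed.

End neg_overlap.

Theorem theorem1p1 (R : realType) (beta h q C0 : R) (hbeta : 0 < beta) (hq : q < 1)
  (Hyp : forall (N : nat) (d : measure_display) (T : measurableType d)
           (P : probability T R) (g : 'I_N -> 'I_N -> T -> R),
           (0 < N)%N -> SK_disorder P g ->
           (\int[P]_w
              (gavg2 beta h g (fun s1 s2 => (overlap s1 s2 - q) ^+ 4) w)%:E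
            <= (C0 / (N%:R ^+ 2))%:E)%E) :
  exists C : R, forall (N : nat) (d : measure_display) (T : measurableType d)
           (P : probability T R) (g : 'I_N -> 'I_N -> T -> R),
           (0 < N)%N -> SK_disorder P g ->
           forall (u : R -> R), measurable_fun setT u ->
           (exists M : R, forall x, `|u x| <= M) ->
           forall i : 'I_N,
           (\int[P]_w
              ((gavg1 beta h g (fun s => u (local_field g i w s)) w
                - nu_integral beta h g q u i w) ^+ 2)%:E
            <= (C * supnorm u ^+ 2 / Num.sqrt (N%:R))%:E)%E.
Proof.
have [q0|q0] := leP 0 q.
  (* [C] depends on q and beta only: it is obtained before N and the probability space are
     introduced. *)
  have [C C0ge hC] := bigauss_compare q beta q0 hq (ltW hbeta).
  exists (site_cst beta h q C0 C) => N d T P g N0 hSK u mu_ bu i.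
  exact: (site_diff_bound P beta h q C0 g i hSK q0 hq (Hyp N d T P g N0 hSK) u C mu_ bu C0ge hC).
exists (4 * (`|C0| / q ^+ 4)) => N d T P g N0 hSK u mu_ bu i.
exact: (site_diff_bound_neg P beta h q C0 g i hSK q0 (Hyp N d T P g N0 hSK) u hq mu_ bu).
Qed.
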